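(* Let $G$ be a connected graph that does not contain a cycle with a unique chord. Then either $G$ is strongly 2-bipartite, or $G$ is a hole of length at least 7, or $G$ is a clique, or $G$ is (isomorphic to) an induced subgraph of the Petersen graph or of the Heawood graph, or $G$ has a 1-cutset, a proper 2-cutset, or a proper 1-join.
   Context: All graphs are finite and simple. A graph $G$ contains a graph $H$ if $H$ is isomorphic to an induced subgraph of $G$; $G$ is $H$-free if it does not contain $H$. $G[S]$ is the subgraph of $G$ induced by $S\subseteq V(G)$. A cycle in $G$ is a sequence of nodes $v_1v_2\ldots v_nv_1$ ($n\ge 3$), distinct except for the first and last, with consecutive nodes adjacent; an edge of $G$ with both ends in the cycle that is not an edge of the cycle is a chord. $G$ does not contain a cycle with a unique chord if no cycle of $G$ has exactly one chord. A path in $G$ is always a chordless (induced) path; an $ab$-path is a path with ends $a,b$. A hole is a chordless cycle of length at least 4; a square is a hole of length 4. A clique here means a complete graph. Strongly 2-bipartite: a graph $G$ that is square-free and bipartite with bipartition $(X,Y)$ where $X$ is the set of all degree-2 nodes of $G$ and $Y$ is the set of all nodes of $G$ of degree at least 3. Petersen graph: nodes $a_1,\dots,a_5,b_1,\dots,b_5$, where $\{a_1,\dots,a_5\}$ and $\{b_1,\dots,b_5\}$ each induce a chordless 5-cycle in the natural order, and the only edges between the $a_i$'s and $b_i$'s are $a_1b_1,a_2b_4,a_3b_2,a_4b_5,a_5b_3$. Heawood graph: nodes $a_1,\dots,a_{14}$ forming a Hamiltonian cycle in the natural order, the only other edges being $a_1a_{10},a_2a_7,a_3a_{12},a_4a_9,a_5a_{14},a_6a_{11},a_8a_{13}$.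 1-cutset of a connected graph $G$: a node $v$ such that $V(G)$ can be partitioned into non-empty sets $X$, $Y$ and $\{v\}$ with no edge between $X$ and $Y$. Proper 2-cutset of a connected graph $G$: a pair of non-adjacent nodes $a,b$, both of degree at least three, such that $V(G)$ can be partitioned into non-empty sets $X$, $Y$, $\{a,b\}$ with $|X|\ge 2$, $|Y|\ge 2$, no edges between $X$ and $Y$, and both $G[X\cup\{a,b\}]$ and $G[Y\cup\{a,b\}]$ containing an $ab$-path. 1-join of $G$: a partition of $V(G)$ into sets $X,Y$ with $|X|\ge 2$, $|Y|\ge 2$, for which there are sets $\emptyset\ne A\subseteq X$, $\emptyset\ne B\subseteq Y$ such that all possible edges between $A$ and $B$ are present and there are no other edges between $X$ and $Y$. It is a proper 1-join if moreover $A$ and $B$ are stable sets of size at least two. *)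

(* Defs.v *)
From mathcomp Require Import all_boot.
Set Implicit Arguments.
Unset Strict Implicit.
Unset Printing Implicit Defensive.

Record sgraph := SGraph {
  vertex :> finType;
  adj : rel vertex;
  adj_sym : symmetric adj;
  adj_irr : irreflexive adj }.

Section InducedSubgraph.
Variables (G : sgraph) (S : {set G}).

Definition induced_adj : rel {x : G | x \in S} :=
  fun x y => adj (val x) (val y).

Lemma induced_sym : symmetric induced_adj.
Proof. by move=> x y; apply: adj_sym. Qed.

Lemma induced_irr : irreflexive induced_adj.
Proof. by move=> x; apply: adj_irr. Qed.

Definition induced : sgraph := SGraph induced_sym induced_irr.
End InducedSubgraph.

Definition isomorphic (G H : sgraph) : Prop :=
  exists f : G -> H, bijective f /\ forall x y, adj (f x) (f y) = adj x y.

Definition contains (G H : sgraph) : Prop :=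
  exists S : {set G}, isomorphic H (induced S).

Section GraphNotions.
Variable G : sgraph.
Implicit Types (X Y A B S : {set G}) (s : seq G).

(* The null graph counts as connected (and, below, as complete). *)
Definition connected : Prop := forall x y : G, connect (@adj G) x y.

Definition degree (x : G) : nat := #|[set y | adj x y]|.

Definition stable S : Prop := forall x y, x \in S -> y \in S -> ~~ adj x y.

Definition no_edges X Y : Prop :=
  forall x y, x \in X -> y \in Y -> ~~ adj x y.

Definition clique : Prop := forall x y : G, x != y -> adj x y.

Definition edges : {set {set G}} :=
  [set [set p.1; p.2] | p : G * G & adj p.1 p.2].

(* The cycle v_1 v_2 ... v_n v_1 is encoded as [:: v_1; ...; v_n]. *)
Definition is_cycle s : bool := (3 <= size s) && ucycleb (@adj G) s.

Definition cycle_edges s : {set {set G}} :=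
  [set [set x; next s x] | x in s].

Definition chords s : {set {set G}} :=
  [set E in edges | (E \subset s) && (E \notin cycle_edges s)].

Definition has_cycle_with_unique_chord : Prop :=
  exists s, is_cycle s /\ #|chords s| = 1.

Definition is_hole s : Prop :=
  [/\ is_cycle s, 4 <= size s & chords s = set0].

Definition square_free : Prop := ~ exists s, is_hole s /\ size s = 4.

(* G itself is a hole with at least n nodes. *)
Definition hole_graph_geq (n : nat) : Prop :=
  exists s, [/\ is_hole s, forall x : G, x \in s & n <= size s].

Definition bipartition X Y : Prop :=
  [/\ X :|: Y = setT, [disjoint X & Y], stable X & stable Y].

Definition strongly_2_bipartite : Prop :=
  square_free /\
  bipartition [set x : G | degree x == 2] [set x : G | 3 <= degree x].

(* Paths are induced: adjacent nodes of s are exactly its consecutive ones. *)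
Definition is_path s : Prop :=
  uniq s /\
  forall (x0 : G) i j, i < j < size s ->
    adj (nth x0 s i) (nth x0 s j) = (j == i.+1).

(* An ab-path of G[S], viewed as a path of G with all its nodes in S. *)
Definition has_path_in S (a b : G) : Prop :=
  exists p, [/\ is_path (a :: p), last a p = b & {subset a :: p <= S}].

Definition splits X Y S : Prop :=
  [/\ X :|: Y :|: S = setT,
      [disjoint X & Y], [disjoint X & S] & [disjoint Y & S]].

Definition one_cutset (v : G) : Prop :=
  exists X Y, [/\ splits X Y [set v], X != set0, Y != set0 & no_edges X Y].

Definition proper_2_cutset (a b : G) : Prop :=
  [/\ a != b, ~~ adj a b, 3 <= degree a & 3 <= degree b] /\
  exists X Y,
    [/\ splits X Y [set a; b], 2 <= #|X|, 2 <= #|Y| & no_edges X Y] /\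
    (has_path_in (X :|: [set a; b]) a b /\
     has_path_in (Y :|: [set a; b]) a b).

Definition one_join X Y A B : Prop :=
  [/\ X :|: Y = setT, [disjoint X & Y], 2 <= #|X| & 2 <= #|Y|] /\
  [/\ A != set0, A \subset X, B != set0, B \subset Y &
      forall x y, x \in X -> y \in Y -> adj x y = (x \in A) && (y \in B)].

Definition proper_one_join X Y A B : Prop :=
  one_join X Y A B /\
  [/\ stable A, stable B, 2 <= #|A| & 2 <= #|B|].

End GraphNotions.

Arguments connected : clear implicits.
Arguments clique : clear implicits.
Arguments has_cycle_with_unique_chord : clear implicits.
Arguments square_free : clear implicits.
Arguments hole_graph_geq : clear implicits.
Arguments strongly_2_bipartite : clear implicits.

Definition cyc_adj (n : nat) : rel 'I_n :=
  fun i j => (j == i.+1 %[mod n]) || (i == j.+1 %[mod n]).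

(* inl i is a_(i+1) and inr i is b_(i+1). *)
Definition petersen_ab : seq (nat * nat) :=
  [:: (1, 1); (2, 4); (3, 2); (4, 5); (5, 3)].

Definition petersen_adj : rel ('I_5 + 'I_5) := fun u v =>
  match u, v with
  | inl i, inl j | inr i, inr j => cyc_adj i j
  | inl i, inr j | inr j, inl i => (i.+1, j.+1) \in petersen_ab
  end.

Lemma cyc_adj_sym n : symmetric (@cyc_adj n).
Proof. by move=> i j; rewrite /cyc_adj orbC. Qed.

Lemma petersen_sym : symmetric petersen_adj.
Proof. by case=> i [] j //=; apply: cyc_adj_sym. Qed.

Lemma petersen_irr : irreflexive petersen_adj.
Proof. by case=> -[m lt_m]; do 5?[case: m lt_m => [|m] lt_m //]. Qed.

Definition petersen : sgraph := SGraph petersen_sym petersen_irr.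

(* i : 'I_14 is a_(i+1). *)
Definition heawood_chords : seq (nat * nat) :=
  [:: (1, 10); (2, 7); (3, 12); (4, 9); (5, 14); (6, 11); (8, 13)].

Definition heawood_adj : rel 'I_14 := fun i j =>
  [|| cyc_adj i j, (i.+1, j.+1) \in heawood_chords
    | (j.+1, i.+1) \in heawood_chords].

Lemma heawood_sym : symmetric heawood_adj.
Proof.
by move=> i j; rewrite /heawood_adj cyc_adj_sym; congr (_ || _); rewrite orbC.
Qed.

Lemma heawood_irr : irreflexive heawood_adj.
Proof. by case=> m lt_m; do 14?[case: m lt_m => [|m] lt_m //]. Qed.

Definition heawood : sgraph := SGraph heawood_sym heawood_irr.

(* Main.v *)
(* The tool used throughout is [unique_chord]: two disjoint anticomplete connected sets that
   both see the two ends of an edge yield a cycle with a unique chord. It shows that if G has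
   no 1-cutset then a maximal clique containing a triangle is the whole graph, and that a
   maximal complete bipartite subgraph containing a square gives a proper 1-join; so let G
   have no triangle, no square and no cutset.

   Two adjacent vertices of degree two lie in a maximal path of such vertices, whose
   attachments are a proper 2-cutset unless G is a hole. If instead some edge xy joins two
   vertices of degree at least three, the absence of 2-cutsets gives two disjoint
   connections between x and y (as in Menger's theorem). A shortest choice has exactly one
   edge zw between them: a cycle with two crossing chords xy and zw, that is, the Petersen
   graph minus two adjacent vertices with its four vertices of degree two blown up to
   connected sets.

   Such a blow-up exists for a last graph in the chain [cfgs], consisting of the Petersen and
   Heawood graphs minus at most three vertices of a path. If some blown-up set were not a
   single vertex with two neighbours, then, there being no 2-cutset, some vertex attached to
   this set would also see another part of the blow-up. A minimal connected set joined to
   three vertices has one of fourteen shapes, and a computation shows that each resulting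
   configuration has a triangle, a square or a cycle with a unique chord, or contains a blow-up
   of a later graph in the chain. Hence all sets are single vertices, and similarly no
   further vertex can be attached: G is a graph of the chain. *)
Require Import Defs.
From mathcomp Require Import all_boot zify.
From Stdlib Require Import Classical.
Set Implicit Arguments.
Unset Strict Implicit.
Unset Printing Implicit Defensive.

(** * Connected sets *)

(** The obstacle is that the sets of a blow-up have unbounded size, while the case analysis must be
    finite. It becomes finite because [unique_chord] asks only which connected sets see each other
    and which are anticomplete. A configuration records the certain links and the certain non-links;
    a pair in between is decided only when it matters. The searches for a cycle with a unique chord
    and for a later blow-up are not verified; their results are certificates, checked by [uc_check]
    and [accept_check].

    The blown-up positions are the neighbours of the deleted vertices. Each has lost one of three
    neighbours, so such a set has two single neighbours, and these form a 2-cutset unless something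
    else is attached to the set. The set is first enlarged as far as possible without seeing the
    other parts; the next vertex [q] then sees both the set and another part. A blown-up set that
    [q] sees has three single vertices around it, which is why [kinds] describes connected sets with
    three targets. *)

Lemma disjointI (T : finType) (A B : {set T}) :
  (forall z, z \in A -> z \in B -> False) -> [disjoint A & B].
Proof.
by move=> AB; rewrite disjoint_subset; apply/subsetP => z zA; rewrite inE; apply/negP/AB.
Qed.

Lemma not_uniq_split (T : eqType) (s : seq T) : ~~ uniq s ->
  exists s1 u s2 s3, s = s1 ++ u :: s2 ++ u :: s3.
Proof.
elim: s => //= u s IHs; rewrite negb_and negbK => /orP[us|/IHs].
  by exists [::], u; case/splitPr: us => s2 s3; exists s2, s3.
by case=> s1 [v [s2 [s3 ->]]]; exists (u :: s1), v, s2, s3.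
Qed.

Section Connectivity.
Variable G : sgraph.
Implicit Types (A B S T : {set G}) (x y z : G) (p q s : seq G).

Lemma mem_split x p : x \in p -> exists s s' : seq G, p = s ++ x :: s'.
Proof. by case/splitPr => s s'; exists s, s'. Qed.

Definition adj_in S : rel G := [rel x y | [&& adj x y, x \in S & y \in S]].
Definition conn S := [forall x in S, forall y in S, connect (adj_in S) x y].
Definition touch A B := [exists a in A, exists b in B, adj a b].
(** The component of [x] in the subgraph induced by [S]; it is empty when [x] lies outside [S]. *)
Definition compo S x := [set y in S | connect (adj_in S) x y].

Lemma adj_in_sym S : symmetric (adj_in S).
Proof. by move=> x y; rewrite /adj_in /= adj_sym [(x \in S) && _]andbC. Qed.

Lemma adj_inC S : connect_sym (adj_in S).
Proof. exact/sym_connect_sym/adj_in_sym. Qed.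

Lemma adj_neq x y : adj x y -> x != y.
Proof. by apply: contraTneq => ->; rewrite adj_irr. Qed.

Lemma touchP A B :
  reflect (exists a b, [/\ a \in A, b \in B & adj a b]) (touch A B).
Proof.
apply: (iffP exists_inP) => [[a aA /exists_inP[b bB ab]]|[a [b [aA bB ab]]]].
  by exists a, b.
by exists a => //; apply/exists_inP; exists b.
Qed.

Lemma touchI A B a b : a \in A -> b \in B -> adj a b -> touch A B.
Proof. by move=> aA bB ab; apply/touchP; exists a, b. Qed.

Lemma touchC A B : touch A B = touch B A.
Proof.
by apply/touchP/touchP => -[a [b [aA bB ab]]]; exists b, a; rewrite adj_sym.
Qed.

Lemma touch1P x B : reflect (exists2 b, b \in B & adj x b) (touch [set x] B).
Proof.
apply: (iffP (touchP _ _)) => [[a [b [/set1P-> bB ab]]]|[b bB xb]].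
  by exists b.
by exists x, b; rewrite set11.
Qed.

Lemma touchS A B A' B' : A \subset A' -> B \subset B' -> touch A B -> touch A' B'.
Proof.
move=> /subsetP sA /subsetP sB /touchP[a [b [aA bB ab]]].
by apply: touchI ab; [apply: sA | apply: sB].
Qed.

Lemma touchUl A B T : touch (A :|: B) T = touch A T || touch B T.
Proof.
apply/idP/orP => [/touchP[a [b [/setUP[] aA bB ab]]]|[] tAB].
- by left; apply: touchI ab.
- by right; apply: touchI ab.
- by apply: touchS tAB; rewrite ?subsetUl.
- by apply: touchS tAB; rewrite ?subsetUr.
Qed.

Lemma touchUr A B T : touch T (A :|: B) = touch T A || touch T B.
Proof. by rewrite touchC touchUl !(touchC T). Qed.

Lemma touch0 A : touch A set0 = false.
Proof. by apply/touchP => -[a [b []]]; rewrite inE. Qed.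

Lemma ntouchP A B :
  reflect (forall a b, a \in A -> b \in B -> adj a b = false) (~~ touch A B).
Proof.
apply: (iffP idP) => [nt a b aA bB|nt]; last first.
  by apply/touchP => -[a [b [aA bB ab]]]; rewrite nt in ab.
by apply: contraNF nt; apply: touchI.
Qed.

Lemma connP S : reflect {in S &, forall x y, connect (adj_in S) x y} (conn S).
Proof.
apply: (iffP forall_inP) => [cS x y xS yS|cS x xS].
  by have /forall_inP := cS x xS; apply.
by apply/forall_inP => y yS; apply: cS.
Qed.

Lemma conn_exit S A : conn S -> A \subset S -> A != set0 -> A != S ->
  exists x y, [/\ x \in A, y \in S :\: A & adj x y].
Proof.
move=> /connP cS sAS /set0Pn[x xA] neAS.
have [y yS yA] : exists2 y, y \in S & y \notin A.
  by apply/subsetPn; apply: contra neAS => sSA; rewrite eqEsubset sAS.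
have xS := subsetP sAS _ xA.
have /connectP[p] := cS x y xS yS; elim: p x xA {xS} => [|z p IHp] x xA /=.
  by move=> _ eyx; rewrite eyx xA in yA.
case/andP=> /and3P[xz _ zS]; have [zA|zA] := boolP (z \in A); first exact: IHp.
by exists x, z; rewrite inE zA.
Qed.

Lemma conn_cut S A : conn S -> A \subset S -> A != set0 ->
  (forall x y, x \in A -> y \in S -> adj x y -> y \in A) -> A = S.
Proof.
move=> cS sAS nA clA; apply/eqP; apply: contraT => neAS.
have [x [y [xA /setDP[yS yA] xy]]] := conn_exit cS sAS nA neAS.
by rewrite (clA x y) in yA.
Qed.

Lemma connI S :
  (forall A, A \subset S -> A != set0 ->
   (forall x y, x \in A -> y \in S -> adj x y -> y \in A) -> S \subset A) ->
  conn S.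
Proof.
move=> cutS; apply/connP => x y xS yS.
have sub : compo S x \subset S by apply/subsetP => z; rewrite inE => /andP[].
have /subsetP/(_ y yS) : S \subset compo S x; last by rewrite inE => /andP[].
apply: cutS => //; first by apply/set0Pn; exists x; rewrite inE xS connect0.
move=> u v; rewrite !inE => /andP[uS xu] vS uv; rewrite vS /=.
by apply: connect_trans xu (connect1 _); rewrite /adj_in /= uv uS vS.
Qed.

Lemma conn1 x : conn [set x].
Proof. by apply/connP => y z /set1P-> /set1P->. Qed.

Lemma conn0 : conn set0.
Proof. by apply/connP => y z; rewrite inE. Qed.

Lemma connU A B : conn A -> conn B -> (touch A B) || ~~ [disjoint A & B] ->
  conn (A :|: B).
Proof.
move=> cA cB AB; apply: connI => T sT nT clT.
have clA x y : x \in T :&: A -> y \in A -> adj x y -> y \in T :&: A.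
  move=> /setIP[xT xA] yA xy; rewrite inE yA (clT x) //.
  by rewrite inE yA.
have clB x y : x \in T :&: B -> y \in B -> adj x y -> y \in T :&: B.
  move=> /setIP[xT xB] yB xy; rewrite inE yB (clT x) //.
  by rewrite inE yB orbT.
have subA : T :&: A != set0 -> A \subset T.
  by move=> nTA; rewrite -(conn_cut cA _ nTA clA) ?subsetIl ?subsetIr.
have subB : T :&: B != set0 -> B \subset T.
  by move=> nTB; rewrite -(conn_cut cB _ nTB clB) ?subsetIl ?subsetIr.
suff [sA sB] : A \subset T /\ B \subset T by rewrite subUset sA.
have [nTA|nTB] : T :&: A != set0 \/ T :&: B != set0.
- have /set0Pn[x xT] := nT; have /setUP[xA|xB] := subsetP sT x xT.
    by left; apply/set0Pn; exists x; rewrite inE xT.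
  by right; apply/set0Pn; exists x; rewrite inE xT.
- have sA := subA nTA; split=> //; apply: subB; apply/set0Pn.
  have [/touchP[a [b [aA bB ab]]]|/pred0Pn[x /andP[xA xB]]] := orP AB.
    exists b; rewrite inE bB (clT a) ?inE ?bB ?orbT // (subsetP sA) //.
  by exists x; rewrite inE (subsetP sA).
have sB := subB nTB; split=> //; apply: subA; apply/set0Pn.
have [/touchP[a [b [aA bB ab]]]|/pred0Pn[x /andP[xA xB]]] := orP AB.
  exists a; rewrite inE aA (clT b) ?inE ?aA // 1?adj_sym // (subsetP sB) //.
by exists x; rewrite inE (subsetP sB).
Qed.

Lemma comp_sub S x : compo S x \subset S.
Proof. by apply/subsetP => z; rewrite inE => /andP[]. Qed.

Lemma mem_comp S x : x \in S -> x \in compo S x.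
Proof. by rewrite inE connect0 => ->. Qed.

Lemma comp_closed S x y z : y \in compo S x -> z \in S -> adj y z -> z \in compo S x.
Proof.
rewrite !inE => /andP[yS xy] zS yz; rewrite zS /=.
by apply: connect_trans xy (connect1 _); rewrite /adj_in /= yz yS zS.
Qed.

Lemma comp_conn S x : conn (compo S x).
Proof.
apply: connI => A sA /set0Pn[a aA] clA.
have aC := subsetP sA a aA; have := aC; rewrite inE => /andP[aS xa].
apply/subsetP => y; rewrite inE => /andP[yS xy].
have : connect (adj_in S) a y by apply: connect_trans xy; rewrite adj_inC.
case/connectP => p; elim: p a aA aC {aS xa} => [|z p IHp] a aA aC /=.
  by move=> _ ->.
case/andP=> /and3P[az _ zS] pz ely; have zC := comp_closed aC zS az.
by apply: IHp pz ely => //; apply: clA az.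
Qed.

Lemma conn_sub_comp S A x a :
  conn A -> A \subset S -> a \in A -> a \in compo S x -> A \subset compo S x.
Proof.
move=> cA sA aA aC; rewrite -(conn_cut (A := A :&: compo S x) cA) ?subsetIr ?subsetIl //.
  by apply/set0Pn; exists a; rewrite inE aA.
move=> u v /setIP[uA uC] vA uv; rewrite inE vA (comp_closed uC) //.
exact: (subsetP sA).
Qed.

Lemma comp_id S x y : y \in compo S x -> compo S y = compo S x.
Proof.
rewrite inE => /andP[yS xy]; apply/setP => z; rewrite !inE.
by rewrite (same_connect (adj_inC S) xy).
Qed.

(** A maximal connected proper subset of [S] containing [r] misses only one vertex: some vertex of
    [S] outside it sees it, and could be added otherwise. *)
Lemma conn_noncut S r : conn S -> r \in S -> S != [set r] ->
  exists v, [/\ v \in S, v != r & conn (S :\ v)].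
Proof.
move=> cS rS nSr.
pose P A := [&& conn A, A \subset S, r \in A & A != S].
have P1 : P [set r] by rewrite /P conn1 sub1set rS set11 eq_sym.
have [A /and4P[cA sA rA nA] maxA] := arg_maxnP (fun A : {set G} => #|A|) P1.
have [|x [v [xA /setDP[vS vA] xv]]] := conn_exit cS sA _ nA.
  by apply/set0Pn; exists r.
exists v; split=> //; first by apply: contraNneq vA => ->.
suff -> : S :\ v = A by [].
suff eS : A :|: [set v] = S.
  by rewrite -eS setDUl setDv setU0; apply/setDidPl; rewrite disjoint_sym disjoints1.
apply/eqP; apply: contraT => nAv.
have /maxA : P (A :|: [set v]).
  rewrite /P connU ?conn1 //=; last by rewrite (touchI xA (set11 v) xv).
  by rewrite subUset sA sub1set vS inE rA.
by rewrite setUC cardsU1 vA /= add1n ltnn.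
Qed.

Lemma path_conn x p : path (@adj G) x p -> conn [set:: x :: p].
Proof.
elim: p x => [|y p IHp] x /=.
  by move=> _; rewrite set_cons set_nil setU0 conn1.
case/andP=> xy /IHp cp; rewrite set_cons.
by apply: connU => //; rewrite ?conn1 // (touchI (set11 x) _ xy) // inE mem_head.
Qed.

Lemma conn_path S x y : conn S -> touch [set x] S -> touch [set y] S ->
  exists p, [/\ p != [::], path (@adj G) x (rcons p y) & {subset p <= S}].
Proof.
move=> /connP cS /touch1P[a aS xa] /touch1P[b bS yb].
have /connectP[p ap lp] := cS a b aS bS.
exists (a :: p); split=> //=.
  rewrite xa rcons_path -lp [adj b y]adj_sym yb andbT.
  by apply: sub_path ap => u v /and3P[].
move=> z; rewrite inE => /predU1P[-> //|].
elim: p a ap {aS xa lp} => //= u p IHp a /andP[/and3P[_ _ uS] pu].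
by rewrite inE => /predU1P[->|]; last exact: IHp pu.
Qed.

(** A list of least length among those with nonempty interior in [S]. As the interior must not be
    empty, the edge [xy], if present, is no shortcut; this is the exception in the last clause. *)
Lemma induced_path S x y : conn S -> touch [set x] S -> touch [set y] S ->
  exists p, [/\ p != [::], path (@adj G) x (rcons p y), {subset p <= S}, uniq p &
  forall s1 u s2 v s3, x :: rcons p y = s1 ++ u :: s2 ++ v :: s3 -> adj u v ->
    s2 = [::] \/ (s1 = [::] /\ s3 = [::])].
Proof.
move=> cS xS yS.
pose P n := [exists p : n.-tuple G,
  [&& tval p != [::], path (@adj G) x (rcons p y) & all [in S] p]].
have exP : exists n, P n.
  have [p [p0 xp pS]] := conn_path cS xS yS.
  exists (size p); apply/existsP; exists (in_tuple p).
  by rewrite p0 xp /=; apply/allP.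
case: (ex_minnP exP) => n /existsP[[p /= /eqP szp] /and3P[p0 xp pS]] minp.
have minP q : q != [::] -> path (@adj G) x (rcons q y) -> all [in S] q -> n <= size q.
  by move=> q0 xq qS; apply/minp/existsP; exists (in_tuple q); rewrite q0 xq.
exists p; split=> //; first exact/allP.
  apply: contraT => /not_uniq_split[s1 [u [s2 [s3 ep]]]].
  have : n <= size (s1 ++ u :: s3).
    move: xp pS; rewrite ep !rcons_cat !cat_path /= !rcons_cat !cat_path /= !all_cat /=
      all_cat /=.
    move=> /and4P[xs1 s1u us2 /andP[_ us3]] /and4P[s1S uS _ /andP[_ s3S]].
    by apply: minP; rewrite ?rcons_cat ?cat_path /= ?all_cat /= ?xs1 ?s1u ?us3 ?s1S ?uS ?s3S
      //; case: (s1).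
  by rewrite -szp ep !size_cat /= !size_cat /= leqNgt; lia.
move=> s1 u [|w s2] v s3 es uv; [by left | right].
suff short q : q != [::] -> path (@adj G) x (rcons q y) -> all [in S] q -> size p <= size q.
  have cat0 (r : seq G) a r' : r ++ a :: r' != [::] by case: r.
  (* Three kinds of shortcut are excluded: from [x] into [p], from [p] to [y], and between two
     vertices of [p]. Each leaves a nonempty shorter list. *)
  case: s1 es => [|x1 s1] [ex]; case/lastP: s3 => [|s3 y1] //.
  - rewrite /= -rcons_cons -rcons_cat -rcons_cons => /rcons_inj[ep ey]; exfalso.
    move: xp pS (short (v :: s3) isT); rewrite ep /= rcons_cat cat_path all_cat /=.
    move=> /and4P[_ _ _ vs3] /and4P[_ _ vS s3S]; rewrite vS s3S ex uv vs3.
    by move=> /(_ isT isT); rewrite size_cat /=; lia.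
  - rewrite /= !cats1 -!rcons_cons -rcons_cat => /rcons_inj[ep ey]; exfalso.
    move: xp pS (short (rcons s1 u)); rewrite ep rcons_cat cat_path all_cat /=.
    move=> /and3P[xs1 s1u _] /and3P[s1S uS _]; rewrite -cats1 all_cat s1S /= uS.
    by rewrite -cats1 -catA cat_path xs1 /= s1u /= ey uv /= => /(_ (cat0 _ _ _) isT isT);
      rewrite !size_cat /=; lia.
  - rewrite /= -rcons_cons -rcons_cat -!rcons_cons -rcons_cat => /rcons_inj[ep ey]; exfalso.
    move: xp pS (short (s1 ++ u :: v :: s3)); rewrite ep !rcons_cat !cat_path !all_cat /=
      !rcons_cat !cat_path !all_cat /=.
    move=> /and4P[-> -> _ /and3P[_ _ ->]] /and5P[-> -> _ _ /andP[-> ->]]; rewrite uv.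
    by move=> /(_ (cat0 _ _ _) isT isT); rewrite !size_cat /= size_cat /=; lia.
by move=> q0 xq qS; rewrite szp; apply: minP.
Qed.
End Connectivity.

(** * Cycles with a unique chord *)

Lemma mem2_split (T : eqType) (s : seq T) a b : a \in s -> b \in s -> a != b ->
  exists s1 s2 s3, s = s1 ++ a :: s2 ++ b :: s3 \/ s = s1 ++ b :: s2 ++ a :: s3.
Proof.
case/splitPr => s1 s2; rewrite mem_cat inE => /or3P[|/eqP->|]; last 2 first.
- by rewrite eqxx.
- by case/splitPr => s3 s4 _; exists s1, s3, s4; left.
by case/splitPr => s3 s4 _; exists s3, s4, s2; right; rewrite -catA.
Qed.

Lemma set2_inj (T : finType) (x y z t : T) :
  [set x; y] = [set z; t] -> (x = z /\ y = t) \/ (x = t /\ y = z).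
Proof.
move=> e; have: x \in [set z; t] by rewrite -e set21.
have: y \in [set z; t] by rewrite -e set22.
have: z \in [set x; y] by rewrite e set21.
have: t \in [set x; y] by rewrite e set22.
by rewrite !in_set2 => /orP[]/eqP-> /orP[]/eqP-> /orP[]/eqP? /orP[]/eqP?; subst; auto.
Qed.

Section UniqueChord.
Variable G : sgraph.
Implicit Types (A B S T : {set G}) (x y z : G) (p q s : seq G).

Lemma set2C x y : [set x; y] = [set y; x].
Proof. by rewrite setUC. Qed.

Lemma cycle_edges_rot n s : uniq s -> cycle_edges (rot n s) = cycle_edges s.
Proof.
move=> us; apply/setP => E; apply/imsetP/imsetP => -[z zs ->]; exists z;
  by rewrite ?next_rot // ?mem_rot // -(mem_rot n).
Qed.

Lemma mem_cycle_edges s1 a b s2 : uniq (s1 ++ a :: b :: s2) ->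
  [set a; b] \in cycle_edges (s1 ++ a :: b :: s2).
Proof.
move=> us; rewrite -(cycle_edges_rot (size s1) us) rot_size_cat.
apply/imsetP; exists a; first by rewrite mem_head.
by rewrite /= eqxx.
Qed.

Lemma next_head s1 a b s2 : uniq (s1 ++ a :: b :: s2) ->
  next (s1 ++ a :: b :: s2) a = b.
Proof.
by move=> us; rewrite -(next_rot (size s1) us) rot_size_cat /= eqxx.
Qed.

Lemma cycle_chord x y p q a b (s := x :: p ++ y :: q) :
  uniq s -> adj a b -> a \in x :: rcons p y -> b \in x :: rcons p y ->
  (forall s1 u s2 v s3, x :: rcons p y = s1 ++ u :: s2 ++ v :: s3 -> adj u v ->
    s2 = [::] \/ (s1 = [::] /\ s3 = [::])) ->
  [set a; b] \in cycle_edges s \/ [set a; b] = [set x; y].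
Proof.
move=> us ab ap bp ind.
have es : s = (x :: rcons p y) ++ q by rewrite /s /= cat_rcons.
suff key u v s1 s2 s3 : x :: rcons p y = s1 ++ u :: s2 ++ v :: s3 -> adj u v ->
    [set u; v] \in cycle_edges s \/ [set u; v] = [set x; y].
  have [s1 [s2 [s3 [e|e]]]] := mem2_split ap bp (adj_neq ab); first exact: key e ab.
  by rewrite set2C; apply: key e _; rewrite adj_sym.
move=> e uv; have [s20|[s10 s30]] := ind _ _ _ _ _ e uv.
  move: us; rewrite es e s20 /= -catA /= => us; left; exact: mem_cycle_edges.
right; move: e; rewrite s10 s30 /= cats1 -rcons_cons -!rcons_cons => -[-> /rcons_inj[_ ->]].
by [].
Qed.

(** Shortest connections of [x] and [y] through [A] and through [B] form a cycle. A chord other than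
    [xy] cannot run between [A] and [B], so both its ends lie on one of the two arcs, which it would
    shorten. *)
Lemma unique_chord x y A B : adj x y -> conn A -> conn B -> [disjoint A & B] ->
  touch [set x] A -> touch [set y] A -> touch [set x] B -> touch [set y] B ->
  ~~ touch A B -> has_cycle_with_unique_chord G.
Proof.
move=> xy cA cB dAB xA yA xB yB nAB.
have out (z : G) : touch [set z] A -> touch [set z] B -> (z \notin A) && (z \notin B).
  move=> zA zB; rewrite -!sub1set; apply/andP; split; apply: contra nAB => zS.
    by apply: touchS zB.
  by rewrite touchC; apply: touchS zA.
have /andP[nxA nxB] := out x xA xB; have /andP[nyA nyB] := out y yA yB.
have [p [p0 px pA up pind]] := induced_path cA xA yA.
have [q [q0 qy qB uq qind]] := induced_path cB yB xB.
pose s := x :: p ++ y :: q.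
have xp : x \notin p by apply: contra nxA => /pA.
have yp : y \notin p by apply: contra nyA => /pA.
have xq : x \notin q by apply: contra nxB => /qB.
have yq : y \notin q by apply: contra nyB => /qB.
have us : uniq s.
  rewrite /s /= mem_cat inE !negb_or xp xq (adj_neq xy) /= cat_uniq up /= yq uq andbT.
  rewrite negb_or yp /= ?andbT; apply/hasPn => z /qB zB /=.
  by apply: contraTN zB => /pA zA; rewrite (disjointFr dAB).
have cs : is_cycle s.
  rewrite /is_cycle /ucycleb us andbT /s; apply/andP; split.
    by rewrite /= size_cat /=; move: p0 q0; rewrite -!size_eq0 -!lt0n;
      case: (size p) => // n _; case: (size q) => // m _; rewrite addnS.
  by rewrite /= rcons_cat /= -cat_rcons cat_path px last_rcons.
have es : rot (size (x :: p)) s = y :: q ++ x :: p by rewrite /s -cat_cons rot_size_cat.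
exists s; split=> //; apply/eqP/cards1P; exists [set x; y]; apply/setP => E.
rewrite !inE; apply/and3P/eqP => [[/imsetP[[a b] ab ->] /subsetP sE nE]|->] /=; last first.
  split; [by apply/imsetP; exists (x, y); rewrite ?inE | | ].
    by apply/subsetP => z; rewrite in_set2 /s => /orP[]/eqP->;
      rewrite !inE ?mem_cat ?inE eqxx ?orbT.
  (* The pair [xy] is no edge of the cycle: the successor of [x] lies in [A] and that of [y] in
     [B]. *)
  apply/imsetP => -[z zs e].
  have [[ez ey]|[ey ez]] := set2_inj e.
    have [p1 [p' ep]] : exists (p1 : G) p', p = p1 :: p' by case: (p) p0 => // u v; exists u, v.
    have nx : next s x = p1.
      by rewrite /s ep; apply: (@next_head [::]); move: us; rewrite /s ep.
    by rewrite -ez nx in ey; rewrite ey pA ?ep ?mem_head in nyA.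
  have [q1 [q' eq]] : exists (q1 : G) q', q = q1 :: q' by case: (q) q0 => // u v; exists u, v.
  have ny : next s y = q1.
    by rewrite /s eq -cat_cons; apply: next_head; move: us; rewrite /s eq.
  by rewrite -ez ny in ey; rewrite ey qB ?eq ?mem_head in nxB.
rewrite inE /= in ab *; rewrite /= in sE nE.
have as' : a \in s by apply: sE; rewrite set21.
have bs' : b \in s by apply: sE; rewrite set22.
have mem_s z : (z \in s) = (z \in x :: rcons p y) || (z \in q).
  by rewrite /s /= -cat_rcons -cat_cons mem_cat.
have mem_s' z : (z \in s) = (z \in y :: rcons q x) || (z \in p).
  by rewrite -(mem_rot (size (x :: p))) es -cat_rcons -cat_cons mem_cat.
have done1 : a \in x :: rcons p y -> b \in x :: rcons p y -> [set a; b] = [set x; y].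
  move=> ap bp; have [] := cycle_chord us ab ap bp pind => // inE'.
  by rewrite inE' in nE.
have done2 : a \in y :: rcons q x -> b \in y :: rcons q x -> [set a; b] = [set x; y].
  move=> aq bq; have us' : uniq (y :: q ++ x :: p) by rewrite -es rot_uniq.
  have [|->] := cycle_chord us' ab aq bq qind; last exact: set2C.
  by rewrite -es cycle_edges_rot // => inE'; rewrite inE' in nE.
have [ap|nap] := boolP (a \in x :: rcons p y).
  have [bp|nbp] := boolP (b \in x :: rcons p y); first exact: done1.
  have bq : b \in q by rewrite mem_s (negPf nbp) in bs'.
  have [aq|naq] := boolP (a \in y :: rcons q x).
    by apply: done2 => //; rewrite inE mem_rcons inE bq !orbT.
  have ap' : a \in p by rewrite mem_s' (negPf naq) in as'.
  by case/negP: nAB; apply: touchI ab; [apply: pA | apply: qB].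
have aq : a \in q by rewrite mem_s (negPf nap) in as'.
have [bq|nbq] := boolP (b \in y :: rcons q x).
  by apply: done2 => //; rewrite inE mem_rcons inE aq !orbT.
have bp' : b \in p by rewrite mem_s' (negPf nbq) in bs'.
by case/negP: nAB; rewrite touchC; apply: touchI ab; [apply: qB | apply: pA].
Qed.

Lemma conn_has_path S A a b : a != b -> ~~ adj a b -> a \notin A -> b \notin A ->
  conn A -> touch [set a] A -> touch [set b] A -> A \subset S ->
  has_path_in (S :|: [set a; b]) a b.
Proof.
move=> nab ab aA bA cA taA tbA sAS.
have [p [p0 px pA up pind]] := induced_path cA taA tbA.
exists (rcons p b); split; last 2 first.
- by rewrite last_rcons.
- move=> z; rewrite inE mem_rcons !inE => /or3P[->|->|/pA/(subsetP sAS)->] //=;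
    by rewrite !orbT.
split.
  rewrite /= mem_rcons inE negb_or nab rcons_uniq up andbT.
  by apply/andP; split; [apply: contra aA => /pA | apply: contra bA => /pA].
move=> x0 i j /andP[ij js]; set t := a :: rcons p b in js *.
have is_ : i < size t by apply: ltn_trans ij js.
have [ej|nej] := altP (j =P i.+1).
  have : path (@adj G) a (rcons p b) := px.
  by move/(pathP x0)/(_ i); rewrite ej in js *; apply.
apply/negP => aij.
have et : t = take i t ++ nth x0 t i :: (take (j - i.+1) (drop i.+1 t)) ++
    nth x0 t j :: drop j.+1 t.
  rewrite -{1}(cat_take_drop i t) (drop_nth x0 is_); congr (_ ++ _ :: _).
  rewrite -{1}(cat_take_drop (j - i.+1) (drop i.+1 t)) drop_drop subnK //; congr (_ ++ _).
  exact: drop_nth.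
case: (pind _ _ _ _ _ et aij) => [/(congr1 size)/= s0|[/(congr1 size)/= i0 /(congr1 size)/=
  j0]].
  case/negP: nej; rewrite eqn_leq ij andbT -subn_eq0 -s0 size_takel //.
  by move: js; rewrite /t /= size_drop size_rcons; clear; lia.
move: aij; rewrite size_takel ?(ltnW is_) // in i0.
have -> : j = (size t).-1.
  by move/eqP: j0; rewrite size_drop subn_eq0 => j0; apply/eqP;
    rewrite eqn_leq -ltnS (ltn_predK js) js /= -ltnS (ltn_predK js).
by rewrite i0 nth_last /= last_rcons (negPf ab).
Qed.
End UniqueChord.

(** * Cutsets, triangles and squares *)

Section Neighborhoods.
Variable G : sgraph.
Implicit Types (A B D S T X Y : {set G}) (x y z v : G).

Definition nbr D := [set y | (y \notin D) && touch [set y] D].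

Lemma nbrP D y : reflect (y \notin D /\ exists2 x, x \in D & adj x y) (y \in nbr D).
Proof.
rewrite inE; apply: (iffP andP) => -[-> ?]; split=> //.
  by have /touch1P[x xD yx] : touch [set y] D by []; exists x; rewrite // adj_sym.
by have [x xD xy] : exists2 x, x \in D & adj x y by []; apply/touch1P; exists x;
  rewrite // adj_sym.
Qed.

Lemma nbr_touch D y : y \in nbr D -> touch [set y] D.
Proof. by rewrite inE => /andP[]. Qed.

Lemma nbr_comp S x : nbr (compo S x) \subset ~: S.
Proof.
apply/subsetP => y /nbrP[yC [z zC zy]]; rewrite inE.
by apply: contra yC => yS; apply: comp_closed zy.
Qed.

(** Both conditions on cutsets mention one side [D] only, since every use starts from a set with few
    neighbours. *)
Definition no_1_cutset := forall v D, v \notin D -> D != set0 ->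
  nbr D \subset [set v] -> v |: D = setT.

Definition no_2_cutset := forall a b D, a != b -> ~~ adj a b ->
  3 <= degree a -> 3 <= degree b -> a \notin D -> b \notin D ->
  nbr D \subset [set a; b] -> 2 <= #|D| -> 2 <= #|~: (D :|: [set a; b])| -> False.

Lemma no_1_cutsetP : ~ (exists v : G, one_cutset v) -> no_1_cutset.
Proof.
move=> no v D vD D0 ND; apply/eqP; apply: contraT => nT; case: no; exists v.
exists D, (~: (v |: D)); split=> //.
- split.
  + by apply/setP => x; rewrite !inE; case: (x \in D); case: (x == v).
  + by rewrite disjoint_subset; apply/subsetP => x xD; rewrite !inE xD orbT.
  + by rewrite disjoint_sym disjoints1.
  + by rewrite disjoint_sym disjoints1 !inE eqxx.
- by apply: contra nT => /eqP e; rewrite -[_ |: _]setCK e setC0.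
move=> x y xD; rewrite !inE negb_or => /andP[yv yD]; apply: contra yv => xy.
by rewrite -in_set1; apply: (subsetP ND); apply/nbrP; split=> //; exists x.
Qed.

Section Cut.
Hypothesis nc1 : no_1_cutset.

Lemma conn_setC1 v : conn (~: [set v]).
Proof.
apply: connI => A sA nA clA; apply/subsetP => x; rewrite !inE => xv.
have vA : v \notin A by apply/negP => /(subsetP sA); rewrite !inE eqxx.
have /setP/(_ x) : v |: A = setT; last by rewrite !inE (negPf xv).
apply: nc1 => //; apply/subsetP => y /nbrP[yA [z zA zy]]; rewrite inE.
by apply: contraR yA => yv; apply: clA zy => //; rewrite !inE.
Qed.

Lemma comp_touch2 D a b : D != set0 -> nbr D \subset [set a; b] -> a != b ->
  a \notin D -> b \notin D -> touch [set a] D /\ touch [set b] D.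
Proof.
have H (u v : G) : D != set0 -> nbr D \subset [set u; v] -> u != v ->
    u \notin D -> v \notin D -> touch [set u] D.
  move=> D0 ND uv uD vD; apply: contraT => nu.
  have /setP/(_ u) : v |: D = setT; last by rewrite !inE (negPf uv) (negPf uD).
  apply: nc1 => //; apply/subsetP => y yN; have := subsetP ND y yN.
  rewrite !inE => /orP[/eqP eyu|->//]; by rewrite -eyu nbr_touch in nu.
by move=> D0 ND ab aD bD; split; [apply: H ab _ _ | apply: (H b a) => //;
  rewrite 1?set2C 1?eq_sym].
Qed.

Lemma comp2_touch a b x : x \notin [set a; b] -> a != b ->
  touch [set a] (compo (~: [set a; b]) x) /\ touch [set b] (compo (~: [set a; b]) x).
Proof.
move=> xab ab; set C := compo _ _; have sC : C \subset ~: [set a; b] := comp_sub _ _.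
apply: comp_touch2 ab _ _.
- by apply/set0Pn; exists x; apply: mem_comp; rewrite inE.
- by have := nbr_comp (~: [set a; b]) x; rewrite setCK.
- by apply/negP => /(subsetP sC); rewrite !inE eqxx.
- by apply/negP => /(subsetP sC); rewrite !inE eqxx orbT.
Qed.

(** The two paths that a proper 2-cutset requires are automatic: without 1-cutsets, every component
    of the complement of [[set a; b]] sees both [a] and [b]. *)
Lemma no_2_cutsetP : ~ (exists a b : G, proper_2_cutset a b) -> no_2_cutset.
Proof.
move=> no a b D ab nab da db aD bD ND D2 Y2; case: no; exists a, b; split=> //.
exists D, (~: (D :|: [set a; b])).
have path_in X x : x \in X -> x \notin [set a; b] ->
    compo (~: [set a; b]) x \subset X -> has_path_in (X :|: [set a; b]) a b.
  move=> xX xab sX; have [tA tB] := comp2_touch xab ab.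
  apply: conn_has_path tA tB sX => //; last exact: comp_conn.
    by apply/negP => /(subsetP (comp_sub _ _)); rewrite !inE eqxx.
  by apply/negP => /(subsetP (comp_sub _ _)); rewrite !inE eqxx orbT.
have sDC : D \subset ~: [set a; b].
  by apply/subsetP => x xD; rewrite !inE; apply/norP; split; apply: contraTneq xD => ->.
have clD x y : x \in D -> y \in ~: [set a; b] -> adj x y -> y \in D.
  move=> xD; rewrite inE => yab xy; apply: contraR yab => yD.
  by apply: (subsetP ND); apply/nbrP; split=> //; exists x.
split; last split.
- split=> //.
  + split; first by apply/setP => x; rewrite !inE; case: (x \in D); case: (x == a);
    case: (x == b).
    * by rewrite disjoint_subset; apply/subsetP => x xD; rewrite !inE xD.
    * by rewrite disjoint_subset; apply/subsetP => x /(subsetP sDC); rewrite !inE.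
    * by rewrite disjoint_subset; apply/subsetP => x; rewrite !inE negb_or => /andP[_ ->].
  + move=> x y xD; rewrite in_setC in_setU => /norP[yD yab]; apply: contra yD.
    by apply: clD => //; rewrite inE.
- have /card_gt0P[x xD] : 0 < #|D| by apply: leq_trans D2.
  have := subsetP sDC x xD; rewrite inE => xab; apply: (path_in _ x) => //.
  rewrite -(conn_cut (A := compo (~: [set a; b]) x :&: D) (comp_conn _ x)) ?subsetIl
    ?subsetIr //.
    by apply/set0Pn; exists x; rewrite inE xD mem_comp // inE.
  move=> u v /setIP[uC uD] vC uv; rewrite inE vC (clD u) //.
  exact: (subsetP (comp_sub _ _) _ vC).
have /card_gt0P[x] : 0 < #|~: (D :|: [set a; b])| by apply: leq_trans Y2.
rewrite in_setC in_setU => /norP[xD xab].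
apply: (path_in _ x) => //; first by rewrite in_setC in_setU negb_or xD.
rewrite -(conn_cut (A := compo (~: [set a; b]) x :\: D) (comp_conn _ x)) ?subsetDl //.
- apply/subsetP => y /setDP[/(subsetP (comp_sub _ _))]; rewrite in_setC => yab yD.
  by rewrite in_setC in_setU negb_or yD.
- by apply/set0Pn; exists x; rewrite inE xD mem_comp // inE.
move=> u v /setDP[uC uD] vC uv; rewrite inE vC andbT.
apply: contra uD => vD; apply: (clD v) => //; last by rewrite adj_sym.
exact: (subsetP (comp_sub _ _) _ uC).
Qed.
End Cut.

Lemma nbrU D E : nbr (D :|: E) \subset nbr D :|: nbr E.
Proof.
apply/subsetP => y /nbrP[]; rewrite in_setU => /norP[yD yE] [x /setUP[] xDE xy].
  by apply/setUP; left; apply/nbrP; split=> //; exists x.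
by apply/setUP; right; apply/nbrP; split=> //; exists x.
Qed.

(** Take a smallest connected subset with two attachments in [H]. If it has several vertices, remove
    one that leaves it connected: both this vertex and the rest have at most one attachment, so
    there are two altogether. *)
Lemma min_attach H D : conn D -> 2 <= #|nbr D :&: H| -> exists D',
  [/\ D' \subset D, conn D', D' != set0, 2 <= #|nbr D' :&: H| &
      (exists d, D' = [set d]) \/ #|nbr D' :&: H| = 2].
Proof.
move=> cD D2; pose P E := [&& conn E, E \subset D & 2 <= #|nbr E :&: H|].
have PD : P D by rewrite /P cD subxx.
have [E /and3P[cE sE E2] minE] := arg_minnP (fun A : {set G} => #|A|) PD.
have [r rE] : exists r, r \in E.
  have /card_gt0P[y /setIP[/nbrP[_ [r rE _]] _]] : 0 < #|nbr E :&: H| by apply: leq_trans E2.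
  by exists r.
exists E; split=> //; first by apply/set0Pn; exists r.
have [->|nE] := eqVneq E [set r]; [by left; exists r | right].
have [v [vE vr cEv]] := conn_noncut cE rE nE.
have small A : conn A -> A \subset E -> #|A| < #|E| -> #|nbr A :&: H| <= 1.
  move=> cA sA; apply: contraTT; rewrite -ltnNge -leqNgt => A2; apply: minE.
  by rewrite /P cA A2 (subset_trans sA).
have E1 : #|[set v]| < #|E|.
  by rewrite cards1 (cardsD1 v) vE (cardsD1 r) !inE eq_sym vr rE.
have le1 := small _ (conn1 v) _ E1; have le2 := small _ cEv (subsetDl _ _).
apply/eqP; rewrite eqn_leq E2 andbT.
apply: leq_trans (_ : #|(nbr [set v] :&: H) :|: (nbr (E :\ v) :&: H)| <= _).
  by rewrite -setIUl subset_leq_card // setSI // -{1}(setD1K vE) nbrU.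
apply: leq_trans (leq_card_setU _ _) _.
apply: (@leq_add _ _ 1 1); first by apply: le1; rewrite sub1set.
by apply: le2; rewrite [X in _ < X](cardsD1 v) vE.
Qed.
End Neighborhoods.

(** * Maximal cliques *)

Section Triangles.
Variable G : sgraph.
Implicit Types (K D E : {set G}) (x y z u v w : G).
Hypothesis nuc : ~ has_cycle_with_unique_chord G.
Hypothesis nc1 : no_1_cutset G.

(** A minimal connected set [E] outside a maximal clique [K] with two attachments in [K] misses some
    [u] in [K]: otherwise [E] is a vertex extending [K], or [K] has only two vertices. Two
    attachments of [E] are the ends of the chord, for the sets [E] and [[set u]]. *)
Lemma triangle_clique (a b c : G) : adj a b -> adj b c -> adj a c -> clique G.
Proof.
move=> ab bc ac.
pose P (K : {set G}) := (3 <= #|K|) && [forall x in K, forall y in K, (x != y) ==> adj x y].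
have PP K : reflect (3 <= #|K| /\ {in K &, forall x y, x != y -> adj x y}) (P K).
  apply: (iffP andP) => -[K3 cK]; split=> //.
    by move=> x y xK yK; move/forall_inP: cK => /(_ x xK)/forall_inP/(_ y yK)/implyP.
  by apply/forall_inP => x xK; apply/forall_inP => y yK; apply/implyP/cK.
have P0 : P [set a; b; c].
  apply/PP; split.
    have nca : c != a by rewrite eq_sym adj_neq.
    have ncb : c != b by rewrite eq_sym adj_neq.
    by rewrite setUC cardsU1 !inE negb_or nca ncb cards2 adj_neq.
  move=> x y; rewrite !inE => /orP[/orP[]|] /eqP-> /orP[/orP[]|] /eqP->;
    by rewrite ?eqxx ?ab ?bc ?ac // adj_sym ?ab ?bc ?ac.
have [K /PP[K3 cK] maxK] := arg_maxnP (fun A : {set G} => #|A|) P0.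
have [KT|nKT] := eqVneq K setT.
  by move=> x y; apply: cK; rewrite KT.
have [x xK] : exists x, x \notin K by apply/existsP; rewrite -negb_forall;
  apply: contra nKT => /forallP KT; apply/eqP/setP => y; rewrite inE KT.
pose D := compo (~: K) x.
have ND : nbr D \subset K by have := nbr_comp (~: K) x; rewrite setCK.
have D2 : 2 <= #|nbr D :&: K|.
  rewrite (setIidPl ND) ltnNge; apply/negP => D1.
  have [v vK sv] : exists2 v, v \in K & nbr D \subset [set v].
    have /card_gt0P[k kK] : 0 < #|K| by apply: leq_trans K3.
    have [/eqP D0|[v vD]] := set_0Vmem (nbr D).
      by exists k; rewrite // (eqP D0) sub0set.
    exists v; first exact: (subsetP ND).
    by rewrite -(eqP (_ : [set v] == nbr D)) // eqEcard sub1set vD cards1.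
  have /card_gt0P[w /setDP[wK]] : 0 < #|K :\: [set v]|.
    by rewrite -(ltn_add2l #|K :&: [set v]|) addn0 cardsID (leq_ltn_trans (subset_leq_card
      (subsetIr _ _))) // cards1; apply: leq_trans K3.
  rewrite inE => wv.
  have /setP/(_ w) : v |: D = setT.
    apply: nc1 sv; last by apply/set0Pn; exists x; rewrite mem_comp // inE.
    by apply/negP => /(subsetP (comp_sub _ _)); rewrite inE vK.
  by rewrite !inE (negPf wv) wK.
have [E [sE cE E0 E2 alt]] := min_attach (comp_conn _ _) D2.
have dEK w : w \in E -> w \notin K.
  by move=> /(subsetP sE)/(subsetP (comp_sub _ _)); rewrite inE.
have [u uK uE] : exists2 u, u \in K & u \notin nbr E.
  apply/subsetPn/negP => sKN; case: alt => [[d ed]|e2]; last first.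
    by move: K3; rewrite -e2 (setIidPr sKN) ltnn.
  have /maxK : P (d |: K).
    have adjd k : k \in K -> adj d k.
      by move=> kK; have /nbrP[_ [d']] := subsetP sKN k kK; rewrite ed inE => /eqP->.
    apply/PP; split; first by apply: leq_trans K3 _; rewrite subset_leq_card // subsetUr.
    move=> y z; rewrite !inE => /orP[/eqP->|yK] /orP[/eqP->|zK]; rewrite ?eqxx //.
    - by move=> _; apply: adjd.
    - by move=> _; rewrite adj_sym; apply: adjd.
    - exact: cK.
  have dK : d \notin K by apply: dEK; rewrite ed set11.
  by rewrite cardsU1 dK /= add1n ltnn.
have /card_gt1P[a' [b' [/setIP[aN aK] /setIP[bN bK] nab]]] := E2.
case: nuc; apply: (@unique_chord _ a' b' E [set u]);
  rewrite ?conn1 ?(nbr_touch aN) ?(nbr_touch bN) //.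
- exact: cK.
- by rewrite disjoint_sym disjoints1; apply: contraL uK => /dEK.
- apply: (touchI (set11 _) (set11 _)); apply: cK => //.
  by apply: contraNneq uE => <-.
- apply: (touchI (set11 _) (set11 _)); apply: cK => //.
  by apply: contraNneq uE => <-.
rewrite touchC; apply: contra uE => tu; rewrite inE tu andbT.
by apply: contraL uK => /dEK.
Qed.
End Triangles.

(** * Maximal complete bipartite subgraphs *)

Section Squares.
Variable G : sgraph.
Implicit Types (A B D E X Y : {set G}) (x y z v w p r : G).
Hypothesis nuc : ~ has_cycle_with_unique_chord G.
Hypothesis tri_free : forall x y z : G, adj x y -> adj y z -> adj x z = false.

Lemma square_join (a b c d : G) : adj a b -> adj b c -> adj c d -> adj d a ->
  a != c -> b != d -> exists X Y A B : {set G}, proper_one_join X Y A B.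
Proof.
move=> ab bc cd da nac nbd.
pose P (AB : {set G} * {set G}) := [&& 2 <= #|AB.1|, 2 <= #|AB.2| &
  [forall x in AB.1, forall y in AB.2, adj x y]].
have PP A B : reflect [/\ 2 <= #|A|, 2 <= #|B| & forall x y, x \in A -> y \in B -> adj x y]
  (P (A, B)).
  apply: (iffP and3P) => -[A2 B2 cAB]; split=> //.
    by move=> x y xA yB; move/forall_inP: cAB => /(_ x xA)/forall_inP/(_ y yB).
  by apply/forall_inP => x xK; apply/forall_inP => y yK; apply/cAB.
have P0 : P ([set a; c], [set b; d]).
  apply/PP; rewrite !cards2 nac nbd; split=> // x y; rewrite !inE.
  by move=> /orP[]/eqP-> /orP[]/eqP->; rewrite // adj_sym.
have [[A B] /PP[A2 B2 cAB] maxAB] := arg_maxnP (fun AB : {set G} * {set G} => #|AB.1| +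
  #|AB.2|) P0.
have {}maxAB A' B' : P (A', B') -> #|A'| + #|B'| <= #|A| + #|B| by move/maxAB.
have /card_gt0P[a0 a0A] : 0 < #|A| by apply: leq_trans A2.
have /card_gt0P[b0 b0B] : 0 < #|B| by apply: leq_trans B2.
have stA : stable A.
  move=> x y xA yA; apply/negP => xy.
  by have := tri_free xy (cAB y b0 yA b0B); rewrite cAB.
have stB : stable B.
  move=> x y xB yB; apply/negP => xy.
  have := tri_free (cAB _ _ a0A xB) xy; by rewrite cAB.
have dAB x : x \in A -> x \in B -> False.
  by move=> xA xB; have := cAB x x xA xB; rewrite adj_irr.
pose R := ~: (A :|: B).
(* In a minimal such set [E] a single vertex [p] sees [A] and a single vertex [p'] sees [B]. By
   maximality [p] misses some [a1] in [A] and [p'] some [b1] in [B]. An edge between a neighbour of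
   [p] in [A] and a neighbour of [p'] in [B] is then a unique chord for [E] and [[set a1; b1]]. *)
have key D : conn D -> D \subset R -> touch D A -> touch D B -> False.
  move=> cD sD tA tB.
  pose Q E := [&& conn E, E \subset D, touch E A & touch E B].
  have QD : Q D by rewrite /Q cD subxx tA tB.
  have [E /and4P[cE sE tEA tEB] minE] := arg_minnP (fun A : {set G} => #|A|) QD.
  have outE x : x \in E -> (x \notin A) && (x \notin B).
    by move=> /(subsetP sE)/(subsetP sD); rewrite !inE negb_or.
  have noboth x y z : x \in E -> y \in A -> z \in B -> adj x y -> adj x z -> False.
    by move=> xE yA zB xy xz; have := tri_free xy (cAB _ _ yA zB); rewrite xz.
  (* By minimality, a vertex [v] that can be removed without disconnecting [E] is the only one
     seeing [A] or the only one seeing [B]. Below this is used once avoiding a vertex that sees [A]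
     and once avoiding one that sees [B]. *)
  have uniqE v r : v \in E -> r \in E -> v != r -> conn (E :\ v) ->
      (forall w, w \in E -> touch [set w] A -> w = v) \/
      (forall w, w \in E -> touch [set w] B -> w = v).
    move=> vE rE vr cEv.
    have : ~~ Q (E :\ v).
      by apply/negP => /minE; rewrite [X in X <= _](cardsD1 v) vE ltnn.
    rewrite /Q cEv (subset_trans (subsetDl _ _) sE) /= negb_and.
    case/orP => nt; [left | right] => w wE tw; apply/eqP; apply: contraR nt => nwv;
      by apply: touchS tw; rewrite // sub1set !inE nwv.
  have [p [p' [pE p'E pA p'B [up up']]]] : exists p p', [/\ p \in E, p' \in E, touch [set p] A,
      touch [set p'] B & (forall w, w \in E -> touch [set w] A -> w = p) /\
      (forall w, w \in E -> touch [set w] B -> w = p')].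
    have /touchP[p [y [pE yA py]]] := tEA; have /touchP[p' [z [p'E zB pz]]] := tEB.
    have tp : touch [set p] A by apply: touchI py; rewrite ?set11.
    have tp' : touch [set p'] B by apply: touchI pz; rewrite ?set11.
    have npp : p != p' by apply: contraTneq pz => <-; apply/negP; apply: noboth py.
    have nE x : E != [set x].
      by apply: contra npp => /eqP eE; move: pE p'E; rewrite eE !inE => /eqP-> /eqP->.
    have [v [vE vp cv]] := conn_noncut cE pE (nE p).
    have uB : forall w, w \in E -> touch [set w] B -> w = v.
      by case: (uniqE v p vE pE vp cv) => // /(_ p pE tp) ep; rewrite ep eqxx in vp.
    have [v' [vE' vp' cv']] := conn_noncut cE p'E (nE p').
    have uA : forall w, w \in E -> touch [set w] A -> w = v'.
      by case: (uniqE v' p' vE' p'E vp' cv') => // /(_ p' p'E tp') ep; rewrite ep eqxx in vp'.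
    exists p, p'; split=> //; split=> w wE tw; first by rewrite (uA w) // (uA p).
    by rewrite (uB w) // (uB p').
  have /exists_inP[a1 a1A na1] : [exists a1 in A, ~~ adj p a1].
    apply: contraT; rewrite negb_exists_in => /forall_inP pall.
    have : P (A, p |: B).
      apply/PP; split=> //; first by apply: leq_trans B2 _; rewrite subset_leq_card ?subsetUr.
      move=> x y xA; rewrite !inE => /orP[/eqP->|]; last exact: cAB.
      by have := pall x xA; rewrite negbK adj_sym.
    have /andP[_ pB] := outE p pE.
    by move/maxAB; rewrite cardsU1 pB /= leq_add2l add1n ltnn.
  have /exists_inP[b1 b1B nb1] : [exists b1 in B, ~~ adj p' b1].
    apply: contraT; rewrite negb_exists_in => /forall_inP pall.
    have : P (p' |: A, B).
      apply/PP; split=> //; first by apply: leq_trans A2 _; rewrite subset_leq_card ?subsetUr.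
      move=> x y; rewrite !inE => /orP[/eqP->|] yB; last exact: cAB.
      by have := pall y yB; rewrite negbK.
    have /andP[pA' _] := outE p' p'E.
    by move/maxAB; rewrite cardsU1 pA' /= leq_add2r add1n ltnn.
  have /touch1P[y yA py] := pA; have /touch1P[z zB pz] := p'B.
  case: nuc; apply: (@unique_chord _ y z E [set a1; b1]) => //.
  - exact: cAB.
  - by apply: connU; rewrite ?conn1 // (touchI (set11 _) (set11 _) (cAB _ _ a1A b1B)).
  - rewrite disjoint_subset; apply/subsetP => w /outE/andP[wA wB]; rewrite !inE.
    by apply/norP; split; [apply: contraNneq wA | apply: contraNneq wB] => ->.
  - by apply: (touchI (set11 _) pE); rewrite adj_sym.
  - by apply: (touchI (set11 _) p'E); rewrite adj_sym.
  - by apply: (touchI (set11 _) (set22 _ _)); apply: cAB.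
  - by apply: (touchI (set11 _) (set21 _ _)); rewrite adj_sym; apply: cAB.
  apply/touchP => -[w [t [wE]]]; rewrite !inE => /orP[]/eqP-> wt.
    by case/negP: na1; rewrite -(up w) // (touchI (set11 _) a1A wt).
  by case/negP: nb1; rewrite -(up' w) // (touchI (set11 _) b1B wt).
(* The side [X] takes [A] and all outer components that see [A]; by [key] none of these sees [B]. *)
pose X := A :|: [set v in R | touch (compo R v) A].
have inX x : x \in X -> x \in A \/ [/\ x \in R, touch (compo R x) A & x \notin A].
  case/setUP; rewrite ?[x \in [set _ | _]]inE; [by left | case/andP=> xR tx; right].
  by split=> //; move: xR; rewrite ?inE; case/norP.
have sBY : B \subset ~: X.
  apply/subsetP => y yB; rewrite inE; apply/negP => /inX[yA|[]]; first exact: (dAB y).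
  by rewrite !inE yB orbT.
exists X, (~: X), A, B; split; last by split.
split; first split.
- exact: setUCr.
- by rewrite -subsets_disjoint.
- by apply: leq_trans A2 _; rewrite subset_leq_card ?subsetUl.
- by apply: leq_trans B2 _; rewrite subset_leq_card.
split=> //; [by apply/set0Pn; exists a0 | exact: subsetUl | by apply/set0Pn; exists b0 |].
move=> x y xX yY; apply/idP/andP => [xy|[]]; last exact: cAB.
have yA : y \notin A by apply: contraL yY => yA; rewrite !inE yA.
have yR : y \notin B -> y \in R by move=> yB; rewrite !inE negb_or yA.
have yX : y \notin X by rewrite -in_setC.
have [xA|[xR tx xA]] := inX x xX.
  split=> //; apply: contraR yX => /yR yR'; rewrite !inE in yR' *; rewrite yR' orbC.
  by rewrite (touchI (mem_comp _) xA) ?inE // adj_sym.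
have [yB|/yR yR'] := boolP (y \in B).
  case: (key (compo R x)) => //; rewrite ?comp_conn ?comp_sub //.
  by apply: touchI xy => //; apply: mem_comp.
case/negP: yX; apply/setUP; right; rewrite inE yR'.
by rewrite (@comp_id _ R x y) // (comp_closed (mem_comp xR)).
Qed.
End Squares.

(** * Computation with configurations *)

(* Unlike [has] and [all], these short-circuit under call-by-value evaluation. *)
Fixpoint any (T : Type) (f : T -> bool) s :=
  if s is x :: s' then (if f x then true else any f s') else false.
Fixpoint every (T : Type) (f : T -> bool) s :=
  if s is x :: s' then (if f x then every f s' else false) else true.
Definition memn (x : nat) := any (eqn x).

(* A configuration constrains connected disjoint vertex sets numbered from 0 (see
   [model]): [yes] lists, for each set, sets known to be joined to it by an edge, [may]
   those that can be, so that sets outside [may] are anticomplete; [sg] flags the sets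
   that are a single vertex. *)
Record cfg := Cfg { yes : seq (seq nat); may : seq (seq nat); sg : seq bool }.
Definition row (r : seq (seq nat)) i := nth [::] r i.
Definition sz c := size (sg c).
Definition single c i := nth false (sg c) i.
Definition linked c i j := memn j (row (yes c) i).
Definition apart c i j := ~~ memn j (row (may c) i).

(** A certificate that the union of the listed sets is connected: it can be built up from the end of
    the list. *)
Fixpoint ordered c L :=
  if L is i :: L' then
    if (if L' is [::] then true else any (linked c i) L') then ordered c L' else false
  else true.
(* Checks the hypotheses of [unique_chord] for the edge [x y] and the unions of the sets
   listed in [A] and [B]; everything down to [uc_search] only looks for candidates. *)
Definition uc_check c x y A B :=
  [&& single c x, single c y, linked c x y,
    all (fun i => i < sz c) A, all (fun i => i < sz c) B, ordered c A, ordered c B,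
    has (linked c x) A, has (linked c y) A, has (linked c x) B, has (linked c y) B &
    all (fun a => all (fun b => (a != b) && apart c a b) B) A].

Fixpoint grow fuel c bad L {struct fuel} :=
  if fuel is k.+1 then
    let new := undup (filter (fun w => if memn w L then false else ~~ memn w bad)
                             (flatten (map (row (yes c)) L))) in
    if new is [::] then L else grow k c bad (new ++ L)
  else L.
(** Once [P] is fixed as the first set, the second one is grown from a neighbour of [x] through
    everything that certainly does not touch [P]. *)
Definition uc_complete c x y P :=
  let bad := [:: x, y & P ++ flatten (map (row (may c)) P)] in
  any (fun v => if memn v bad then false else uc_check c x y P (grow (sz c) c bad [:: v]))
      (row (yes c) x).
Fixpoint uc_dfs fuel c x y (l : nat) P :=
  if fuel is k.+1 then
    if linked c l y then uc_complete c x y (l :: P) else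
    any (fun w => if eqn w x then false else if memn w P then false
           else if linked c x w then false
           else if any (fun p => linked c p w) P then false
           else uc_dfs k c x y w (l :: P)) (row (yes c) l)
  else false.
Definition uc_search c :=
  any (fun x => if single c x then
    any (fun y => if (if x < y then single c y else false) then
      any (fun p => if eqn p y then false else uc_dfs (sz c) c x y p [::]) (row (yes c) x)
      else false) (row (yes c) x)
    else false) (iota 0 (sz c)).

Definition snbr c i := filter (single c) (row (yes c) i).
Definition has_triangle c :=
  any (fun a => if single c a then
    any (fun b => any (fun d => linked c d a) (snbr c b)) (snbr c a)
    else false) (iota 0 (sz c)).
Definition has_square c :=
  any (fun a => if single c a then
    any (fun b => any (fun d => if eqn a d then false else
      any (fun e => if eqn e b then false else linked c e a) (snbr c d)) (snbr c b)) (snbr c a)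
    else false) (iota 0 (sz c)).
Definition refuted c :=
  if has_triangle c then true else if has_square c then true else uc_search c.

Definition upd (r : seq (seq nat)) i f := set_nth [::] r i (f (row r i)).
Definition link (e : nat * nat) r := upd (upd r e.1 (cons e.2)) e.2 (cons e.1).
Definition without j := filter (fun k => ~~ eqn k j).
Definition set_yes c i j := Cfg (link (i, j) (yes c)) (may c) (sg c).
Definition set_no c i j := Cfg (yes c) (upd (upd (may c) i (without j)) j (without i)) (sg c).
(* Case analysis on whether the set [q] is joined to each of the sets in [l]. *)
Fixpoint decide (leaf : cfg -> bool) q l c :=
  if l is i :: l' then
    if (let c1 := set_yes c q i in if refuted c1 then true else decide leaf q l' c1)
    then decide leaf q l' (set_no c q i) else false
  else if refuted c then true else leaf c.

(* A minimal connected set joined to three vertices numbered 5, 6, 7 splits into at most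
   five connected pieces numbered 0 to 4 in one of the ways listed in [kinds]; a kind gives
   the pieces that are single vertices, the pairs joined by an edge and the pairs about
   which nothing is known. *)
Definition kind := (seq bool * seq (nat * nat) * seq (nat * nat))%type.
(** A centre [0] with legs [1], [2] and [3]. A flag tells whether a leg is nonempty; an empty leg is
    an edge from the centre to the target. *)
Definition claw_kind (b : bool * bool * bool) : kind :=
  let leg (b : bool) i := if b then [:: (0, 1 + i); (1 + i, 5 + i)] else [:: (0, 5 + i)] in
  ([:: true; false; false; false; false], leg b.1.1 0 ++ leg b.1.2 1 ++ leg b.2 2, [::]).
(** Two anticomplete sets that share one target; the pieces 2, 3 and 4 are empty. The shared target
    is 5 or 6, as [fork_kind] takes care of target 7. *)
Definition pair_kind j : kind :=
  (nseq 5 false, [:: (0, 5); (0, 6); (1, 5 + j); (1, 7)], [::]).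
(** The vertices [0] and [2] both see target 7 and are joined through the path [1], so these pieces
    close a cycle with the target. The legs [3] and [4] lead to targets 5 and 6 and may see 7 as
    well, whence the two undecided pairs. *)
Definition fork_kind (b : bool * bool) : kind :=
  ([:: true; false; true; false; false],
   [:: (0, 1); (1, 2); (0, 7); (2, 7)]
     ++ (if b.1 then [:: (0, 3); (3, 5)] else [:: (0, 5)])
     ++ (if b.2 then [:: (2, 4); (4, 6)] else [:: (2, 6)]),
   [:: (3, 7); (4, 7)]).
Definition bools := [:: false; true].
Definition kinds : seq kind :=
  [seq claw_kind b | b <- allpairs pair (allpairs pair bools bools) bools]
  ++ [:: pair_kind 0; pair_kind 1]
  ++ [seq fork_kind b | b <- allpairs pair bools bools].

Definition isolate m r := map (without m) (set_nth [::] r m [::]).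
Definition rename n m (ts : seq nat) i :=
  if i is i'.+1 then (if i < 5 then n + i' else nth 0 ts (i - 5)) else m.
(* The set [m] is replaced by its piece 0, the other pieces are appended at the end. *)
Definition split_node c m ts (k : kind) :=
  let ren := rename (sz c) m ts in
  let add r es := foldr link (isolate m r ++ nseq 4 [::]) [seq (ren e.1, ren e.2) | e <- es] in
  Cfg (add (yes c) k.1.2) (add (may c) (k.1.2 ++ k.2))
      (set_nth false (sg c) m (head false k.1.1) ++ behead k.1.1).
(** The order matters because the kinds are not symmetric: when the shared target is the last one,
    here [q], the fork kinds keep the path between the two pieces that see it. *)
Definition targets c m q := rcons (without q (row (yes c) m)) q.
Definition split_ok c m ts :=
  [&& size (yes c) == sz c, size (may c) == sz c, m < sz c, size ts == 3, uniq ts,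
    all (single c) ts, all (linked c m) ts, m \notin ts & all [in ts] (row (may c) m)].

(* [accept] looks for connected unions of sets of [c] that realize the configuration [T]. *)
Section Accept.
Variable T : cfg.
Definition part_ok c (L1 L2 : seq nat) (e : bool) :=
  if e then has (fun a => has (linked c a) L2) L1
  else all (fun a => all (apart c a) L2) L1.
Definition accept_check c (f : seq (seq nat)) :=
  [&& yes T == may T, all (all (fun i => i < sz T)) (yes T), size f == sz T, uniq (flatten
    f), all (all (fun i => i < sz c)) f, all (ordered c) f,
    all (fun i => single T i ==> if row f i is [:: v] then single c v else false)
        (iota 0 (sz T)) &
    all (fun i => all (fun j => if i == j then ~~ linked T i j
           else part_ok c (row f i) (row f j) (linked T i j)) (iota 0 (sz T))) (iota 0 (sz T))].
Fixpoint accept_search fuel c (parts : seq (seq nat)) (f : seq (seq nat)) :=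
  if eqn (size f) (sz T) then accept_check c f else
  if fuel is k.+1 then
    let i := size f in
    any (fun P =>
      if memn (head 0 P) (flatten f) then false
      else if (if single T i then (if P is [:: v] then single c v else false) else true) then
        if every (fun j => part_ok c (row f j) P (linked T j i)) (iota 0 i)
        then accept_search k c parts (rcons f P) else false
      else false) parts
  else false.
End Accept.
(** Candidates for the sets of a new blow-up: single vertices with three certain links stay alone,
    all other sets are merged along their links. The test [every (leq v) L] lists each merged class
    once, under its least member. *)
Definition parts c :=
  let branch i := if single c i then 2 < size (row (yes c) i) else false in
  let br := filter branch (iota 0 (sz c)) in
  map (cons^~ [::]) br ++
  pmap (fun v => if memn v br then None else
     let L := grow (sz c) c br [:: v] in
     if every (leq v) L then (if row (yes c) v is [::] then None else Some L) else None)
    (iota 0 (sz c)).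
Definition accept T c := let ps := parts c in
  if eqn (size ps) (sz T) then accept_search T (sz T) c ps [::] else false.

Fixpoint explore Ts q ms c :=
  if refuted c then true else
  if ms is m :: ms' then
    let ts := targets c m q in
    if split_ok c m ts then every (fun k => explore Ts q ms' (split_node c m ts k)) kinds
      else false
  else any (fun T => accept T c) Ts.

Definition graph_cfg n (E : seq (nat * nat)) :=
  let r := foldr link (nseq n [::]) E in Cfg r r [seq 2 < size (row r i) | i <- iota 0 n].
Definition heawood_edges : seq (nat * nat) :=
  [seq (i, i.+1 %% 14) | i <- iota 0 14] ++ [seq (e.1.-1, e.2.-1) | e <- heawood_chords].
Definition petersen_edges : seq (nat * nat) :=
  [seq (i, i.+1 %% 5) | i <- iota 0 5] ++ [seq (5 + i, 5 + i.+1 %% 5) | i <- iota 0 5]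
  ++ [seq (e.1.-1, 4 + e.2) | e <- petersen_ab].
(* The base graph minus its first [k] vertices, which form a path. Its vertices of degree
   two stand for connected sets. *)
Definition tail_graph n k (E : seq (nat * nat)) :=
  graph_cfg (n - k) [seq (e.1 - k, e.2 - k) | e <- E & (k <= e.1) && (k <= e.2)].
Definition cfgs := [:: tail_graph 10 2 petersen_edges; tail_graph 10 1 petersen_edges;
  tail_graph 14 3 heawood_edges; tail_graph 14 2 heawood_edges; tail_graph 14 1 heawood_edges;
  tail_graph 10 0 petersen_edges; tail_graph 14 0 heawood_edges].

Definition add_vertex c m :=
  let q := sz c in
  Cfg (link (m, q) (rcons (yes c) [::]))
      (foldr link (rcons (may c) [::]) [seq (q, i) | i <- iota 0 q])
      (rcons (sg c) true).
(* A new vertex joined to the set [m] of [T] and to a set that is not a neighbour of [m]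
   leads to a contradiction or to a configuration in [Ts]. *)
Definition mid_ok Ts T m := let q := sz T in
  let leaf c :=
    if every (fun j => if eqn j m then true else if linked T m j then true else apart c q j)
      (iota 0 q)
    then true
    else explore Ts q (filter (fun i => if single T i then false else linked c i q) (iota 0
      q)) c in
  let others := filter (fun i => ~~ eqn i m) (iota 0 q) in
  decide leaf q (filter (fun i => ~~ single T i) others ++ filter (single T) others)
    (add_vertex T m).
(** Only later entries may serve as outcomes, so moving from one configuration to the next
    terminates. *)
Fixpoint mids_ok Ts := if Ts is T :: Ts' then
    every (fun m => if single T m then true else mid_ok Ts' T m) (iota 0 (sz T)) && mids_ok
      Ts' else true.

Lemma anyE (T : Type) (f : T -> bool) s : any f s = has f s.
Proof. by elim: s => //= x s ->; case: (f x). Qed.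
Lemma everyE (T : Type) (f : T -> bool) s : every f s = all f s.
Proof. by elim: s => //= x s ->; case: (f x). Qed.
Lemma memnE x s : memn x s = (x \in s).
Proof. by rewrite /memn anyE -has_pred1; apply: eq_has => y; rewrite /= eq_sym. Qed.
Lemma anyP (T : eqType) (f : T -> bool) s : reflect (exists2 x, x \in s & f x) (any f s).
Proof. by rewrite anyE; apply: hasP. Qed.
Lemma everyP (T : eqType) (f : T -> bool) s : reflect {in s, forall x, f x} (every f s).
Proof. by rewrite everyE; apply: allP. Qed.
Lemma single_lt c i : single c i -> i < sz c.
Proof. by rewrite /single /sz; apply: contraLR; rewrite -leqNgt => ?; rewrite nth_default. Qed.

(** * Soundness of refutations *)

Section Soundness.
Variable G : sgraph.
Implicit Types (A B S X Y Z : {set G}) (x y z u v : G) (phi : nat -> {set G}).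
Hypothesis tri_free : forall x y z, adj x y -> adj y z -> adj x z = false.
Hypothesis sq_free : forall x y z t, adj x y -> adj y z -> adj z t -> adj t x ->
  x != z -> y != t -> False.
Hypothesis nuc : ~ has_cycle_with_unique_chord G.

Record model phi c : Prop := Model {
  model_conn : forall i, i < sz c -> conn (phi i);
  model_single : forall i, single c i -> exists v, phi i = [set v];
  model_disj : forall i j, i < sz c -> j < sz c -> i != j -> [disjoint phi i & phi j];
  model_linked : forall i j, i < sz c -> linked c i j -> j < sz c /\ touch (phi i) (phi j);
  model_apart : forall i j, i < sz c -> j < sz c -> i != j -> apart c i j ->
    ~~ touch (phi i) (phi j) }.

Definition region phi (L : seq nat) := \bigcup_(i <- L) phi i.

Lemma regionP phi L x : reflect (exists2 i, i \in L & x \in phi i) (x \in region phi L).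
Proof.
rewrite /region; elim: L => [|j L IHL]; first by rewrite big_nil inE; constructor; case.
rewrite big_cons in_setU; apply: (iffP orP) => [[xj|/IHL[i iL xi]]|[i]].
- by exists j; rewrite ?mem_head.
- by exists i; rewrite ?inE ?iL ?orbT.
by rewrite inE => /predU1P[-> ?|iL xi]; [left | right; apply/IHL; exists i].
Qed.

Lemma region_touch phi L A i : i \in L -> touch A (phi i) -> touch A (region phi L).
Proof.
move=> iL; apply: touchS => //; apply/subsetP => x xi; apply/regionP; by exists i.
Qed.

Lemma ordered_conn phi c L : model phi c -> all (fun i => i < sz c) L -> ordered c L ->
  conn (region phi L).
Proof.
move=> M; elim: L => [|i L IHL] /=; first by rewrite /region big_nil conn0.
move=> /andP[ic Lc]; rewrite /region big_cons.
case: L IHL Lc => [|j L] IHL Lc.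
  by move=> _; rewrite big_nil setU0; apply: model_conn M _ ic.
case: ifP => // /anyP[k kL ik] /(IHL Lc) cL; apply: connU => //.
  exact: model_conn M _ ic.
by have [_ tk] := model_linked M ic ik; rewrite (region_touch kL tk).
Qed.

Lemma uc_check_sound phi c (x y : nat) (A B : seq nat) : model phi c -> uc_check c x y A B ->
  False.
Proof.
move=> M /and5P[sx sy xy Ac /and5P[Bc oA oB xA /and4P[yA xB yB AB]]].
have xc := single_lt sx; have yc := single_lt sy.
have [a pa] := model_single M sx; have [b pb] := model_single M sy.
have tch (z : nat) (L : seq nat) (v : G) : z < sz c -> phi z = [set v] -> has (linked c z) L
  -> touch [set v] (region phi L).
  move=> zc pz /hasP[k kL zk]; have [_] := model_linked M zc zk.
  by rewrite pz; apply: region_touch.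
have [_ tab] := model_linked M xc xy; rewrite pa pb in tab.
apply: nuc; apply: (@unique_chord _ a b (region phi A) (region phi B)).
- by have /touch1P[b' /set1P->] := tab.
- exact: ordered_conn M Ac oA.
- exact: ordered_conn M Bc oB.
- rewrite disjoint_subset; apply/subsetP => v /regionP[i iA vi]; rewrite inE.
  apply/regionP => -[j jB vj]; move/allP: AB => /(_ i iA)/allP/(_ j jB)/andP[ij _].
  have := model_disj M (allP Ac _ iA) (allP Bc _ jB) ij.
  by move/disjointFr=> /(_ v vi); rewrite vj.
- exact: tch xc pa xA.
- exact: tch yc pb yA.
- exact: tch xc pa xB.
- exact: tch yc pb yB.
apply/touchP => -[v [w [/regionP[i iA vi] /regionP[j jB wj] vw]]].
move/allP: AB => /(_ i iA)/allP/(_ j jB)/andP[ij ap];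
  have := model_apart M (allP Ac _ iA) (allP Bc _ jB) ij ap.
by case/negP; apply: touchI vi wj vw.
Qed.

Lemma uc_dfs_sound phi c fuel (x y l : nat) (P : seq nat) : model phi c -> uc_dfs fuel c x y
  l P -> False.
Proof.
move=> M; elim: fuel l P => //= k IHk l P.
case: ifP => _.
  case/anyP => v _; case: ifP => // _; exact: (uc_check_sound M).
by case/anyP => w _; do 4?case: ifP => // _; apply: IHk.
Qed.

Lemma single_adj phi c i j : model phi c -> single c i -> single c j -> linked c i j ->
  exists u v, [/\ phi i = [set u], phi j = [set v] & adj u v].
Proof.
move=> M si sj ij; have [u pu] := model_single M si; have [v pv] := model_single M sj.
have [_] := model_linked M (single_lt si) ij; rewrite pu pv => /touch1P[w /set1P-> uv].
by exists u, v.
Qed.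

Lemma snbrP c i j : j \in snbr c i -> single c j /\ linked c i j.
Proof. by rewrite mem_filter /linked memnE => /andP[]. Qed.

Lemma set1_eq phi c i j u v : model phi c -> single c i -> single c j -> ~~ eqn i j ->
  phi i = [set u] -> phi j = [set v] -> u != v.
Proof.
move=> M si sj ij pu pv; have := model_disj M (single_lt si) (single_lt sj) ij.
by rewrite pu pv disjoints1 inE.
Qed.

Lemma refuted_sound phi c : model phi c -> refuted c -> False.
Proof.
move=> M; rewrite /refuted; case: ifP => [|_].
  case/anyP => a _; case: ifP => // sa /anyP[b /snbrP[sb ab] /anyP[d /snbrP[sd bd] da]].
  have [u [v [pu pv uv]]] := single_adj M sa sb ab.
  have [v' [w []]] := single_adj M sb sd bd; rewrite pv => /set1_inj <- pw vw.
  have [w' [u' []]] := single_adj M sd sa da; rewrite pw pu => /set1_inj <- /set1_inj <- wu.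
  by have := tri_free uv vw; rewrite adj_sym wu.
case: ifP => [|_].
  case/anyP => a _; case: ifP => // sa /anyP[b /snbrP[sb ab] /anyP[d /snbrP[sd bd]]].
  case: ifP => // /negbT nad /anyP[e /snbrP[se de]]; case: ifP => // /negbT neb ea.
  have [u [v [pu pv uv]]] := single_adj M sa sb ab.
  have [v' [w []]] := single_adj M sb sd bd; rewrite pv => /set1_inj <- pw vw.
  have [w' [t []]] := single_adj M sd se de; rewrite pw => /set1_inj <- pt wt.
  have [t' [u' []]] := single_adj M se sa ea; rewrite pt pu => /set1_inj <- /set1_inj <- tu.
  have uw := set1_eq M sa sd nad pu pw; have vt := set1_eq M se sb neb pt pv.
  by rewrite eq_sym in vt; move=> _; apply: (sq_free uv vw wt tu uw vt).
case/anyP => x _; case: ifP => // sx /anyP[y _]; case: ifP => // _ /anyP[p _].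
by case: ifP => // _; apply: uc_dfs_sound M.
Qed.
End Soundness.

(** * Minimal connected sets with three attachments *)

Lemma ex_min_nat (P : nat -> Prop) : (exists n, P n) ->
  exists2 n, P n & forall m, P m -> n <= m.
Proof.
case=> n; elim/ltn_ind: n => n IHn Pn.
have [[m [Pm mn]]|no] := classic (exists m, P m /\ m < n); first exact: IHn Pm.
by exists n => // m Pm; rewrite leqNgt; apply/negP => mn; case: no; exists m.
Qed.

Lemma split_first (T : eqType) (P : pred T) s : has P s ->
  exists s1 a s2, [/\ s = s1 ++ a :: s2, P a & ~~ has P s1].
Proof.
elim: s => //= x s IHs; case: (boolP (P x)) => /= [Px _|nPx /IHs].
  by exists [::], x, s.
by case=> s1 [a [s2 [-> Pa ns1]]]; exists (x :: s1), a, s2; rewrite /= (negPf nPx).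
Qed.

Section Tripod.
Variable G : sgraph.
Implicit Types (X Y Z : {set G}) (u v a b : G) (p q r s : seq G).
Hypothesis tri_free : forall x y z : G, adj x y -> adj y z -> adj x z = false.

(* A path inside [Z] from [u] to [X]; the vertex [u] itself is left out of the list. *)
Definition leg Z X u p :=
  [&& u \in Z, path (@adj G) u p, all [in Z] p & last u p \in X].

(** Three walks from a common root with least total length, over all roots. The facts below compare
    this length with that of a triple that is shortened or has another root. *)
Record tripod Z X0 X1 X2 u p0 p1 p2 : Prop := Tripod {
  leg0 : leg Z X0 u p0; leg1 : leg Z X1 u p1; leg2 : leg Z X2 u p2;
  leg_min : forall u' q0 q1 q2, leg Z X0 u' q0 -> leg Z X1 u' q1 -> leg Z X2 u' q2 ->
    size p0 + size p1 + size p2 <= size q0 + size q1 + size q2 }.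

Lemma tripod_swap Z X0 X1 X2 u p0 p1 p2 :
  tripod Z X0 X1 X2 u p0 p1 p2 -> tripod Z X1 X0 X2 u p1 p0 p2.
Proof.
case=> l0 l1 l2 lm; split=> // u' q0 q1 q2 h0 h1 h2.
by rewrite (addnC (size p1)) (addnC (size q0)); apply: lm h1 h0 h2.
Qed.

Lemma tripod_rot Z X0 X1 X2 u p0 p1 p2 :
  tripod Z X0 X1 X2 u p0 p1 p2 -> tripod Z X1 X2 X0 u p1 p2 p0.
Proof.
case=> l0 l1 l2 lm; split=> // u' q0 q1 q2 h0 h1 h2.
by have := lm u' q2 q0 q1 h2 h0 h1; lia.
Qed.

Lemma leg_exists Z t u : conn Z -> touch [set t] Z -> u \in Z ->
  exists p, leg Z [set z | adj z t] u p.
Proof.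
move=> /connP cZ /touch1P[z zZ tz] uZ; have /connectP[p up ez] := cZ u z uZ zZ.
exists p; rewrite /leg uZ inE -ez adj_sym tz andbT /=; elim: p u up {uZ ez} => //= v p IHp u.
by case/andP=> /and3P[-> _ ->] /IHp.
Qed.

Lemma tripod_exists Z t0 t1 t2 : conn Z -> touch [set t0] Z -> touch [set t1] Z ->
  touch [set t2] Z -> exists u p0 p1 p2,
  tripod Z [set z | adj z t0] [set z | adj z t1] [set z | adj z t2] u p0 p1 p2.
Proof.
set X0 := [set z | adj z t0]; set X1 := [set z | adj z t1]; set X2 := [set z | adj z t2].
move=> cZ tZ0 tZ1 tZ2.
pose P n := exists u p0 p1 p2, [/\ leg Z X0 u p0, leg Z X1 u p1, leg Z X2 u p2 &
  n = size p0 + size p1 + size p2].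
have [|n [u [p0 [p1 [p2 [l0 l1 l2 ->]]]]] minn] := @ex_min_nat P.
  have /touch1P[u uZ _] := tZ0.
  have [p0 l0] := leg_exists cZ tZ0 uZ; have [p1 l1] := leg_exists cZ tZ1 uZ.
  have [p2 l2] := leg_exists cZ tZ2 uZ.
  by exists (size p0 + size p1 + size p2), u, p0, p1, p2.
exists u, p0, p1, p2; split=> // u' q0 q1 q2 h0 h1 h2.
by apply: minn; exists u', q0, q1, q2.
Qed.

Lemma leg_cat Z X u s a s' : leg Z X u (s ++ a :: s') -> leg Z X a s'.
Proof.
rewrite /leg cat_path all_cat last_cat /=.
by case/and4P=> _ /and3P[_ _ ->] /and3P[_ -> ->].
Qed.

Lemma leg_cons Z X u a p : u \in Z -> adj u a -> leg Z X a p -> leg Z X u (a :: p).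
Proof. by rewrite /leg /= => -> -> /and4P[-> -> -> ->]. Qed.

(** Serves to move the root from [u] to a vertex [a] of a leg: the initial part of that leg,
    reversed, is put in front of another leg. *)
Lemma leg_back Z X Y u s a s' p : leg Z X u (s ++ a :: s') -> leg Z Y u p ->
  leg Z Y a (rcons (rev s) u ++ p).
Proof.
rewrite /leg cat_path all_cat last_cat /= => /and4P[uZ /and3P[us sa _] /and3P[sZ aZ _] _].
case/and4P=> _ up pZ lp; rewrite aZ cat_path all_cat last_cat last_rcons up pZ lp !andbT /=.
rewrite all_rcons all_rev uZ sZ andbT -rev_cons.
have -> : u :: s = belast u (rcons s a) by rewrite belast_rcons.
rewrite -{1}(last_rcons u s a) rev_path (eq_path (e' := @adj G)).
  by rewrite rcons_path us sa.
by move=> x y /=; rewrite adj_sym.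
Qed.

Lemma leg_shortcut Z X u s a r b s' : leg Z X u (s ++ a :: r ++ b :: s') -> adj a b ->
  leg Z X u (s ++ a :: b :: s').
Proof.
rewrite /leg !cat_path !all_cat !last_cat /= !cat_path !all_cat !last_cat /=.
move=> /and4P[-> /and3P[-> -> /and3P[_ _ ->]] /and3P[-> -> /and3P[_ -> ->]] ->] ->.
by [].
Qed.

Section Facts.
Variables (Z X0 X1 X2 : {set G}) (u : G) (p0 p1 p2 : seq G).
Hypothesis tp : tripod Z X0 X1 X2 u p0 p1 p2.

Lemma tripod_short q : leg Z X0 u q -> size p0 <= size q.
Proof. by move=> lq; have := leg_min tp lq (leg1 tp) (leg2 tp); lia. Qed.

Lemma tripod_end s a s' : p0 = s ++ a :: s' -> a \in X0 -> s' = [::].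
Proof.
move=> e aX; have := tripod_short (q := rcons s a).
rewrite e size_cat size_rcons /= => H; apply/eqP; rewrite -size_eq0.
have : size s + (size s').+1 <= (size s).+1.
  2: by rewrite addnS ltnS -{2}(addn0 (size s)) leq_add2l leqn0.
apply: H; have := leg0 tp; rewrite e /leg cat_path all_cat /= => /and4P[-> /and3P[us ua _]
  /and3P[sZ aZ _] _].
by rewrite rcons_path us ua all_rcons aZ sZ last_rcons.
Qed.

Lemma tripod_root : u \in X0 -> p0 = [::].
Proof.
move=> uX; apply/eqP; rewrite -size_eq0 -leqn0; apply: (tripod_short (q := [::])).
by rewrite /leg uX; have /and4P[-> _ _ _] := leg0 tp.
Qed.

Lemma tripod_uniq : uniq (u :: p0).
Proof.
apply: contraT => /(@not_uniq_split _ (u :: p0))[[|x s] [a [r [s']]]] [eu e].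
  have := leg0 tp; rewrite e => /leg_cat; rewrite -eu => /tripod_short.
  by rewrite e size_cat /=; lia.
have := tripod_short (q := s ++ a :: s').
have := leg0 tp; rewrite e /leg size_cat !cat_path !all_cat !last_cat /= cat_path all_cat
  last_cat /=.
move=> /and4P[-> /and4P[-> -> _ /andP[_ ->]] /and4P[-> -> _ /andP[_ ->]] ->] /(_ isT).
by rewrite !size_cat /=; lia.
Qed.

Lemma tripod_far s a s' : p0 = s ++ a :: s' -> s != [::] -> adj u a = false.
Proof.
move=> e s0; apply/negP => ua.
have : size p0 <= size (a :: s').
  apply: tripod_short; apply: leg_cons ua _; first by have /and4P[] := leg0 tp.
  by apply: (@leg_cat _ _ u s); rewrite -e (leg0 tp).
by rewrite e size_cat /=; case: (s) s0 => //= *; lia.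
Qed.

Lemma tripod_induced s a s' b c : p0 = s ++ a :: s' -> b \in s -> c \in s' -> adj b c = false.
Proof.
move=> e /mem_split[r [r' es]] /mem_split[w [w' es']]; rewrite es es' in e.
apply/negP => bc.
have e' : p0 = r ++ b :: (r' ++ a :: w) ++ c :: w' by rewrite e -!catA /= -?catA.
have := leg0 tp; rewrite e' => /leg_shortcut/(_ bc)/tripod_short.
by rewrite e' !size_cat /= !size_cat /=; lia.
Qed.

(** If [a = b], moving the root there is shorter. If [a] and [b] are adjacent, moving the root to
    [a] shows that [b] is the first vertex of its leg, and moving it to [b] shows the same for [a];
    then [u], [a], [b] form a triangle. *)
Lemma tripod_apart a b : a \in p0 -> b \in p1 -> (a != b) && ~~ adj a b.
Proof.
have [/and4P[uZ _ _ _] l0 l1 l2] := And4 (leg0 tp) (leg0 tp) (leg1 tp) (leg2 tp).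
case/mem_split=> s [s' e0]; case/mem_split=> r [r' e1].
rewrite e0 in l0; rewrite e1 in l1.
have a0 := leg_cat l0; have b1 := leg_cat l1.
have a2 := leg_back l0 l2; have b2 := leg_back l1 l2.
have sz0 : size p0 = size s + (size s').+1 by rewrite e0 size_cat.
have sz1 : size p1 = size r + (size r').+1 by rewrite e1 size_cat.
have aZ : a \in Z by case/and4P: a0.
have bZ : b \in Z by case/and4P: b1.
apply/andP; split; [apply/negP => /eqP eab | apply/negP => ab].
  rewrite -eab in b1; have := leg_min tp a0 b1 a2.
  by rewrite sz0 sz1 size_cat size_rcons size_rev; clear; lia.
have r0 : size r = 0.
  have := leg_min tp a0 (leg_cons aZ ab b1) a2.
  by rewrite sz0 sz1 size_cat size_rcons size_rev /=; clear; lia.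
have s0 : size s = 0.
  rewrite adj_sym in ab; have := leg_min tp (leg_cons bZ ab a0) b1 b2.
  by rewrite sz0 sz1 size_cat size_rcons size_rev /=; move: r0; clear; lia.
move: l0 l1; rewrite (size0nil r0) (size0nil s0) /leg /=.
move=> /and4P[_ /andP[ua _] _ _] /and4P[_ /andP[ub _] _ _].
by have := tri_free ua ab; rewrite ub.
Qed.

(** With the root moved to [a], the leg to [X1] is empty, while what [p0] loses is exactly what [p2]
    gains. *)
Lemma tripod_other a : a \in p0 -> a \in X1 -> p1 = [::].
Proof.
have [l0 l2] := conj (leg0 tp) (leg2 tp).
case/mem_split=> s [s' e0] aX; rewrite e0 in l0.
have a0 := leg_cat l0; have a2 := leg_back l0 l2.
have a1 : leg Z X1 a [::] by rewrite /leg /= aX; case/and4P: a0 => ->.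
have := leg_min tp a0 a1 a2; rewrite e0 !size_cat size_rcons size_rev /=.
by move=> ?; apply: size0nil; lia.
Qed.
End Facts.
End Tripod.

Ltac by_cases i j := 
  case: i => [|[|[|[|[|i]]]]]; case: j => [|[|[|[|[|[|[|[|j]]]]]]]] //=;
  try by case/andP.

(** * Pieces of a tripod that realize the kinds *)

Section Split.
Variable G : sgraph.
Implicit Types (A B X Y Z : {set G}) (u v a t : G) (p q r s : seq G) (psi : nat -> {set G}).
Hypothesis tri_free : forall x y z : G, adj x y -> adj y z -> adj x z = false.

(** Here [psi 0] to [psi 4] are the pieces, which need not cover [Z], and [psi 5] to [psi 7] are the
    targets. *)
Record local_model Z (k : kind) psi : Prop := LocalModel {
  lm_sub : forall i, i < 5 -> psi i \subset Z;
  lm_conn : forall i, i < 5 -> conn (psi i);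
  lm_single : forall i, nth false k.1.1 i -> exists v, psi i = [set v];
  lm_disj : forall i j, i < j < 5 -> [disjoint psi i & psi j];
  lm_edge : forall i j, (i, j) \in k.1.2 -> touch (psi i) (psi j);
  lm_non : forall i j, i < j < 8 -> i < 5 -> (i, j) \notin k.1.2 ++ k.2 ->
    ~~ touch (psi i) (psi j) }.

Lemma local_modelS Z Z' k psi : Z \subset Z' -> local_model Z k psi -> local_model Z' k psi.
Proof. by move=> sZ [? ? ? ? ? ?]; split=> // i i5; apply: subset_trans sZ; auto. Qed.

Lemma touch_seq p t : touch [set:: p] [set t] = has [in [set z | adj z t]] p.
Proof.
apply/touchP/hasP => [[a [b [+ /set1P-> ab]]]|[a ap]]; rewrite ?inE.
  by move=> ap; exists a; rewrite // inE.
by move=> ab; exists a, t; rewrite !inE ap.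
Qed.

Lemma touch_vertex u t : touch [set u] [set t] = adj u t.
Proof. by apply/touchP/idP => [[a [b [/set1P-> /set1P->]]]|ut] //; exists u, t;
  rewrite !set11. Qed.

Lemma ntouch_seqs p q : (forall a b, a \in p -> b \in q -> ~~ adj a b) ->
  ~~ touch [set:: p] [set:: q].
Proof. by move=> H; apply/ntouchP => a b; rewrite !inE => ap bq; apply/negbTE/H. Qed.

Lemma ntouch_vseq u p : (forall b, b \in p -> ~~ adj u b) -> ~~ touch [set u] [set:: p].
Proof. by move=> H; apply/ntouchP => a b; rewrite !inE => /eqP-> bq; apply/negbTE/H. Qed.

Lemma leg_conn Z X u p : leg Z X u p -> conn [set:: p].
Proof.
case/and4P=> _ up _ _; case: p up => [|a p] /=; first by rewrite set_nil conn0.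
by case/andP=> _ /path_conn.
Qed.

Lemma leg_sub Z X u p : leg Z X u p -> [set:: p] \subset Z.
Proof. by case/and4P=> _ _ /allP pZ _; apply/subsetP => x; rewrite inE => /pZ. Qed.

Lemma leg_head Z X u p : leg Z X u p -> p != [::] -> touch [set u] [set:: p].
Proof.
case/and4P=> _ + _ _; case: p => //= a p /andP[ua _] _.
by rewrite (touchI (set11 u) _ ua) // inE mem_head.
Qed.

Lemma leg_last Z t u p : leg Z [set z | adj z t] u p -> p != [::] -> touch [set:: p] [set t].
Proof.
case/and4P=> _ _ _; case/lastP: p => // p a; rewrite last_rcons touch_seq => aX _.
by apply/hasP; exists a; rewrite // mem_rcons mem_head.
Qed.

Lemma tripod_conn Z X0 X1 X2 u p0 p1 p2 s r : tripod Z X0 X1 X2 u p0 p1 p2 ->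
  p0 = s ++ r -> conn [set:: s] /\ conn [set:: r].
Proof.
move=> tp e; have /and4P[_ + _ _] := leg0 tp; rewrite e cat_path => /andP[us sr].
split; first by case: (s) us => [|x ?] /=; rewrite ?set_nil ?conn0 // => /andP[_ /path_conn].
by case: (r) sr => [|x ?] /=; rewrite ?set_nil ?conn0 // => /andP[_ /path_conn].
Qed.

Section Claw.
Variables (Z : {set G}) (t0 t1 t2 u : G) (p0 p1 p2 : seq G).
Notation X t := [set z | adj z t].
Hypothesis tp : tripod Z (X t0) (X t1) (X t2) u p0 p1 p2.

Let tp1 := tripod_rot tp.
Let tp2 := tripod_rot tp1.

Lemma tripod_ntouch01 : ~~ touch [set:: p0] [set:: p1].
Proof. by apply: ntouch_seqs => a b ap bq; case/andP: (tripod_apart tri_free tp ap bq). Qed.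

Lemma tripod_disj01 : [disjoint [set:: p0] & [set:: p1]].
Proof.
rewrite disjoint_subset; apply/subsetP => x; rewrite !inE => x0; apply/negP => x1.
by case/andP: (tripod_apart tri_free tp x0 x1); rewrite eqxx.
Qed.

Lemma tripod_center : [disjoint [set u] & [set:: p0]].
Proof. by rewrite disjoints1 inE; case/andP: (tripod_uniq tp). Qed.

Lemma tripod_flag : touch [set u] [set t0] = (p0 == [::]).
Proof.
rewrite touch_vertex; apply/idP/eqP => [ut|e].
  by apply: (tripod_root tp); rewrite inE.
by have := leg0 tp; rewrite e /leg inE => /and4P[].
Qed.
End Claw.

Definition claw_sets u p0 p1 p2 t0 t1 t2 :=
  nth set0 [:: [set u]; [set:: p0]; [set:: p1]; [set:: p2]; set0; [set t0]; [set t1]; [set t2]].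

Lemma claw_local Z t0 t1 t2 u p0 p1 p2 (X := fun t => [set z | adj z t]) :
  tripod Z (X t0) (X t1) (X t2) u p0 p1 p2 ->
  ~~ touch [set:: p0] [set t1] -> ~~ touch [set:: p0] [set t2] ->
  ~~ touch [set:: p1] [set t0] -> ~~ touch [set:: p1] [set t2] ->
  ~~ touch [set:: p2] [set t0] -> ~~ touch [set:: p2] [set t1] ->
  local_model Z (claw_kind (p0 != [::], p1 != [::], p2 != [::]))
    (claw_sets u p0 p1 p2 t0 t1 t2).
Proof.
move=> tp n01 n02 n10 n12 n20 n21; have tp1 := tripod_rot tp; have tp2 := tripod_rot tp1.
have d01 := tripod_disj01 tp; have d12 := tripod_disj01 tp1.
have d02 := tripod_disj01 tp2; rewrite disjoint_sym in d02.
have e01 := tripod_ntouch01 tp; have e12 := tripod_ntouch01 tp1.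
have e02 := tripod_ntouch01 tp2; rewrite touchC in e02.
have c0 := tripod_center tp; have c1 := tripod_center tp1; have c2 := tripod_center tp2.
have f0 := tripod_flag tp; have f1 := tripod_flag tp1; have f2 := tripod_flag tp2.
have l0 := leg0 tp; have l1 := leg1 tp; have l2 := leg2 tp.
have uZ : [set u] \subset Z by rewrite sub1set; case/and4P: l0.
have t0n := touch0 [set u]; have n0t t : ~~ touch set0 [set t] by rewrite touchC touch0.
have d0 (A : {set G}) : [disjoint A & set0] by rewrite disjoint_sym -setI_eq0 set0I.
rewrite /claw_sets; split.
- case=> [|[|[|[|[|i]]]]] //= _; rewrite ?sub0set ?(leg_sub l0) ?(leg_sub l1) ?(leg_sub l2) //.
- case=> [|[|[|[|[|i]]]]] //= _; rewrite ?conn0 ?conn1 ?(leg_conn l0) ?(leg_conn l1)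
  ?(leg_conn l2) //.
- by case=> [|[|[|[|[|i]]]]] //=; [exists u | rewrite nth_nil].
- by move=> i j; by_cases i j.
- move=> i j; rewrite /claw_kind /= !mem_cat => /or3P[]; case: eqVneq => q0 /=;
    rewrite !inE ?xpair_eqE; do ?[case/orP]; case/andP=> /eqP-> /eqP-> /=;
    rewrite ?f0 ?f1 ?f2 ?q0 //; (apply: leg_head || apply: leg_last); eassumption.
- move=> i j; by_cases i j; move=> _ _; rewrite /claw_kind /= !mem_cat;
    case: (eqVneq p0 [::]) => q0; case: (eqVneq p1 [::]) => q1;
      case: (eqVneq p2 [::]) => q2 //= _;
    rewrite ?f0 ?f1 ?f2 ?q0 ?q1 ?q2 ?set_nil ?touch0 ?[touch set0 _]touchC ?touch0 //.
Qed.

Lemma pair_local Z A B t0 t1 t2 (b : bool) (tj := if b then t1 else t0)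
    (tk := if b then t0 else t1) : A \subset Z -> B \subset Z -> conn A -> conn B ->
  [disjoint A & B] -> ~~ touch A B ->
  touch A [set t0] -> touch A [set t1] -> ~~ touch A [set t2] ->
  touch B [set tj] -> touch B [set t2] -> ~~ touch B [set tk] ->
  local_model Z (pair_kind b)
    (nth set0 [:: A; B; set0; set0; set0; [set t0]; [set t1]; [set t2]]).
Proof.
move=> sA sB cA cB dAB nAB A0 A1 nA2 Bj B2 nBk.
have d0 (C : {set G}) : [disjoint C & set0] by rewrite disjoint_sym -setI_eq0 set0I.
split.
- by case=> [|[|[|[|[|i]]]]] //= _; rewrite sub0set.
- by case=> [|[|[|[|[|i]]]]] //= _; rewrite conn0.
- by case=> [|[|[|[|[|i]]]]] //=; rewrite nth_nil.
- by move=> i j; by_cases i j.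
- move=> i j; rewrite /pair_kind /= !inE !xpair_eqE.
  by do ?[case/orP]; case/andP=> /eqP-> /eqP-> //=; move: Bj; rewrite /tj; case: (b).
- move=> i j; by_cases i j; rewrite ?touch0 ?[touch set0 _]touchC ?touch0 //.
  all: by move: nBk; rewrite /pair_kind /tk; case: (b).
Qed.

Lemma fork_local Z t0 t1 t2 a u (M L1 L2 : {set G}) (b1 := L1 != set0) (b2 := L2 != set0) :
  [set a] \subset Z -> M \subset Z -> [set u] \subset Z -> L1 \subset Z -> L2 \subset Z ->
  conn M -> conn L1 -> conn L2 ->
  [disjoint [set a] & M] -> [disjoint [set a] & [set u]] -> [disjoint [set a] & L1] ->
  [disjoint [set a] & L2] -> [disjoint M & [set u]] -> [disjoint M & L1] ->
  [disjoint M & L2] -> [disjoint [set u] & L1] -> [disjoint [set u] & L2] ->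
  [disjoint L1 & L2] ->
  touch [set a] M -> touch M [set u] -> touch [set a] [set t2] -> touch [set u] [set t2] ->
  (b1 -> touch [set a] L1) -> (b1 -> touch L1 [set t0]) -> touch [set a] [set t0] = ~~ b1 ->
  (b2 -> touch [set u] L2) -> (b2 -> touch L2 [set t1]) -> touch [set u] [set t1] = ~~ b2 ->
  ~~ touch [set a] [set u] -> ~~ touch [set a] L2 -> ~~ touch [set a] [set t1] ->
  ~~ touch M L1 -> ~~ touch M L2 ->
  ~~ touch M [set t0] -> ~~ touch M [set t1] -> ~~ touch M [set t2] ->
  ~~ touch [set u] L1 -> ~~ touch [set u] [set t0] -> ~~ touch L1 L2 ->
  ~~ touch L1 [set t1] -> ~~ touch L2 [set t0] ->
  local_model Z (fork_kind (b1, b2))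
    (nth set0 [:: [set a]; M; [set u]; L1; L2; [set t0]; [set t1]; [set t2]]).
Proof.
move=> sa sM su s1 s2 cM c1 c2 daM dau da1 da2 dMu dM1 dM2 du1 du2 d12.
move=> aM Mu at2 ut2 a1 l1t0 at0 u2 l2t1 ut1 nau na2 nat1 nM1 nM2 nM0' nM1' nM2' nu1 nu0 n12
  n1t1 n2t0.
split.
- by case=> [|[|[|[|[|i]]]]] //= _.
- by case=> [|[|[|[|[|i]]]]] //= _; rewrite conn1.
- case=> [|[|[|[|[|i]]]]] //=; rewrite ?nth_nil //; by [exists a | exists u].
- by move=> i j; by_cases i j.
- move=> i j; rewrite /fork_kind /= !inE !mem_cat !xpair_eqE.
  move: a1 l1t0 at0 u2 l2t1 ut1; case: (b1); case: (b2) => a1 l1t0 at0 u2 l2t1 ut1;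
    rewrite !inE !xpair_eqE; do ?[case/orP]; case/andP=> /eqP-> /eqP-> /=; auto.
- move=> i j; by_cases i j => _ _; rewrite /fork_kind /= !inE !mem_cat !xpair_eqE;
  move: a1 l1t0 at0 u2 l2t1 ut1; rewrite /b1 /b2; case: (eqVneq L1) => e1;
    case: (eqVneq L2) => e2;
  move=> a1 l1t0 at0 u2 l2t1 ut1; rewrite ?inE ?xpair_eqE //= => _;
  rewrite ?at0 ?ut1 ?e1 ?e2 ?touch0 ?[touch set0 _]touchC ?touch0 //.
Qed.
End Split.

Section Kinds.
Variable G : sgraph.
Implicit Types (A B X Y Z : {set G}) (u v a t : G) (p q r s : seq G) (psi : nat -> {set G}).
Hypothesis tri_free : forall x y z : G, adj x y -> adj y z -> adj x z = false.

(** Exchanges the roles of the targets 5 and 6, so that [tripod_fork] only has to treat a leg to the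
    first target that sees the third one. *)
Lemma fork_flip Z b1 b2 psi : local_model Z (fork_kind (b1, b2)) psi ->
  local_model Z (fork_kind (b2, b1))
    (fun i => psi (nth 7 [:: 2; 1; 0; 4; 3; 6; 5; 7] i)).
Proof.
case=> lsub lconn lsing ldisj ledge lnon.
have ldisj' i j : i < j < 5 -> [disjoint psi j & psi i] by rewrite disjoint_sym; apply: ldisj.
have lnon' i j : i < j < 8 -> i < 5 -> (i, j) \notin (fork_kind (b1, b2)).1.2 ++ (fork_kind
  (b1, b2)).2 ->
    ~~ touch (psi j) (psi i) by rewrite touchC; apply: lnon.
split.
- by case=> [|[|[|[|[|i]]]]] //= _; apply: lsub.
- by case=> [|[|[|[|[|i]]]]] //= _; apply: lconn.
- by case=> [|[|[|[|[|i]]]]] //=; rewrite ?nth_nil // => _;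
  [apply: (lsing 2) | apply: (lsing 0)].
- by move=> i j; by_cases i j => _; ((by apply: ldisj) || (by apply: ldisj')).
- move=> i j; rewrite /fork_kind /= !inE !mem_cat !xpair_eqE.
  case: b1 b2 ledge {lsub lconn lsing ldisj lnon ldisj' lnon'} => [] [] ledge;
    rewrite !inE !xpair_eqE; do ?[case/orP]; case/andP=> /eqP-> /eqP-> /=;
    (by apply: ledge) || (by rewrite touchC; apply: ledge).
- move=> i j; by_cases i j => _ _; case: b1 b2 lnon lnon' {lsub lconn lsing ldisj ledge
  ldisj'} => [] [] lnon lnon' //= _;
   (by apply: lnon) || (by apply: lnon').
Qed.

Notation X t := [set z | adj z t].

(** If a vertex [a] of the leg to [ti] sees [tj], then the leg to [tj] is empty and the root sees
    [tj]. The part of the leg from [a] on and the root with the leg to [tk] are the two sets. The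
    first one misses [tk] by the minimality of [Z]. *)
Lemma tripod_pair Z ti tj tk u pi pj pk :
  tripod Z (X ti) (X tj) (X tk) u pi pj pk -> touch [set:: pi] [set tj] ->
  (forall A, A \subset Z -> #|A| < #|Z| -> conn A -> touch A [set ti] ->
     touch A [set tj] -> touch A [set tk] -> False) ->
  exists A B, [/\ [/\ A \subset Z, B \subset Z, conn A & conn B],
    [disjoint A & B], ~~ touch A B,
    [/\ touch A [set ti], touch A [set tj] & ~~ touch A [set tk]] &
    [/\ touch B [set tj], touch B [set tk] & ~~ touch B [set ti]]].
Proof.
move=> tp; rewrite touch_seq => /hasP[a api /= aX] minZ.
have l0 := leg0 tp; have l2 := leg2 tp.
have pj0 := tripod_other tp api aX.
have utj : adj u tj by have := leg1 tp; rewrite pj0 /leg inE => /and4P[].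
have [s [s' e]] := mem_split api.
(* If [a] followed the root directly, then [u], [a] and [tj] would form a triangle. So the omitted
   part [s] is nonempty and separates the two sets. *)
have s0 : s != [::].
  apply/eqP => s0; have ua : adj u a by move: l0; rewrite e s0 /leg /= => /and4P[_ /andP[]].
  by rewrite inE in aX; have := tri_free ua aX; rewrite utj.
have tp' := tripod_swap (tripod_rot (tripod_rot tp)).
have pi0 : pi != [::] by rewrite e; case: (s).
have nuti : adj u ti = false.
  by apply/negP => ut; case/eqP: pi0; apply: (tripod_root tp); rewrite inE.
have uZ : u \in Z by case/and4P: l0.
have [_ cA] := tripod_conn tp e.
have cB : conn [set:: u :: pk] by apply: path_conn; case/and4P: l2.
have sA : [set:: a :: s'] \subset Z.
  by apply: subset_trans (leg_sub l0); apply/subsetP => x; rewrite !inE e mem_cat inE => ->;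
    rewrite orbT.
have sB : [set:: u :: pk] \subset Z by rewrite set_cons subUset sub1set uZ (leg_sub l2).
have ap x b : x \in a :: s' -> b \in pk -> (x != b) && ~~ adj x b.
  by move=> xs bp; apply: (tripod_apart tri_free tp') => //; rewrite e mem_cat xs orbT.
have uA : u \notin a :: s'.
  by have := tripod_uniq tp; rewrite e /= mem_cat negb_or -andbA => /and3P[].
have nuA x : x \in a :: s' -> adj u x = false.
  case/mem_split=> w [w' e']; apply: (tripod_far tp (s := s ++ w) (s' := w')).
    by rewrite e e' catA.
  by case: (s) s0.
have Ati : touch [set:: a :: s'] [set ti].
  rewrite touch_seq; apply/hasP; exists (last a s'); rewrite ?mem_last //=.
  by have /and4P[_ _ _] := l0; rewrite e last_cat.
have Atj : touch [set:: a :: s'] [set tj] by rewrite touch_seq /= aX.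
exists [set:: a :: s'], [set:: u :: pk]; split=> //.
- rewrite disjoint_subset; apply/subsetP => x; rewrite !inE negb_or => xA.
  apply/andP; split; first by apply: contraNneq uA => <-.
  by apply/negP => xp; case/andP: (ap x x xA xp); rewrite eqxx.
- apply: ntouch_seqs => x b xA; rewrite inE => /predU1P[->|bp];
  last by case/andP: (ap x b xA bp).
  by rewrite adj_sym nuA.
- split=> //; apply/negP => Atk; apply: (minZ [set:: a :: s']) => //.
  apply: proper_card; rewrite properE sA; apply/subsetPn; exists u => //.
  by rewrite inE.
split.
- by rewrite touch_seq /= inE utj.
- rewrite touch_seq; apply/hasP; exists (last u pk); rewrite ?mem_last //=.
  by have /and4P[_ _ _] := l2.
rewrite touch_seq /= inE nuti /=; apply/hasPn => b bp /=.
apply/negP => bX; have tp2 := tripod_rot (tripod_rot tp).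
by case/eqP: pi0; apply: (tripod_other tp2 bp bX).
Qed.

(** Let [a] be the first vertex of [p0] that sees [t2]. The leg to [t2] is then empty, so the root
    sees [t2] as well. The part of [p0] before [a], nonempty for lack of triangles, becomes piece 1;
    its part after [a] and [p1] are the legs. *)
Lemma tripod_fork Z t0 t1 t2 u p0 p1 p2 :
  tripod Z (X t0) (X t1) (X t2) u p0 p1 p2 -> touch [set:: p0] [set t2] ->
  ~~ touch [set:: p0] [set t1] -> ~~ touch [set:: p1] [set t0] ->
  exists b1 b2 psi, [/\ local_model Z (fork_kind (b1, b2)) psi,
    psi 5 = [set t0], psi 6 = [set t1] & psi 7 = [set t2]].
Proof.
move=> tp; rewrite !touch_seq => /split_first[s [a [s' [e /= aX nsX]]]] n01 n10.
have l0 := leg0 tp; have l1 := leg1 tp.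
have tp' := tripod_swap (tripod_rot (tripod_rot tp)).
have a0 : a \in p0 by rewrite e mem_cat mem_head orbT.
have p20 := tripod_other tp' a0 aX.
have ut2 : adj u t2 by have := leg2 tp; rewrite p20 /leg inE => /and4P[].
have at2 : adj a t2 by rewrite inE in aX.
have s0 : s != [::].
  apply/eqP => s0; have ua : adj u a by move: l0; rewrite e s0 /leg /= => /and4P[_ /andP[]].
  by have := tri_free ua at2; rewrite ut2.
have p00 : p0 != [::] by rewrite e; case: (s).
have uZ : u \in Z by case/and4P: l0.
have [cs cas] := tripod_conn tp e.
have [_ cs'] : conn [set:: rcons s a] /\ conn [set:: s'].
  by apply: (tripod_conn tp); rewrite e cat_rcons.
have up := tripod_uniq tp; have ua := tripod_far tp e s0.
have ap x y : x \in p0 -> y \in p1 -> (x != y) && ~~ adj x y.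
  by apply: (tripod_apart tri_free tp).
have sp x : x \in s -> x \in p0 by rewrite e mem_cat => ->.
have sp' x : x \in s' -> x \in p0 by rewrite e mem_cat inE orbC => ->; rewrite orbT.
have disjI p q : (forall x, x \in p -> x \notin q) -> [disjoint [set:: p] & [set:: q]].
  by move=> H; rewrite disjoint_subset; apply/subsetP => x; rewrite !inE => /H.
have disjp p : {subset p <= p0} -> [disjoint [set:: p] & [set:: p1]].
  by move=> pp; apply: disjI => x /pp xp; apply/negP => x1; case/andP: (ap x x xp x1);
    rewrite eqxx.
have tchp p : {subset p <= p0} -> ~~ touch [set:: p] [set:: p1].
  by move=> pp; apply: ntouch_seqs => x b /pp xp bp; case/andP: (ap x b xp bp).
have sub1 p t : {subset p <= p0} -> ~~ touch [set:: p0] [set t] -> ~~ touch [set:: p] [set t].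
  by rewrite !touch_seq => pp; apply: contra => /hasP[x /pp xp xX]; apply/hasP; exists x.
have seq1 x : [set x] = [set:: [:: x]] by rewrite set_cons set_nil setU0.
have subp p : {subset p <= p0} -> [set:: p] \subset Z.
  move=> pp; apply: subset_trans (leg_sub l0); apply/subsetP => x; rewrite !inE; exact: pp.
have ap0 : {subset [:: a] <= p0} by move=> x; rewrite inE => /eqP->.
have n01' : ~~ touch [set:: p0] [set t1] by rewrite touch_seq.
have e0 : ([set:: s'] != set0) = (s' != [::]).
  by case: (s') => [|x r]; rewrite ?set_nil ?eqxx //; apply/set0Pn; exists x;
    rewrite inE mem_head.
have e1 : ([set:: p1] != set0) = (p1 != [::]).
  by case: (p1) => [|x r]; rewrite ?set_nil ?eqxx //; apply/set0Pn; exists x;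
    rewrite inE mem_head.
have las : leg Z (X t0) a s' by move: l0; rewrite e => /leg_cat.
exists ([set:: s'] != set0), ([set:: p1] != set0).
exists (nth set0 [:: [set a]; [set:: s]; [set u]; [set:: s']; [set:: p1]; [set t0]; [set t1];
  [set t2]]).
split=> //; move: up; rewrite e /= mem_cat inE !negb_or cat_uniq /= negb_or.
case/andP=> /and3P[us una us'] /and3P[_ /andP[as_ ss'] /andP[as' _]].
apply: fork_local => //.
- by rewrite seq1 subp.
- exact: subp.
- by rewrite sub1set.
- exact: subp.
- exact: leg_sub l1.
- exact: leg_conn l1.
- by rewrite disjoints1 inE.
- by rewrite disjoints1 inE eq_sym.
- by rewrite disjoints1 inE.
- by rewrite seq1 disjp.
- by rewrite disjoint_sym disjoints1 inE.
- by apply: disjI => x; apply: contraL => xs'; apply/negP => xs; case/hasP: ss'; exists x.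
- exact: disjp.
- by rewrite disjoints1 inE.
- exact: tripod_center (tripod_rot tp).
- exact: disjp.
- have /and4P[_ + _ _] := l0; rewrite e cat_path /= => /and3P[_ la _].
  rewrite touchC; apply: (touchI _ (set11 a) la); rewrite inE.
  by case: (s) s0 => // x r _ /=; rewrite mem_last.
- have /and4P[_ + _ _] := l0; rewrite e cat_path => /andP[+ _]; rewrite touchC.
  case: (s) s0 => // x r _ /= /andP[ux _].
  by rewrite (touchI (set11 u) _ ux) // inE mem_head.
- by rewrite touch_vertex.
- by rewrite touch_vertex.
- by rewrite e0; apply: leg_head las.
- by rewrite e0; apply: leg_last las.
- rewrite touch_vertex e0 negbK; apply/idP/eqP => [a0'|s'0].
    by apply: (tripod_end tp e); rewrite inE.
  by move: las; rewrite s'0 /leg inE => /and4P[].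
- by rewrite e1; apply: leg_head l1.
- by rewrite e1; apply: leg_last l1.
- by rewrite e1 negbK; apply: tripod_flag (tripod_rot tp).
- by rewrite touch_vertex adj_sym ua.
- by rewrite seq1 tchp.
- by rewrite seq1 sub1.
- apply: ntouch_seqs => x y xs ys; by rewrite (tripod_induced tp e).
- exact: tchp.
- rewrite touch_seq; apply/hasPn => x /mem_split[w [w' es]]; apply/negP => /= xX.
  have := tripod_end tp (s := w) (s' := w' ++ a :: s') _ xX.
  by rewrite e es -catA => /(_ erefl); case: (w').
- exact: sub1.
- by rewrite touch_seq.
- apply: ntouch_vseq => x /mem_split[w [w' es]];
  rewrite (tripod_far tp (s := s ++ a :: w) (s' := w')) //.
    by rewrite e es -catA.
  by case: (s).
- by rewrite touch_vertex; apply: contra p00 => ut; apply/eqP; apply: (tripod_root tp);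
  rewrite inE.
- exact: tchp.
- exact: sub1.
by rewrite touch_seq.
Qed.

Lemma mem_claw_kind b : claw_kind b \in kinds.
Proof. by case: b => [[[] []] []]. Qed.

Lemma mem_fork_kind b : fork_kind b \in kinds.
Proof. by case: b => [[] []]. Qed.

(** In a minimal [Z], a leg that sees a target other than its own gives a pair if that target is
    [t0] or [t1], and a fork if it is [t2]. If no leg does, the tripod is a claw. *)
Lemma tripod_kinds Z t0 t1 t2 : conn Z -> touch [set t0] Z -> touch [set t1] Z ->
  touch [set t2] Z -> exists k psi, [/\ k \in kinds, local_model Z k psi,
    psi 5 = [set t0], psi 6 = [set t1] & psi 7 = [set t2]].
Proof.
have [n] := ubnP #|Z|; elim: n Z => // n IHn Z leZ cZ tZ0 tZ1 tZ2.
have [[Y [sY ltY cY [tY0 tY1 tY2]]]|minZ] := classic (exists Y, [/\ Y \subset Z, #|Y| < #|Z|,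
    conn Y & [/\ touch [set t0] Y, touch [set t1] Y & touch [set t2] Y]]).
  have [|k [psi [kk lk p5 p6 p7]]] := IHn Y _ cY tY0 tY1 tY2.
    by apply: leq_trans ltY _.
  by exists k, psi; split=> //; apply: local_modelS lk.
have {}minZ A : A \subset Z -> #|A| < #|Z| -> conn A -> touch A [set t0] ->
    touch A [set t1] -> touch A [set t2] -> False.
  by move=> sA ltA cA A0 A1 A2; apply: minZ; exists A; split; rewrite // !(touchC [set _]).
have [u [p0 [p1 [p2 tp]]]] := tripod_exists cZ tZ0 tZ1 tZ2.
pose tp1 := tripod_rot tp; pose tp2 := tripod_rot tp1.
have pairP A B b : A \subset Z -> B \subset Z -> conn A -> conn B ->
    [disjoint A & B] -> ~~ touch A B ->
    touch A [set t0] -> touch A [set t1] -> ~~ touch A [set t2] ->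
    touch B [set if b then t1 else t0] -> touch B [set t2] ->
    ~~ touch B [set if b then t0 else t1] ->
    exists k psi, [/\ k \in kinds, local_model Z k psi,
      psi 5 = [set t0], psi 6 = [set t1] & psi 7 = [set t2]].
  move=> *; exists (pair_kind b), (nth set0 [:: A; B; set0; set0; set0; [set t0]; [set t1];
    [set t2]]).
  by split=> //; [case: (b) | apply: pair_local].
case h10: (touch [set:: p1] [set t0]).
  have [//|A [B [[sA sB cA cB] dAB nAB [A1 A0 nA2] [B0 B2 nB1]]]] := tripod_pair (tripod_swap
    tp) h10.
    by move=> A sA ltA cA A1 A0 A2; apply: (minZ A).
  exact: (pairP A B false).
case h20: (touch [set:: p2] [set t0]).
  have [|A [B [[sA sB cA cB] dAB nAB [A2 A0 nA1] [B0 B1 nB2]]]] := tripod_pair tp2 h20.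
    by move=> A sA ltA cA A2 A0 A1; apply: (minZ A).
  by apply: (pairP B A false) => //; rewrite 1?disjoint_sym 1?touchC.
case h01: (touch [set:: p0] [set t1]).
  have [//|A [B [[sA sB cA cB] dAB nAB [A0 A1 nA2] [B1 B2 nB0]]]] := tripod_pair tp h01.
  exact: (pairP A B true).
case h21: (touch [set:: p2] [set t1]).
  have [|A [B [[sA sB cA cB] dAB nAB [A2 A1 nA0] [B1 B0 nB2]]]] := tripod_pair (tripod_swap
    tp1) h21.
    by move=> A sA ltA cA A2 A1 A0; apply: (minZ A).
  by apply: (pairP B A true) => //; rewrite 1?disjoint_sym 1?touchC.
case h02: (touch [set:: p0] [set t2]).
  have [||b1 [b2 [psi [lk p5 p6 p7]]]] := tripod_fork tp h02; rewrite ?h01 ?h10 //.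
  by exists (fork_kind (b1, b2)), psi; split; rewrite ?mem_fork_kind.
case h12: (touch [set:: p1] [set t2]).
  have [||b1 [b2 [psi [lk p5 p6 p7]]]] := tripod_fork (tripod_swap tp) h12;
    rewrite ?h01 ?h10 //.
  have := fork_flip lk; set psi' := (fun i => _) => lk'.
  by exists (fork_kind (b2, b1)), psi'; split; rewrite ?mem_fork_kind.
exists (claw_kind (p0 != [::], p1 != [::], p2 != [::])), (claw_sets u p0 p1 p2 t0 t1 t2).
by split; rewrite ?mem_claw_kind //; apply: claw_local; rewrite ?h01 ?h02 ?h10 ?h12 ?h20 ?h21.
Qed.
End Kinds.

(** * From a configuration to a larger one *)

Lemma row_upd r i f j : row (upd r i f) j = if j == i then f (row r i) else row r j.
Proof. by rewrite /row /upd nth_set_nth /=. Qed.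

Lemma row_link e r i j :
  (j \in row (link e r) i) = [|| j \in row r i, (i, j) == e | (j, i) == e].
Proof.
case: e => a b; rewrite /link !row_upd !xpair_eqE /=.
case: (eqVneq i b) => [->|nib]; [case: (eqVneq b a) => [->|nba] | case: (eqVneq i a) =>
  [->|nia]];
  rewrite ?inE ?eqxx ?(negPf nib) //=;
  by case: (j == a); case: (j == b); rewrite ?orbT ?orbF ?andbF.
Qed.

Lemma row_links es r i j :
  (j \in row (foldr link r es) i) = [|| j \in row r i, (i, j) \in es | (j, i) \in es].
Proof.
elim: es => [|e es IHes] /=; first by rewrite !orbF.
rewrite row_link IHes !inE; case: (j \in _) => //=.
by case: (_ \in es); case: (_ \in es); case: (_ == e); case: (_ == e).
Qed.

Lemma mem_without i j s : (j \in without i s) = (j != i) && (j \in s).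
Proof. by rewrite mem_filter. Qed.

Lemma linkedE c i j : linked c i j = (j \in row (yes c) i).
Proof. exact: memnE. Qed.

Lemma apartE c i j : apart c i j = (j \notin row (may c) i).
Proof. by rewrite /apart memnE. Qed.

Lemma linked_set_yes c i j k l :
  linked (set_yes c i j) k l = [|| linked c k l, (k, l) == (i, j) | (l, k) == (i, j)].
Proof. by rewrite !linkedE row_link. Qed.

Lemma apart_set_no c i j k l :
  apart (set_no c i j) k l -> [|| apart c k l, (k, l) == (i, j) | (l, k) == (i, j)].
Proof.
rewrite !apartE !row_upd !xpair_eqE.
case: (eqVneq k j) => [->|_]; [case: (eqVneq j i) => [->|_] | case: (eqVneq k i) => [->|_]];
  rewrite ?mem_without ?negb_and ?negbK ?orbF ?andbF ?andbT //=;
  by do ?[case/orP] => ->; rewrite ?orbT.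
Qed.

Section Soundness.
Variable G : sgraph.
Implicit Types (A B S X Y Z : {set G}) (x y z u v : G) (phi psi : nat -> {set G}).
Hypothesis tri_free : forall x y z, adj x y -> adj y z -> adj x z = false.
Hypothesis sq_free : forall x y z t, adj x y -> adj y z -> adj z t -> adj t x ->
  x != z -> y != t -> False.
Hypothesis nuc : ~ has_cycle_with_unique_chord G.

Lemma model_set_yes phi c i j : model phi c -> i < sz c -> j < sz c ->
  touch (phi i) (phi j) -> model phi (set_yes c i j).
Proof.
case=> cn sn dj lk ap ic jc tij; split=> // k l kc; rewrite linked_set_yes.
case/or3P=> [|/eqP[-> ->]|/eqP[-> ->]] //; first exact: lk.
by rewrite touchC.
Qed.

Lemma model_set_no phi c i j : model phi c -> ~~ touch (phi i) (phi j) ->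
  model phi (set_no c i j).
Proof.
case=> cn sn dj lk ap tij; split=> // k l kc lc kl /apart_set_no.
case/or3P=> [|/eqP[-> ->]|/eqP[-> ->]] //; first exact: ap.
by rewrite touchC.
Qed.

Lemma decide_sound leaf q l c phi : model phi c -> q < sz c ->
  all (fun i => i < sz c) l -> decide leaf q l c ->
  exists c', [/\ model phi c', sg c' = sg c & leaf c'].
Proof.
move=> + qc; elim: l c qc => [|i l IHl] c qc M /=.
  by move=> _; case: ifP => [/(refuted_sound tri_free sq_free nuc M)|_] // lc; exists c.
case/andP=> ic lc; case: ifP => // dyes dno.
have [t|nt] := boolP (touch (phi q) (phi i)).
  have M' := model_set_yes M qc ic t; move: dyes => /=.
  case: ifP => [/(refuted_sound tri_free sq_free nuc M')|_] //.
  by case/(IHl (set_yes c q i)) => // c' [M'' sg' lf]; exists c'.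
have M' := model_set_no M nt.
by case: (IHl (set_no c q i) qc M' lc dno) => c' [M'' sg' lf]; exists c'.
Qed.

Definition split_phi phi psi n m i := if i == m then psi 0 else
  if i < n then phi i else psi (i - n).+1.

Lemma kinds_ok k : k \in kinds -> size k.1.1 = 5 /\
  all (fun e => [&& e.1 < e.2, e.1 < 5 & e.2 < 8]) (k.1.2 ++ k.2).
Proof.
suff /allP H : all (fun k => (size k.1.1 == 5) && all (fun e => [&& e.1 < e.2, e.1 < 5 & e.2
  < 8]) (k.1.2 ++ k.2)) kinds.
  by move/H => /andP[/eqP-> ->].
by vm_compute.
Qed.

Lemma row_isolate m r i : m < size r ->
  row (isolate m r ++ nseq 4 [::]) i = if i == m then [::] else without m (row r i).
Proof.
move=> mr; rewrite /row nth_cat size_map size_set_nth (maxn_idPr mr).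
case: ltnP => ir.
  rewrite (nth_map [::]) ?size_set_nth ?(maxn_idPr mr) // nth_set_nth /=.
  by case: eqP.
rewrite nth_nseq if_same; case: eqP => // _.
by rewrite nth_default.
Qed.

(** The links of [m] are forgotten, because it is unknown which piece inherits them; its non-links
    pass to all pieces, being subsets. Since [split_ok] lets [m] be joined only to the three
    targets, the kind accounts for every possible link of a piece. *)
Lemma split_model c m (t0 t1 t2 : nat) (k : kind) phi psi (ts := [:: t0; t1; t2]) :
  model phi c -> split_ok c m ts -> k \in kinds -> local_model (phi m) k psi ->
  psi 5 = phi t0 -> psi 6 = phi t1 -> psi 7 = phi t2 ->
  model (split_phi phi psi (sz c) m) (split_node c m ts k).
Proof.
move=> M /and5P[/eqP szy /eqP szm mc _ /and5P[uts sts lts mts mmay]] kk L p5 p6 p7.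
have [sk /allP ok] := kinds_ok kk.
set n := sz c in szy szm mc *; set ren := rename n m ts.
set phi' := split_phi _ _ _ _; 
have [s0 s1 s2] : [/\ single c t0, single c t1 & single c t2].
  by move/allP: sts => H; split; apply: H; rewrite !inE eqxx ?orbT.
have [n0 n1 n2] : [/\ t0 < n, t1 < n & t2 < n] by split; apply: single_lt.
have [m0 m1 m2] : [/\ t0 != m, t1 != m & t2 != m].
  by move: mts; rewrite !inE !negb_or ![m == _]eq_sym => /and3P[].
have szc : sz (split_node c m ts k) = n + 4.
  rewrite /sz /= size_cat size_set_nth size_behead sk (maxn_idPr _) //.
have renE i : i < 8 -> phi' (ren i) = psi i.
  rewrite /phi' /split_phi /ren /rename -/n.
  case: i => [|[|[|[|[|[|[|[|i]]]]]]]] //= _; rewrite ?eqxx ?(negPf m0) ?(negPf m1) ?(negPf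
    m2) ?n0 ?n1 ?n2 //;
    rewrite ifN ?ltnNge ?leq_addr /= ?addKn // neq_ltn orbC (leq_trans mc) ?leq_addr //.
have ren_lt i : i < 8 -> ren i < n + 4.
  by case: i => [|[|[|[|[|[|[|[|i]]]]]]]] //= _; rewrite ?ltn_add2l // ltn_addr.
have oldE g : g != m -> g < n -> phi' g = phi g.
  by rewrite /phi' /split_phi => /negPf-> ->.
have renK g : g < n + 4 -> (exists2 i, i < 5 & g = ren i) \/ (g != m /\ g < n).
  move=> g4; have [->|gm] := eqVneq g m; first by left; exists 0.
  have [gn|gn] := ltnP g n; [by right | left].
  exists (g - n).+1; first by move: g4 gn; clear; lia.
  by rewrite /ren /rename; case: ltnP; move: g4 gn; clear; lia.
have tsP g : g \in ts -> exists2 j, 5 <= j < 8 & g = ren j.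
  by rewrite !inE => /or3P[]/eqP->; [exists 5 | exists 6 | exists 7].
have rows r es i j : size r = n ->
    (j \in row (foldr link (isolate m r ++ nseq 4 [::]) [seq (ren e.1, ren e.2) | e <- es]) i) =
    [|| [&& i != m, j != m & j \in row r i], (i, j) \in [seq (ren e.1, ren e.2) | e <- es] |
        (j, i) \in [seq (ren e.1, ren e.2) | e <- es]].
  move=> sr; rewrite row_links row_isolate ?sr //; case: (eqVneq i m) => //= _.
  by rewrite mem_without.
have subm i : i < 5 -> psi i \subset phi m by apply: (lm_sub L).
have lt58 i : i < 5 -> i < 8 by move=> i5; apply: leq_trans i5 _.
split.
- move=> g; rewrite szc => /renK[[i i5 ->]|[gm gn]].
    by rewrite renE; [apply: (lm_conn L) i5 | apply: lt58].
  by rewrite oldE //; apply: (model_conn M).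
- move=> g sgl; have := single_lt sgl; rewrite szc => /renK[[i i5 ge]|[gm gn]].
    rewrite ge renE ?lt58 //; apply: (lm_single L); move: sgl.
    rewrite /single /= nth_cat size_set_nth (maxn_idPr mc) ge /ren /rename i5.
    case: i {ge} i5 => [|i] i5; first by rewrite mc nth_set_nth /= eqxx nth0.
    by rewrite ltnNge leq_addr /= addKn nth_behead.
  rewrite oldE //; apply: (model_single M); move: sgl.
  by rewrite /single /= nth_cat size_set_nth (maxn_idPr mc) gn nth_set_nth /= (negPf gm).
- have old_new i h : i < 5 -> h != m -> h < n -> [disjoint psi i & phi h].
    move=> i5 hm hn; apply: disjointWl (subm i i5) _.
    by apply: (model_disj M) => //; rewrite eq_sym.
  move=> g h; rewrite szc => /renK[[i i5 ->]|[gm gn]] /renK[[j j5 ->]|[hm hn]] gh.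
  + rewrite !renE ?lt58 //; have : i != j by apply: contraNneq gh => ->.
    by case: ltngtP => // ij _; [|rewrite disjoint_sym]; apply: (lm_disj L); rewrite ij.
  + by rewrite renE ?lt58 // oldE //; apply: old_new.
  + by rewrite disjoint_sym renE ?lt58 // oldE //; apply: old_new.
  + by rewrite !oldE //; apply: (model_disj M).
- have edge i j : (i, j) \in k.1.2 -> [/\ i < 8, j < 8 & touch (psi i) (psi j)].
    move=> ij; have := ok (i, j); rewrite mem_cat ij => /(_ isT)/and3P[_ i5 j8].
    by split; [apply: lt58 | | apply: (lm_edge L)].
  move=> g h; rewrite szc linkedE rows // => gn.
  case/or3P=> [/and3P[gm hm gh]|/mapP[[i j] ij [-> ->]]|/mapP[[i j] ij [-> ->]]].
  + have gn' : g < n.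
      by move: gh; apply: contraLR; rewrite -leqNgt -szy => gn'; rewrite /row nth_default.
    have [|hn t] := @model_linked _ _ _ M g h gn'; first by rewrite linkedE.
    by rewrite !oldE //; split=> //; rewrite ltn_addr.
  + by have [i8 j8 t] := edge i j ij; rewrite /= !renE // ren_lt.
  + by have [i8 j8 t] := edge i j ij; rewrite /= !renE // ren_lt // touchC.
pose es := [seq (ren e.1, ren e.2) | e <- k.1.2 ++ k.2].
have key i h : i < 5 -> h < n + 4 -> ren i != h -> (ren i, h) \notin es ->
    (h, ren i) \notin es -> ~~ touch (phi' (ren i)) (phi' h).
  move=> i5 h4 nih nes nes'; rewrite renE ?lt58 //.
  have non j : j < 8 -> h = ren j -> i < j -> ~~ touch (psi i) (psi j).
    move=> j8 hj ij; apply: (lm_non L); rewrite ?ij //.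
    by apply: contra nes => ije; rewrite hj; apply: (map_f (fun e => (ren e.1, ren e.2)) ije).
  have [[j j5 hj]|[hm hn]] := renK h h4.
    rewrite hj renE ?lt58 //; have : i != j by apply: contraNneq nih => ->; rewrite hj.
    case: ltngtP => // ij _; first exact: non (lt58 j j5) hj ij.
    rewrite touchC; apply: (lm_non L); rewrite ?ij ?lt58 //.
    by apply: contra nes' => ije; rewrite hj; apply: (map_f (fun e => (ren e.1, ren e.2)) ije).
  have [/tsP[j /andP[j5 j8] hj]|hts] := boolP (h \in ts).
    by rewrite hj renE //; apply: non hj _ => //; apply: leq_trans i5 j5.
  rewrite oldE //; have := @model_apart _ _ _ M m h mc hn.
  rewrite eq_sym hm apartE => /(_ isT).
  have hrow : h \notin row (may c) m by apply: contra hts => /(allP mmay).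
  move/(_ hrow); apply: contra; apply: touchS => //; exact: subm.
move=> g h; rewrite szc apartE rows // -/es => g4 h4 gh.
rewrite !negb_or => /and3P[gho nes nes'].
have [[i i5 ge]|[gm gn]] := renK g g4; first by rewrite ge; apply: key; rewrite -?ge.
have [[i i5 he]|[hm hn]] := renK h h4.
  by rewrite touchC he; apply: key; rewrite -?he // eq_sym.
rewrite !oldE //; apply: (model_apart M) => //; rewrite apartE.
by move: gho; rewrite gm hm.
Qed.
End Soundness.

Lemma any_In (T : Type) (f : T -> bool) s : any f s -> exists2 x, List.In x s & f x.
Proof.
elim: s => //= x s IHs; case: ifP => [fx _|_ /IHs[y ys fy]]; first by exists x; [left|].
by exists y; [right|].
Qed.

Lemma uniq_flatten_disjoint (T : eqType) (f : seq (seq T)) i j x :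
  uniq (flatten f) -> i != j -> x \in nth [::] f i -> x \in nth [::] f j -> False.
Proof.
elim: f i j => [|s f IHf] i j /=; first by rewrite nth_nil.
rewrite cat_uniq => /and3P[_ /hasPn dis uf].
have out k : x \in nth [::] f k -> x \in flatten f.
  move=> xk; apply/flattenP; exists (nth [::] f k) => //; apply: mem_nth.
  by rewrite ltnNge; apply: contraL xk => /(nth_default [::])->.
case: i j => [|i] [|j] //=; last by rewrite eqSS; apply: IHf.
  by move=> _ xs /out/dis /=; rewrite xs.
by move=> _ /out/dis /= + xs; rewrite xs.
Qed.

Section Soundness.
Variable G : sgraph.
Implicit Types (A B S X Y Z : {set G}) (x y z u v : G) (phi psi : nat -> {set G}).
Hypothesis tri_free : forall x y z, adj x y -> adj y z -> adj x z = false.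
Hypothesis sq_free : forall x y z t, adj x y -> adj y z -> adj z t -> adj t x ->
  x != z -> y != t -> False.
Hypothesis nuc : ~ has_cycle_with_unique_chord G.

Lemma accept_search_check T fuel c ps f : accept_search T fuel c ps f ->
  exists f', accept_check T c f'.
Proof.
elim: fuel f => [|k IHk] f /=; case: ifP => // _; [by exists f | by exists f |].
case/any_In=> P _; case: ifP => // _; case: ifP => // _; case: ifP => // _.
exact: IHk.
Qed.

Lemma accept_model T c phi f : model phi c -> accept_check T c f ->
  model (fun i => region phi (row f i)) T.
Proof.
move=> M /and5P[/eqP ym /allP yT /eqP sf uf /and4P[/allP fc /allP fo /allP fs /allP fp]].
have rowc i : all (fun i => i < sz c) (row f i).
  have [lti|gei] := ltnP i (size f); last by rewrite /row nth_default.
  exact/fc/mem_nth.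
have pok i j : i < sz T -> j < sz T -> if i == j then ~~ linked T i j
    else part_ok c (row f i) (row f j) (linked T i j).
  have mem_T k : k < sz T -> k \in iota 0 (sz T) by rewrite mem_iota.
  by move=> iT jT; have /allP := fp i (mem_T i iT); apply; apply: mem_T.
have linkT i j : i < sz T -> linked T i j -> j < sz T.
  rewrite linkedE => iT ij; have [lti|gei] := ltnP i (size (yes T)).
    by have /allP := yT _ (mem_nth [::] lti); apply.
  by rewrite /row nth_default in ij.
split.
- move=> i iT; apply: (ordered_conn M) (rowc i) _.
  have [lti|gei] := ltnP i (size f); last by rewrite /row nth_default.
  exact/fo/mem_nth.
- move=> i si; have := fs i; rewrite mem_iota single_lt // si => /(_ isT).
  case: (row f i) => [|v [|]] //= sv; have [x px] := model_single M sv.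
  by exists x; rewrite /region big_seq1.
- move=> i j iT jT ij; rewrite disjoint_subset; apply/subsetP => x /regionP[a ai xa].
  rewrite inE; apply/negP => /regionP[b bj xb].
  have ab : a != b.
    apply/eqP => eab; rewrite -eab in bj; exact: (uniq_flatten_disjoint uf ij ai bj).
  have := model_disj M (allP (rowc i) _ ai) (allP (rowc j) _ bj) ab.
  by move/disjointFr/(_ xa); rewrite xb.
- move=> i j iT ij; have jT := linkT i j iT ij; split=> //.
  have := pok i j iT jT; rewrite ij; case: ifP => // _ /hasP[a ai /hasP[b bj ab]].
  have [_] := model_linked M (allP (rowc i) _ ai) ab.
  move/(region_touch bj); rewrite touchC => /(region_touch ai); by rewrite touchC.
move=> i j iT jT ij; have := pok i j iT jT; rewrite (negPf ij) apartE -ym -linkedE.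
case: (linked T i j) => //= /allP ap _; apply/touchP => -[x [y [/regionP[a ai xa] /regionP[b
  bj yb] xy]]].
have ab : a != b.
  apply/eqP => eab; rewrite -eab in bj; exact: (uniq_flatten_disjoint uf ij ai bj).
have := model_apart M (allP (rowc i) _ ai) (allP (rowc j) _ bj) ab (allP (ap a ai) b bj).
by case/negP; apply: touchI xy.
Qed.

Definition has_model Ts := exists2 T, List.In T Ts & exists phi, model phi T.

Lemma explore_sound Ts q ms c phi : model phi c -> explore Ts q ms c -> has_model Ts.
Proof.
elim: ms c phi => [|m ms IHms] c phi M.
  rewrite /=; case: ifP => [/(refuted_sound tri_free sq_free nuc M)|_] //.
  case/any_In=> T inT; rewrite /accept; case: ifP => // _ /accept_search_check[f fok].
  by exists T => //; exists (fun i => region phi (row f i)); apply: accept_model fok.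
rewrite (_ : explore _ _ _ _ = if refuted c then true else
  if split_ok c m (targets c m q) then
    every (fun k => explore Ts q ms (split_node c m (targets c m q) k)) kinds else false) //.
case: ifP => [/(refuted_sound tri_free sq_free nuc M)|_] //.
case: ifP => // ok /everyP all_kinds.
case: (targets c m q) ok all_kinds => [|t0 [|t1 [|t2 [|t3 ts]]]]; try by case/and5P.
move=> ok all_kinds; have := ok.
case/and5P=> _ _ mc _ /and5P[_ sts lts _ _].
have t_ok t : t \in [:: t0; t1; t2] -> exists2 v, phi t = [set v] & touch [set v] (phi m).
  move=> tt; have [v pv] := model_single M (allP sts t tt); exists v => //.
  by have [_] := model_linked M mc (allP lts t tt); rewrite pv touchC.
have [v0 p0 h0] := t_ok t0 (mem_head _ _).
have [|v1 p1 h1] := t_ok t1; first by rewrite !inE eqxx orbT.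
have [|v2 p2 h2] := t_ok t2; first by rewrite !inE eqxx !orbT.
have [k [psi [kk lk e5 e6 e7]]] := tripod_kinds tri_free (model_conn M mc) h0 h1 h2.
apply: (IHms _ _ (split_model M ok kk lk _ _ _) (all_kinds k kk)); by rewrite ?p0 ?p1 ?p2.
Qed.
End Soundness.

(* The shape of a configuration that is a graph whose non-single sets have exactly two
   neighbours, which are single and not adjacent. *)
Definition cfg_ok T :=
  [&& yes T == may T, size (yes T) == sz T &
   all (fun i => [&& all (fun j => [&& j < sz T, j != i & linked T j i]) (row (yes T) i),
     uniq (row (yes T) i) & if single T i then 2 < size (row (yes T) i)
       else if row (yes T) i is [:: u; v] then [&& single T u, single T v & ~~ linked T u v]
       else false]) (iota 0 (sz T))].

Lemma ltnS_or k n : k < n.+1 -> k = n \/ k < n.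
Proof. by rewrite ltnS leq_eqVlt => /predU1P. Qed.

(** * Enlarging a blown-up set *)

Section Step.
Variable G : sgraph.
Implicit Types (A B D S X Y Z : {set G}) (x y z w : G) (phi psi : nat -> {set G}).
Hypothesis tri_free : forall x y z, adj x y -> adj y z -> adj x z = false.
Hypothesis sq_free : forall x y z t, adj x y -> adj y z -> adj z t -> adj t x ->
  x != z -> y != t -> False.
Hypothesis nuc : ~ has_cycle_with_unique_chord G.
Hypothesis nc2 : no_2_cutset G.

Lemma model_extend T phi c D (n := sz T) : model phi T -> conn D ->
  (forall i, i < n -> [disjoint phi i & D]) -> sz c = n.+1 ->
  (forall i, single c i -> i < n -> exists x, phi i = [set x]) ->
  (single c n -> exists d, D = [set d]) ->
  (forall i j, i < n.+1 -> linked c i j -> [\/ i < n /\ linked T i j,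
     [/\ i = n, j < n & touch D (phi j)] | [/\ j = n, i < n & touch D (phi i)]]) ->
  (forall i j, i < n.+1 -> j < n.+1 -> i != j -> apart c i j ->
     [\/ [/\ i < n, j < n & apart T i j],
     [/\ i = n, j < n & ~~ touch D (phi j)] | [/\ j = n, i < n & ~~ touch D (phi i)]]) ->
  model (fun i => if i == n then D else phi i) c.
Proof.
move=> M cD dD szc sl sD lk ap.
have old i : i < n -> (if i == n then D else phi i) = phi i by move/ltn_eqF->.
split; rewrite ?szc.
- by move=> i /ltnS_or[->|iN]; [rewrite eqxx | rewrite old //; apply: (model_conn M)].
- move=> i si; have := single_lt si; rewrite szc => /ltnS_or[ei|iN]; last by rewrite old //;
  apply: sl.
  by rewrite ei eqxx; apply: sD; rewrite -ei.
- move=> i j /ltnS_or[->|iN] /ltnS_or[->|jN] ij.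
  + by rewrite eqxx in ij.
  + by rewrite eqxx old // disjoint_sym dD.
  + by rewrite eqxx old // dD.
  + by rewrite !old //; apply: (model_disj M).
- move=> i j iN /(lk i j iN)[[iN' lij]|[-> jN t]|[-> iN' t]].
  + have [jN t] := model_linked M iN' lij; by rewrite !old // ltnW.
  + by rewrite eqxx old // ltnW.
  + by rewrite eqxx old // touchC ltnSn.
move=> i j iN jN ij /(ap i j iN jN ij)[[iN' jN' aij]|[-> jN' t]|[-> iN' t]].
- by rewrite !old //; apply: (model_apart M).
- by rewrite eqxx old.
- by rewrite eqxx old // touchC.
Qed.

Section Config.
Variables (T : cfg) (phi : nat -> {set G}).
Hypothesis T_ok : cfg_ok T.
Hypothesis M : model phi T.

Lemma cfg_row i : i < sz T ->
  [/\ forall j, j \in row (yes T) i -> [&& j < sz T, j != i & linked T j i],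
    uniq (row (yes T) i) & if single T i then 2 < size (row (yes T) i)
       else if row (yes T) i is [:: u; v] then [&& single T u, single T v & ~~ linked T u v]
       else false].
Proof.
by move=> iT; have /and3P[_ _ /allP/(_ i)] := T_ok; rewrite mem_iota => /(_ iT)/and3P[/allP].
Qed.

Lemma cfg_linkC i j : i < sz T -> linked T i j -> linked T j i.
Proof. by move=> iT; rewrite linkedE => ij; have [/(_ j ij)/and3P[]] := cfg_row iT. Qed.

Lemma cfg_apart i j : apart T i j = ~~ linked T i j.
Proof. by have /and3P[/eqP e _ _] := T_ok; rewrite apartE -e linkedE. Qed.

Lemma cfg_mid m : m < sz T -> ~~ single T m -> exists u v,
  [/\ single T u, single T v, u != v, ~~ linked T u v & forall j, linked T m j = (j == u) ||
    (j == v)].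
Proof.
move=> mT sm; have [_] := cfg_row mT; rewrite (negPf sm).
case er: (row (yes T) m) => [|u [|v [|]]] //; rewrite /= andbT inE => uv /and3P[su sv luv].
by exists u, v; split=> // j; rewrite linkedE er !inE.
Qed.

Lemma model_replace m E : m < sz T -> ~~ single T m -> conn E ->
  (forall i, i < sz T -> i != m -> [disjoint phi i & E]) ->
  (forall i, i < sz T -> i != m -> touch E (phi i) = linked T m i) ->
  model (fun i => if i == m then E else phi i) T.
Proof.
move=> mT sm cE dE tE; split.
- by move=> i iT; case: eqP => // _; apply: (model_conn M).
- by move=> i si; case: eqP => [em|_]; [rewrite em (negPf sm) in si | apply: (model_single M)].
- move=> i j iT jT; case: (eqVneq i m) => [->|im]; case: (eqVneq j m) => [_|jm];
  rewrite ?eqxx // => ij.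
  + by rewrite disjoint_sym dE.
  + exact: dE.
  + exact: (model_disj M).
- move=> i j iT lij; have [jT t] := model_linked M iT lij; split=> //; move: lij.
  case: (eqVneq i m) => [->|im]; case: (eqVneq j m) => [ej|jm] lij //; rewrite ?ej in lij.
  + by have [/(_ m)] := cfg_row mT; rewrite -linkedE => /(_ lij)/and3P[_ /eqP].
  + by rewrite tE.
  + by rewrite touchC tE // cfg_linkC.
move=> i j iT jT; case: (eqVneq i m) => [->|im]; case: (eqVneq j m) => [ej|jm];
  rewrite ?eqxx // => ij.
- by rewrite cfg_apart tE.
- by rewrite ej cfg_apart touchC tE //; apply: contra => /(cfg_linkC mT).
- exact: (model_apart M).
Qed.

Lemma single_degree u a : single T u -> phi u = [set a] -> 3 <= degree a.
Proof.
move=> su pa; have uT := single_lt su; have [rowu unu] := cfg_row uT; rewrite su => s3.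
have pick3 j : j \in row (yes T) u -> exists2 x, x \in phi j & adj a x.
  rewrite -linkedE => uj; have [_] := model_linked M uT uj.
  by rewrite pa => /touch1P.
case er: (row (yes T) u) s3 unu => [|i [|j [|k r]]] // _.
rewrite /= !inE !negb_or => /and4P[/and3P[ij ik _] /andP[jk _] _ _].
have inr l : l \in [:: i; j; k] -> l \in row (yes T) u.
  by rewrite er !inE => /or3P[]->; rewrite ?orbT.
have lT l : l \in [:: i; j; k] -> l < sz T by move/inr/rowu/and3P=> [].
have [|xi xiP ai] := pick3 i; first by apply: inr; rewrite !inE eqxx.
have [|xj xjP aj] := pick3 j; first by apply: inr; rewrite !inE eqxx orbT.
have [|xk xkP ak] := pick3 k; first by apply: inr; rewrite !inE eqxx !orbT.
have neq l l' x x' : l \in [:: i; j; k] -> l' \in [:: i; j; k] -> l != l' ->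
    x \in phi l -> x' \in phi l' -> x != x'.
  move=> li l'i ll' xl xl'; apply: contraTneq xl' => <-.
  by have /disjointFr-> := model_disj M (lT l li) (lT l' l'i) ll'.
apply: leq_trans (_ : #|[set xi; xj; xk]| <= _).
  have nij : xi != xj by apply: (neq i j) => //; rewrite !inE eqxx ?orbT.
  have nik : xi != xk by apply: (neq i k) => //; rewrite !inE eqxx ?orbT.
  have njk : xj != xk by apply: (neq j k) => //; rewrite !inE eqxx ?orbT.
  by rewrite setUC cardsU1 !inE negb_or ![xk == _]eq_sym nik njk cards2 nij.
by apply/subset_leq_card/subsetP => x; rewrite !inE => /orP[/orP[]|] /eqP->.
Qed.

Lemma row_rcons r i : row (rcons r [::]) i = row r i.
Proof.
rewrite /row nth_rcons; case: ltngtP => // [ltr|->]; by rewrite nth_default // ltnW.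
Qed.

(** Let [Z] be the component of [phi m] outside all other sets of the blow-up. If [a] and [b] are
    its only attachments, they are a 2-cutset unless [Z] is one vertex. Otherwise [phi m] is
    enlarged to [Zb], the largest connected set around it that keeps away from the remaining sets
    [O], and a vertex [q] next to [Zb] that sees [O] is added to the configuration. *)
Lemma mid_step Ts m : m < sz T -> ~~ single T m -> mid_ok Ts T m ->
  has_model G Ts \/ exists z, phi m = [set z] /\
    forall y, adj z y -> exists2 u, linked T m u & y \in phi u.
Proof.
move=> mT sm okm; have [u [v [su sv uv luv mE]]] := cfg_mid mT sm.
have [a pa] := model_single M su; have [b pb] := model_single M sv.
have uT := single_lt su; have vT := single_lt sv.
have mu : m != u by apply: contraNneq sm => ->.
have mv : m != v by apply: contraNneq sm => ->.
have disj i j x : i < sz T -> j < sz T -> i != j -> x \in phi i -> x \in phi j -> False.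
  by move=> iT jT ij xi; have /disjointFr-> := model_disj M iT jT ij.
pose oth := [seq i <- iota 0 (sz T) | [&& i != m, i != u & i != v]].
have othE i : (i \in oth) = [&& i < sz T, i != m, i != u & i != v].
  by rewrite mem_filter mem_iota add0n andbC.
pose O := region phi oth; pose F := O :|: [set a; b].
have aphi : a \in phi u by rewrite pa set11.
have bphi : b \in phi v by rewrite pb set11.
have mF x : x \in phi m -> x \notin F.
  move=> xm; rewrite !inE !negb_or; apply/and3P; split.
  - apply/negP => /regionP[i]; rewrite othE => /and4P[iT im _ _] xi; exact: (disj i m x).
  - by apply/negP => /eqP xa; apply: (disj m u x) => //; rewrite xa.
  - by apply/negP => /eqP xb; apply: (disj m v x) => //; rewrite xb.
have lmu : linked T m u by rewrite mE eqxx.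
have lmv : linked T m v by rewrite mE eqxx orbT.
have [_ tmu] := model_linked M mT lmu; have [_ tmv] := model_linked M mT lmv.
have [z0 z0m] : exists z0, z0 \in phi m by have /touchP[z [y []]] := tmu; exists z.
pose Z := compo (~: F) z0.
have z0F : z0 \in ~: F by rewrite inE mF.
have sZ : Z \subset ~: F := comp_sub _ _.
have mZ : phi m \subset Z.
  apply: (conn_sub_comp (model_conn M mT) _ z0m (mem_comp z0F)).
  by apply/subsetP => x xm; rewrite inE mF.
have NZ : nbr Z \subset F by have := nbr_comp (~: F) z0; rewrite setCK.
have nab : ~~ adj a b.
  have := model_apart M uT vT uv; rewrite cfg_apart luv pa pb => /(_ isT).
  by apply: contra => ab; rewrite (touchI (set11 _) (set11 _) ab).
have ab : a != b by apply/eqP => eab; apply: (disj u v a) => //; rewrite eab.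
have oO i x : i \in oth -> x \in phi i -> x \in O by move=> io xi; apply/regionP; exists i.
have Oab x : x \in O -> x \notin [set a; b].
  case/regionP=> i; rewrite othE => /and4P[iT _ iu iv] xi; rewrite !inE.
  apply/norP; split; apply/negP => /eqP e; [apply: (disj i u x) | apply: (disj i v x)] => //.
    by rewrite e.
  by rewrite e.
have OF x : x \in O -> x \in F by move=> xO; rewrite in_setU xO.
have aZ : a \notin Z by apply/negP => /(subsetP sZ); rewrite !inE eqxx orbT.
have bZ : b \notin Z by apply/negP => /(subsetP sZ); rewrite !inE eqxx !orbT.
have [sN|] := boolP (nbr Z \subset [set a; b]).
  have z0Z : z0 \in Z := mem_comp z0F.
  have [Z1|Z2] := leqP #|Z| 1.
    have eZ : Z = [set z0] by apply/esym/eqP; rewrite eqEcard sub1set z0Z cards1.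
    right; exists z0; split.
      by apply/eqP; rewrite eqEsubset -{1}eZ mZ sub1set.
    move=> y z0y; have : y \in nbr Z.
      apply/nbrP; rewrite eZ inE eq_sym adj_neq //; split=> //.
      by exists z0; rewrite ?set11.
    by move/(subsetP sN); rewrite !inE => /orP[]/eqP->; [exists u | exists v].
  case: (nc2 ab nab (single_degree su pa) (single_degree sv pb) aZ bZ sN Z2).
  (* The other side has two vertices: [u] has at least two neighbours besides [m], and their sets
     are nonempty and disjoint. *)
  have [rowu unu] := cfg_row uT; rewrite su => s3.
  have : 1 < size [seq j <- row (yes T) u | predC (pred1 m) j].
    rewrite size_filter; have := count_predC (pred1 m) (row (yes T) u).
    by rewrite (count_uniq_mem m unu) => e; move: s3; rewrite -e; case: (m \in _) => // /ltnW.
  case er: [seq j <- _ | _] => [|i [|j r]] // _.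
  have := filter_uniq (predC (pred1 m)) unu; rewrite er /= inE negb_or => /andP[/andP[ij _] _].
  have inr k : k \in [:: i; j] -> k \in oth /\ exists x, x \in phi k.
    move=> kr; have : k \in i :: j :: r by move: kr; rewrite !inE => /orP[]->; rewrite ?orbT.
    rewrite -er mem_filter /= => /andP[km ku]; have /and3P[kT nku lku] := rowu k ku.
    split; last by have [_ /touchP[x [? []]]] := model_linked M kT lku; exists x.
    rewrite othE kT km nku /=; apply: contraTneq ku => ->; by rewrite -linkedE.
  have [|io [xi xiP]] := inr i; first by rewrite mem_head.
  have [|jo [xj xjP]] := inr j; first by rewrite !inE eqxx orbT.
  have inR x : x \in O -> x \in ~: (Z :|: [set a; b]).
    move=> xO; rewrite in_setC in_setU negb_or Oab // andbT.
    by apply/negP => /(subsetP sZ); rewrite inE OF.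
  apply/card_gt1P; exists xi, xj; split; [exact/inR/(oO i) | exact/inR/(oO j) |].
  apply/eqP => e; move: io jo; rewrite !othE => /and4P[iT _ _ _] /and4P[jT _ _ _].
  by apply: (disj i j xi); rewrite // e.
case/subsetPn=> y yN yab; left.
have yO : y \in O by have := subsetP NZ y yN; rewrite in_setU (negPf yab) orbF.
have /nbrP[yZ [z zZ zy]] := yN.
(* Staying inside [W], the set [Zb] sees exactly the same sets as [phi m], so it may replace [phi m]
   in the model. *)
pose W := ~: (F :|: nbr O); pose Zb := compo W z0.
have mO x : x \in phi m -> x \in W.
  move=> xm; rewrite in_setC in_setU negb_or mF //=; apply/negP => /nbrP[_ [w wO wx]].
  have /regionP[i] := wO; rewrite othE => /and4P[iT im iu iv] wi.
  have := model_apart M iT mT im; rewrite cfg_apart.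
  have -> : linked T i m = false.
    by apply/negP => /(cfg_linkC iT); rewrite mE (negPf iu) (negPf iv).
  by move=> /(_ isT)/negP; apply; apply: touchI wi xm wx.
have mZb : phi m \subset Zb.
  apply: (conn_sub_comp (model_conn M mT) _ z0m (mem_comp (mO z0 z0m))).
  by apply/subsetP.
have WF x : x \in W -> x \in ~: F by rewrite !in_setC in_setU negb_or => /andP[].
have sZbW : Zb \subset W := comp_sub _ _.
have sZb : Zb \subset Z.
  apply: (conn_sub_comp (comp_conn _ _) _ (mem_comp (mO z0 z0m)) (mem_comp z0F)).
  by apply/subsetP => x /(subsetP sZbW)/WF.
have zO : z \in nbr O.
  apply/nbrP; split; last by exists y; rewrite // adj_sym.
  by apply/negP => /OF zF; have := subsetP sZ z zZ; rewrite inE zF.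
have nZb : Zb != Z.
  apply: contraTneq zZ => <-; apply/negP => /(subsetP sZbW).
  by rewrite in_setC in_setU zO orbT.
(* The vertex [z] of [Z] sees [O], so [Zb] is not all of [Z] and can be left inside [Z]; a vertex
   reached this way must see [O]. *)
have [|x [q [xZb /setDP[qZ qZb] xq]]] := conn_exit (comp_conn _ _) sZb _ nZb.
  by apply/set0Pn; exists z0; apply: (subsetP mZb).
have qF : q \notin F by have := subsetP sZ q qZ; rewrite inE.
have qO : q \in nbr O.
  apply: contraR qZb => qO; apply: comp_closed xZb _ xq.
  by rewrite in_setC in_setU negb_or qF.
have [n nE] : exists n, n = sz T by exists (sz T).
have lE i j : linked (add_vertex T m) i j = [|| linked T i j, (i, j) == (m, n) | (j, i) ==
  (m, n)].
  by rewrite !linkedE row_link row_rcons nE.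
have aE i j : i < n.+1 -> j < n.+1 -> i != j -> apart (add_vertex T m) i j ->
    [/\ i < n, j < n & apart T i j].
  move=> iN jN ij; rewrite apartE row_links row_rcons -nE !negb_or => /and3P[ap nij nji].
  have mapE k : k < n -> (n, k) \in [seq (n, l) | l <- iota 0 n].
    by move=> kn; apply/mapP; exists k; rewrite // mem_iota.
  have iltn : i < n.
    rewrite ltn_neqAle -ltnS iN andbT; apply: contraNneq nij => ei; rewrite ei mapE //.
    by rewrite ltn_neqAle -ltnS jN andbT -ei eq_sym.
  split=> //; last by rewrite apartE.
  rewrite ltn_neqAle -ltnS jN andbT; apply: contraNneq nji => ej; rewrite ej mapE //.
have szN : sz (add_vertex T m) = n.+1 by rewrite nE /sz size_rcons.
have mn : m != n by rewrite nE neq_ltn mT.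
have ZbF x' : x' \in Zb -> x' \notin F.
  by move/(subsetP sZbW)/WF; rewrite inE.
have phiF i x' : i < sz T -> i != m -> x' \in phi i -> x' \in F.
  move=> iT im xi; rewrite in_setU !inE.
  have [ei|iu] := eqVneq i u; first by move: xi; rewrite ei pa => /set1P->; rewrite eqxx orbT.
  have [ei|iv] := eqVneq i v; first by move: xi; rewrite ei pb => /set1P->; rewrite eqxx !orbT.
  by rewrite (oO i) // othE iT im iu.
have nZ k : k < sz T -> k != m -> ~~ linked T m k -> ~~ touch Zb (phi k).
  move=> kT km; rewrite mE negb_or => /andP[ku kv].
  apply/touchP => -[t [t' [tZ t'k tt']]].
  have t'O : t' \in O by apply: (oO k) => //; rewrite othE kT km ku.
  have := subsetP sZbW t tZ; rewrite in_setC in_setU negb_or => /andP[tF /negP[]].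
  apply/nbrP; split; last by exists t'; rewrite // adj_sym.
  by apply: contra tF => /OF.
have M1 : model (fun i => if i == m then Zb else phi i) T.
  apply: model_replace => // [|i iT im|i iT im]; first exact: comp_conn.
    apply: disjointI => t ti tZ; have := ZbF t tZ.
    by rewrite (phiF i).
  apply/idP/idP => [|mi]; first by apply: contraLR; apply: nZ.
  by have [_] := model_linked M mT mi; apply: touchS.
pose phi' i := if i == n then [set q] else if i == m then Zb else phi i.
have M' : model phi' (add_vertex T m).
  rewrite /phi' nE in aE szN lE *; apply: (model_extend M1); rewrite ?conn1 //.
  - move=> i iT; rewrite disjoint_sym disjoints1; case: eqP => // /eqP im.
    by apply: contra qF; apply: phiF.
  - move=> i + iT; rewrite /single /= nth_rcons -/(sz T) iT => si.
    rewrite ifN; first exact: (model_single M).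
    by apply: contraNneq sm => <-.
  - by exists q.
  - have tq : touch [set q] Zb by rewrite touchC; apply: touchI xZb (set11 q) xq.
    move=> i j iN; rewrite lE => /or3P[lij|/eqP[-> ->]|/eqP[-> ->]].
    + constructor 1; split=> //; move: lij; apply: contraLR; rewrite -leqNgt => iT.
      by rewrite linkedE /row nth_default //; have /and3P[_ /eqP-> _] := T_ok.
    + by constructor 3; rewrite eqxx.
    + by constructor 2; rewrite eqxx.
  - by move=> i j iN jN ij /(aE i j iN jN ij); constructor 1.
have [||c [Mc sgc]] := decide_sound tri_free sq_free nuc M' _ _ okm.
- by rewrite szN nE.
- apply/allP => i; rewrite mem_cat !mem_filter !mem_iota szN nE.
  by case/orP=> /and3P[_ _ iT]; apply: leq_trans iT _.
case: ifP => [/everyP allap _|_]; last exact: (explore_sound tri_free sq_free nuc Mc).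
(* A leaf in which [q] sees nothing but [m] and its neighbours is impossible, as [q] sees some set
   in [oth]. *)
have /nbrP[_ [w wO wq]] := qO; have /regionP[j] := wO.
rewrite othE -nE => /and4P[jn jm ju jv] wj.
have := allap j; rewrite mem_iota -nE => /(_ jn).
case: eqnP => [ej|_]; first by rewrite ej eqxx in jm.
rewrite mE (negPf ju) (negPf jv) /= => ap.
have szc : sz c = n.+1 by rewrite /sz sgc.
have := @model_apart _ _ _ Mc n j; rewrite szc ltnSn ltnW // => /(_ isT isT).
rewrite neq_ltn jn orbT => /(_ isT ap); rewrite /phi' eqxx (negPf jm) ltn_eqF //.
by case/negP; rewrite touchC; apply: touchI wj (set11 q) wq.
Qed.
End Config.
End Step.

(* These extend [T] by a connected set joined to exactly [u] and [v], and by a vertex about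
   which nothing is known. *)
Definition attach_pair T u v :=
  let r := link (sz T, v) (link (sz T, u) (rcons (yes T) [::])) in
  Cfg r r (rcons (sg T) false).
Definition attach_single T :=
  Cfg (rcons (yes T) [::])
      (foldr link (rcons (may T) [::]) [seq (sz T, i) | i <- iota 0 (sz T) & single T i])
      (nseq (sz T).+1 true).
(** A pair [u], [v] of neighbours of a common blown-up set is exempt: a set attached to both could
    take the place of that set. The second half says that, in all surviving cases, an extra vertex
    can see at most one set. *)
Definition attach_ok T :=
  every (fun u => every (fun v => if eqn u v then true else
     if has (fun m => [&& ~~ single T m, linked T m u & linked T m v]) (iota 0 (sz T))
     then true else refuted (attach_pair T u v))
    (filter (single T) (iota 0 (sz T)))) (filter (single T) (iota 0 (sz T))) &&
  decide (fun c => size (filter (fun i => ~~ apart c (sz T) i) (iota 0 (sz T))) <= 1) (sz T)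
    (filter (single T) (iota 0 (sz T))) (attach_single T).

(** * Vertices outside the blow-up *)

Section Attach.
Variable G : sgraph.
Implicit Types (A B D S X Y Z : {set G}) (x y z w d : G) (phi psi : nat -> {set G}).
Hypothesis tri_free : forall x y z, adj x y -> adj y z -> adj x z = false.
Hypothesis sq_free : forall x y z t, adj x y -> adj y z -> adj z t -> adj t x ->
  x != z -> y != t -> False.
Hypothesis nuc : ~ has_cycle_with_unique_chord G.
Hypothesis nc1 : no_1_cutset G.
Hypothesis nc2 : no_2_cutset G.

Lemma attach_single_false T phi d (n := sz T) : cfg_ok T -> attach_ok T -> model phi T ->
  (forall i, i < n -> exists x, phi i = [set x]) ->
  (forall i, i < n -> d \notin phi i) ->
  (forall i, i < n -> ~~ single T i -> ~~ touch [set d] (phi i)) ->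
  2 <= #|nbr [set d] :&: region phi (iota 0 n)| -> False.
Proof.
move=> Tok /andP[_ dec] M sing dout dmid.
case/card_gt1P=> x [y [/setIP[xN /regionP[i iI xi]] /setIP[yN /regionP[j jI yj]] xy]].
rewrite !mem_iota /= add0n in iI jI.
pose phi' i := if i == n then [set d] else phi i.
have M' : model phi' (attach_single T).
  apply: (model_extend M); rewrite ?conn1 //.
  - by move=> k kn; rewrite disjoint_sym disjoints1 dout.
  - by rewrite /sz size_nseq.
  - by move=> k _; apply: sing.
  - by exists d.
  - move=> k l kn; rewrite linkedE /= row_rcons -linkedE => kl; constructor 1; split=> //.
    move: kl; apply: contraLR; rewrite -leqNgt => kn'; rewrite linkedE /row nth_default //.
    by have /and3P[_ /eqP-> _] := Tok.
  - move=> k l kn ln kl; rewrite apartE row_links row_rcons !negb_or => /and3P[ap nkl nlk].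
    have mapE a : a < n -> single T a -> (n, a) \in [seq (sz T, i) | i <- iota 0 (sz T) &
      single T i].
      by move=> an sa; apply/mapP; exists a; rewrite // mem_filter sa mem_iota.
    case/ltnS_or: kn => [ek|kn]; case/ltnS_or: ln => [el|ln].
    + by rewrite ek el eqxx in kl.
    + by constructor 2; split=> //; apply: dmid => //; apply: contra nkl; rewrite ek;
      apply: mapE.
    + by constructor 3; split=> //; apply: dmid => //; apply: contra nlk; rewrite el;
      apply: mapE.
    + by constructor 1; split=> //; rewrite apartE.
have [||c [Mc sgc]] := decide_sound tri_free sq_free nuc M' _ _ dec.
- by rewrite /sz /= size_nseq.
- apply/allP => k; rewrite mem_filter mem_iota add0n /= => /andP[_ kn].
  by rewrite /sz /= size_nseq; apply: ltnW.
rewrite leqNgt => /negP; apply.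
have szc : sz c = n.+1 by rewrite /sz sgc size_nseq.
have inF k z : k < n -> z \in phi k -> z \in nbr [set d] ->
    k \in [seq i <- iota 0 (sz T) | ~~ apart c (sz T) i].
  move=> kn zk zN; rewrite mem_filter mem_iota leq0n add0n kn !andbT; apply/negP => ak.
  have := @model_apart _ _ _ Mc n k; rewrite szc ltnSn ltnW // neq_ltn kn orbT.
  move=> /(_ isT isT isT ak); rewrite /phi' eqxx (ltn_eqF kn).
  by case/negP; have := nbr_touch zN; rewrite touchC; apply: touchS; rewrite // sub1set.
have := inF i x iI xi xN; have := inF j y jI yj yN.
have ij : i != j.
  apply: contraNneq xy => eij; rewrite -eij in yj; have [z pz] := sing i iI.
  by move: xi yj; rewrite pz !inE => /eqP-> /eqP->.
have : uniq [seq i <- iota 0 (sz T) | ~~ apart c (sz T) i] by rewrite filter_uniq ?iota_uniq.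
case: (filter _ _) => [|a [|b r]] // _; rewrite !inE => /eqP eja /eqP eia.
by rewrite eia eja eqxx in ij.
Qed.

Lemma attach_pair_false T phi D u v (n := sz T) : cfg_ok T -> model phi T -> conn D ->
  (forall i, i < n -> [disjoint phi i & D]) -> single T u -> single T v -> u != v ->
  (forall i, i < n -> touch D (phi i) = (i == u) || (i == v)) ->
  refuted (attach_pair T u v) -> False.
Proof.
move=> Tok M cD dD su sv uv tD.
have un := single_lt su; have vn := single_lt sv.
have rE k l : l \in row (link (sz T, v) (link (sz T, u) (rcons (yes T) [::]))) k =
    [|| l \in row (yes T) k, (k, l) == (n, u), (l, k) == (n, u), (k, l) == (n, v) | (l, k) ==
      (n, v)].
  by rewrite !row_link row_rcons -!orbA.
have M' : model (fun i => if i == n then D else phi i) (attach_pair T u v).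
  apply: (model_extend M) => //.
  - by rewrite /sz size_rcons.
  - move=> k + kn; rewrite /single /= nth_rcons -/(sz T) kn; exact: (model_single M).
  - by rewrite /single /= nth_rcons -/(sz T) ltnn eqxx.
  - move=> k l kn; rewrite linkedE /= rE => /or4P[kl|/eqP[-> ->]|/eqP[-> ->]|].
    + constructor 1; split; last by rewrite linkedE.
      move: kl; apply: contraLR; rewrite -leqNgt => kn'.
      by rewrite /row nth_default //; have /and3P[_ /eqP-> _] := Tok.
    + by constructor 2; split=> //; rewrite tD // eqxx.
    + by constructor 3; split=> //; rewrite tD // eqxx.
    + case/orP=> /eqP[-> ->].
        by constructor 2; split=> //; rewrite tD // eqxx orbT.
      by constructor 3; split=> //; rewrite tD // eqxx orbT.
  - move=> k l kn ln kl; rewrite apartE rE !negb_or => /and5P[ap n1 n2 n3 n4].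
    case/ltnS_or: kn => [ek|kn]; case/ltnS_or: ln => [el|ln].
    + by rewrite ek el eqxx in kl.
    + constructor 2; split=> //; rewrite tD //; move: n1 n3.
      by rewrite ek !xpair_eqE eqxx /= => /negPf-> /negPf->.
    + constructor 3; split=> //; rewrite tD //; move: n2 n4.
      by rewrite el !xpair_eqE eqxx /= => /negPf-> /negPf->.
    + constructor 1; split=> //; rewrite apartE.
      by have /and3P[/eqP <- _ _] := Tok.
exact: (refuted_sound tri_free sq_free nuc M').
Qed.

Definition fits phi T := (forall i, i < sz T -> exists x, phi i = [set x]) /\
  forall x : G, exists2 i, i < sz T & x \in phi i.

(** Suppose no later configuration has a model. By [mid_step] every set is a single vertex, and
    those of degree two have no further neighbours. If a vertex is left over, a minimal connected
    set [E] outside with two attachments exists. It is not a single vertex, by the second half of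
    [attach_ok], so it has exactly two attachments. *)
Lemma attach_step T Ts phi : cfg_ok T -> attach_ok T -> 1 < sz T ->
  (forall m, m < sz T -> ~~ single T m -> mid_ok Ts T m) -> model phi T ->
  has_model G Ts \/ fits phi T.
Proof.
move=> Tok Aok T2 mok M.
have [|nT] := classic (has_model G Ts); [by left | right].
have mid1 psi m : model psi T -> m < sz T -> ~~ single T m -> exists z, psi m = [set z] /\
    forall y, adj z y -> exists2 u, linked T m u & y \in psi u.
  move=> M' mT sm.
  by have [|//] := mid_step tri_free sq_free nuc nc2 Tok M' mT sm (mok m mT sm).
have sing i : i < sz T -> exists x, phi i = [set x].
  move=> iT; have [si|si] := boolP (single T i); first exact: (model_single M).
  by have [z [pz _]] := mid1 phi i M iT si; exists z.
split=> // x; apply: NNPP => nx.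
pose H := region phi (iota 0 (sz T)).
have HP y : y \in H -> exists2 i, i < sz T & y \in phi i.
  by case/regionP=> i; rewrite mem_iota => iT yi; exists i.
have inH i y : i < sz T -> y \in phi i -> y \in H.
  by move=> iT yi; apply/regionP; exists i; rewrite // mem_iota.
have xH : x \notin H by apply/negP => /HP.
pose D := compo (~: H) x.
have ND : nbr D \subset H by have := nbr_comp (~: H) x; rewrite setCK.
have DH y : y \in D -> y \notin H by move/(subsetP (comp_sub _ _)); rewrite inE.
have Dx : x \in D by apply: mem_comp; rewrite inE.
have D2 : 2 <= #|nbr D :&: H|.
  rewrite (setIidPl ND) ltnNge; apply/negP => D1.
  have [y0 p0] := sing 0 (ltnW T2); have [y1 p1] := sing 1 T2.
  have y0H : y0 \in H by apply: (inH 0); rewrite ?p0 ?set11 // ltnW.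
  have y1H : y1 \in H by apply: (inH 1); rewrite ?p1 ?set11.
  have y01 : y0 != y1.
    by have := model_disj M (ltnW T2) T2 isT; rewrite p0 p1 disjoints1 inE.
  have [y yH sy] : exists2 y, y \in H & nbr D \subset [set y].
    have [D0|[y yD]] := set_0Vmem (nbr D); first by exists y0; rewrite // D0 sub0set.
    exists y; first exact: (subsetP ND).
    by rewrite -(eqP (_ : [set y] == nbr D)) // eqEcard sub1set yD cards1.
  have DT : y |: D = setT.
    by apply: nc1 sy; [apply: contraL yH => /DH | apply/set0Pn; exists x].
  have onlyy z : z \in H -> z = y.
    move=> zH; have : z \in y |: D by rewrite DT.
    by case/setU1P=> // /DH; rewrite zH.
  by rewrite (onlyy y0) // (onlyy y1) // eqxx in y01.
have [E [sE cE E0 E2 alt]] := min_attach (comp_conn _ _) D2.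
have EH y : y \in E -> y \notin H by move/(subsetP sE)/DH.
have Emid m : m < sz T -> ~~ single T m -> ~~ touch E (phi m).
  move=> mT sm; have [z [pz nz]] := mid1 phi m M mT sm.
  apply/touchP => -[e [z' [eE]]]; rewrite pz inE => /eqP-> ez.
  have [|u lmu eu] := nz e; first by rewrite adj_sym.
  have [uT _] := model_linked M mT lmu.
  by have := EH e eE; rewrite (inH u).
have dE i : i < sz T -> [disjoint phi i & E].
  move=> iT; rewrite disjoint_subset; apply/subsetP => y yi; rewrite inE.
  by apply: contraL (inH i y iT yi) => /EH.
have no_single d : E = [set d] -> False.
  move=> eE; rewrite eE in E2 Emid EH; apply: (attach_single_false Tok Aok M sing _ Emid E2).
  move=> i iT; apply/negP => di; have := EH d (set11 d); by rewrite (inH i).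
case: alt => [[d]|e2]; first exact: no_single.
have /card_gt1P[y [z [/setIP[yN yH] /setIP[zN zH] yz]]] := E2.
have NE w : w \in nbr E -> w \in H -> (w == y) || (w == z).
  move=> wN wH; rewrite -in_set2; suff -> : [set y; z] = nbr E :&: H by rewrite inE wN.
  apply/eqP; rewrite eqEcard e2 cards2 yz andbT.
  by apply/subsetP => t /set2P[]->; rewrite inE ?yN ?zN.
have [u uT yu] := HP y yH; have [v vT zv] := HP z zH.
have pu : phi u = [set y] by have [y' py] := sing u uT; move: yu; rewrite py => /set1P->.
have pv : phi v = [set z] by have [z' pz] := sing v vT; move: zv; rewrite pz => /set1P->.
have uv : u != v by apply: contraNneq yz => euv; rewrite euv pv in pu; rewrite (set1_inj pu).
have tE i : i < sz T -> touch E (phi i) = (i == u) || (i == v).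
  move=> iT; apply/idP/orP => [|[]/eqP->]; last 2 first.
  - by rewrite pu touchC nbr_touch.
  - by rewrite pv touchC nbr_touch.
  have [w pw] := sing i iT; rewrite pw touchC => tw.
  have wi : w \in phi i by rewrite pw set11.
  have wN : w \in nbr E.
    by rewrite inE tw andbT; apply: contraL (inH i w iT wi) => /EH.
  have same j t : j < sz T -> phi j = [set t] -> w = t -> i == j.
    move=> jT pj ewt; apply: contraT => ij; have := model_disj M iT jT ij.
    by rewrite pw pj ewt disjoints1 set11.
  by case/orP: (NE w wN (inH i w iT wi)) => /eqP e; [left; apply: same e | right;
    apply: same e].
have su : single T u.
  by apply: contraT => su; have := Emid u uT su; rewrite tE // eqxx.
have sv : single T v.
  by apply: contraT => sv; have := Emid v vT sv; rewrite tE // eqxx orbT.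
have /andP[/everyP pairs _] := Aok.
have inS i : single T i -> i \in [seq i <- iota 0 (sz T) | single T i].
  by move=> si; rewrite mem_filter si mem_iota single_lt.
have := pairs u (inS u su) => /everyP/(_ v (inS v sv)).
case: eqnP => [euv|_]; first by rewrite euv eqxx in uv.
case: ifP => [|_]; last exact: (attach_pair_false Tok M cE dE su sv uv tE).
case/hasP=> m; rewrite mem_iota add0n => mT /and3P[sm lmu lmv] _.
have [u' [v' [_ _ _ _ mE]]] := cfg_mid Tok mT sm.
have mE' j : linked T m j = (j == u) || (j == v).
  move: lmu lmv uv; rewrite !mE => /orP[]/eqP-> /orP[]/eqP->; rewrite ?eqxx //.
  by rewrite orbC.
(* The attachments of [E] are the two neighbours of [m]. Hence [E] can replace [phi m], and
   [mid_step] for this new model makes [E] a single vertex after all. *)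
have M' : model (fun i => if i == m then E else phi i) T.
  apply: (model_replace Tok M) => // i iT im; first exact: dE.
  by rewrite tE // mE'.
by have [d [+ _]] := mid1 _ m M' mT sm; rewrite eqxx; apply: no_single.
Qed.
End Attach.

(** * Reading off the Petersen and Heawood graphs *)

Lemma contains_inj (G H : sgraph) (f : G -> H) : injective f ->
  (forall x y, adj (f x) (f y) = adj x y) -> contains H G.
Proof.
move=> injf adjf; exists (f @: setT).
have fS x : f x \in f @: setT by rewrite imset_f.
exists (fun x => exist _ (f x) (fS x)); split; last by move=> x y; apply: adjf.
apply: inj_card_bij; first by move=> x y [/injf].
rewrite card_sig (@eq_card _ _ (f @: setT)); last by move=> y.
by rewrite card_imset // cardsT.
Qed.

Definition petersen_vertex i : petersen :=
  if i < 5 then inl (inord i) else inr (inord (i - 5)).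
Definition heawood_vertex i : heawood := inord i.

(** Adjacency is repeated on plain numbers, so that the computations never meet ordinals. *)
Definition cyc_nat n i j := (j == i.+1 %[mod n]) || (i == j.+1 %[mod n]).
Definition petersen_nat i j :=
  if i < 5 then (if j < 5 then cyc_nat 5 i j else (i.+1, (j - 5).+1) \in petersen_ab)
  else (if j < 5 then (j.+1, (i - 5).+1) \in petersen_ab else cyc_nat 5 (i - 5) (j - 5)).
Definition heawood_nat i j :=
  [|| cyc_nat 14 i j, (i.+1, j.+1) \in heawood_chords | (j.+1, i.+1) \in heawood_chords].

Lemma petersen_vertexE i j : i < 10 -> j < 10 ->
  adj (petersen_vertex i) (petersen_vertex j) = petersen_nat i j.
Proof.
move=> i10 j10; rewrite /petersen_vertex /petersen_nat.
by case: ltnP => i5; case: ltnP => j5; rewrite /= /cyc_adj ?inordK //; lia.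
Qed.

Lemma heawood_vertexE i j : i < 14 -> j < 14 ->
  adj (heawood_vertex i) (heawood_vertex j) = heawood_nat i j.
Proof. by move=> i14 j14; rewrite /= /heawood_adj /cyc_adj /heawood_vertex !inordK. Qed.

Lemma petersen_vertex_inj i j : i < 10 -> j < 10 -> petersen_vertex i = petersen_vertex j ->
  i = j.
Proof.
move=> i10 j10; rewrite /petersen_vertex.
case: ltnP => i5; case: ltnP => j5 // [] /(congr1 val); rewrite /= !inordK //; lia.
Qed.

Lemma heawood_vertex_inj i j : i < 14 -> j < 14 -> heawood_vertex i = heawood_vertex j -> i = j.
Proof. by move=> i14 j14 /(congr1 val); rewrite /= !inordK. Qed.

Definition embeds n k (base : rel nat) T :=
  (sz T + k == n) && all (fun i => all (fun j =>
    base (i + k) (j + k) == linked T i j) (iota 0 (sz T))) (iota 0 (sz T)).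
Definition petersen_type T := [|| embeds 10 2 petersen_nat T, embeds 10 1 petersen_nat T |
  embeds 10 0 petersen_nat T].
Definition heawood_type T :=
  [|| embeds 14 3 heawood_nat T, embeds 14 2 heawood_nat T, embeds 14 1 heawood_nat T |
    embeds 14 0 heawood_nat T].

Lemma cfgs_type : every (fun T => petersen_type T || heawood_type T) cfgs.
Proof. by vm_compute. Qed.
Lemma cfgs_mids : mids_ok cfgs.
Proof. by vm_compute. Qed.
Lemma cfgs_ok : every (fun T => [&& cfg_ok T, attach_ok T & 1 < sz T]) cfgs.
Proof. by vm_compute. Qed.

Section Final.
Variable G : sgraph.
Implicit Types (x y z : G) (phi : nat -> {set G}).
Hypothesis tri_free : forall x y z, adj x y -> adj y z -> adj x z = false.
Hypothesis sq_free : forall x y z t, adj x y -> adj y z -> adj z t -> adj t x ->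
  x != z -> y != t -> False.
Hypothesis nuc : ~ has_cycle_with_unique_chord G.
Hypothesis nc1 : no_1_cutset G.
Hypothesis nc2 : no_2_cutset G.

(** Induction along the list finds the last configuration with a model; there [attach_step] leaves
    only the alternative that the model is all of [G]. *)
Lemma chain_fits Ts : mids_ok Ts -> every (fun T => [&& cfg_ok T, attach_ok T & 1 < sz T]) Ts ->
  has_model G Ts -> exists T phi, [/\ List.In T Ts, cfg_ok T, model phi T & fits phi T].
Proof.
elim: Ts => [|T Ts IH] /=; first by move=> _ _ [].
case/andP=> /everyP mT mTs; case: ifP => // /and3P[Tok Aok T2] oTs.
have step : has_model G Ts -> exists T0 phi, [/\ T = T0 \/ List.In T0 Ts, cfg_ok T0, model
  phi T0 & fits phi T0].
  by case/(IH mTs oTs)=> T0 [phi [iT ok M F]]; exists T0, phi; split; auto.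
case=> T0 [<-|iT0] [phi M]; last by apply: step; exists T0 => //; exists phi.
have [//||F] := attach_step tri_free sq_free nuc nc1 nc2 (Ts := Ts) Tok Aok T2 _ M.
- move=> m mlt sm; have := mT m; rewrite mem_iota mlt (negPf sm); by apply.
- exact: step.
by exists T, phi; split; auto.
Qed.

Lemma fits_contains (H : sgraph) (vertex : nat -> H) (n k : nat) (base : rel nat) T phi :
  (forall i j, i < n -> j < n -> adj (vertex i) (vertex j) = base i j) ->
  (forall i j, i < n -> j < n -> vertex i = vertex j -> i = j) ->
  cfg_ok T -> embeds n k base T -> model phi T -> fits phi T -> contains H G.
Proof.
move=> adjv injv Tok /andP[/eqP nE /allP emb] M [sing cov].
have ex x : exists i, (i < sz T) && (x \in phi i).
  by have [i iT xi] := cov x; exists i; rewrite iT.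
pose ix x := xchoose (ex x).
have ixP x : ix x < sz T /\ phi (ix x) = [set x].
  have /andP[iT xi] := xchooseP (ex x); split=> //.
  by have [y py] := sing _ iT; move: xi; rewrite /ix py => /set1P->.
have lt_n i : i < sz T -> i + k < n by rewrite -nE ltn_add2r.
apply: (@contains_inj _ _ (fun x => vertex (ix x + k))).
  move=> x y; have [xT px] := ixP x; have [yT py] := ixP y.
  move/(injv _ _ (lt_n _ xT) (lt_n _ yT))/addIn => e.
  by apply: set1_inj; rewrite -px -py e.
move=> x y; have [xT px] := ixP x; have [yT py] := ixP y.
rewrite adjv ?lt_n //; have iT i : i < sz T -> i \in iota 0 (sz T) by rewrite mem_iota.
have /allP/(_ _ (iT _ yT))/eqP-> := emb _ (iT _ xT).
apply/idP/idP => [l|xy].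
  have [_] := model_linked M xT l.
  by rewrite px py => /touch1P[y' /set1P->].
have nij : ix x != ix y by apply: contraTneq xy => e; rewrite e py in px;
  rewrite (set1_inj px) adj_irr.
apply: contraT => nl; have := model_apart M xT yT nij.
rewrite (cfg_apart Tok) nl px py => /(_ isT)/negP[].
exact: touchI (set11 x) (set11 y) xy.
Qed.

Lemma model_contains : has_model G cfgs -> contains petersen G \/ contains heawood G.
Proof.
case/(chain_fits cfgs_mids cfgs_ok)=> T [phi [iT Tok M F]].
have : petersen_type T || heawood_type T.
  move: iT cfgs_type; elim: cfgs => //= T' Ts IH [->|/IH{}IH]; case: ifP => //.
have P k : embeds 10 k petersen_nat T -> contains petersen G.
  by move=> e; apply: (fits_contains petersen_vertexE petersen_vertex_inj Tok e M F).
have W k : embeds 14 k heawood_nat T -> contains heawood G.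
  by move=> e; apply: (fits_contains heawood_vertexE heawood_vertex_inj Tok e M F).
by case/orP=> [/or3P[] e|/or4P[] e]; [left|left|left|right|right|right|right]; eauto.
Qed.
End Final.

(** * Adjacent vertices of degree two *)

Section Degrees.
Variable G : sgraph.
Implicit Types (A B S : {set G}) (x y z a b v : G) (s p : seq G).

(** The only neighbour of a vertex of degree one is a 1-cutset unless these two vertices are the
    whole graph, which is then a clique. *)
Lemma degree_ge2 : connected G -> no_1_cutset G -> ~ clique G -> forall x, 2 <= degree x.
Proof.
move=> cG nc1 ncl x; rewrite leqNgt; apply/negP => d1; apply: ncl.
have nN v : adj x v -> nbr [set x] \subset [set v].
  move=> xv; apply/subsetP => y /nbrP[_ [_ /set1P-> xy]]; rewrite inE.
  have /cards1P[w ew] : #|[set z | adj x z]| == 1.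
    by rewrite eqn_leq -ltnS d1 /=; apply/card_gt0P; exists v; rewrite inE.
  have : y \in [set z | adj x z] by rewrite inE.
  have : v \in [set z | adj x z] by rewrite inE.
  by rewrite ew !inE => /eqP-> /eqP->.
have step v : v != x -> exists w, adj x w.
  move=> vx; have /connectP[[|w p] /=] := cG x v; first by move=> _ e; rewrite e eqxx in vx.
  by case/andP=> xw _ _; exists w.
move=> y z yz; have [v vx] : exists v, v != x.
  by have [ey|yx] := eqVneq y x; [exists z; rewrite -ey eq_sym | exists y].
have [w xw] := step v vx.
have wT : w |: [set x] = setT.
  apply: nc1 (nN w xw); first by rewrite inE eq_sym adj_neq.
  by apply/set0Pn; exists x; rewrite set11.
have : y \in w |: [set x] by rewrite wT.
have : z \in w |: [set x] by rewrite wT.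
by rewrite !inE => /orP[]/eqP ez /orP[]/eqP ey; move: yz; rewrite ez ey ?eqxx // adj_sym.
Qed.

Lemma degree2_nbr x a b z : degree x = 2 -> adj x a -> adj x b -> a != b -> adj x z ->
  z = a \/ z = b.
Proof.
move=> dx xa xb ab xz; have : z \in [set y | adj x y] by rewrite inE.
have <- : [set a; b] = [set y | adj x y].
  apply/eqP; rewrite eqEcard cards2 ab; apply/andP; split; last by rewrite -dx.
  by apply/subsetP => y /set2P[]->; rewrite inE.
by case/set2P; auto.
Qed.

Lemma degree2_other x a : 2 <= degree x -> exists2 b, b != a & adj x b.
Proof.
move=> dx; have /card_gt1P[b [c [+ + bc]]] : 1 < #|[set y | adj x y]| by [].
rewrite !inE => xb xc; have [eb|nb] := eqVneq b a; last by exists b.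
by exists c; rewrite // -eb eq_sym.
Qed.

Lemma degree3_other x a b : 3 <= degree x -> exists c, [/\ c != a, c != b & adj x c].
Proof.
move=> dx; have : 0 < #|[set y | adj x y] :\: [set a; b]|.
  rewrite -(ltn_add2l #|[set y | adj x y] :&: [set a; b]|) addn0 cardsID.
  apply: leq_trans dx; rewrite ltnS; apply: leq_trans (subset_leq_card (subsetIr _ _)) _.
  by rewrite cards2; case: (_ != _).
by case/card_gt0P=> c; rewrite !inE negb_or => /andP[/andP[ca cb] xc]; exists c.
Qed.

(** A path of vertices of degree two. Its ends may be adjacent, which is the case of a hole. *)
Definition thread s := [&& uniq s, sorted (@adj G) s, all (fun x => degree x == 2) s & 1 <
  size s].

Lemma thread_rev s : thread s -> thread (rev s).
Proof.
rewrite /thread rev_uniq all_rev size_rev rev_sorted => /and4P[-> srt -> ->].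
by rewrite (eq_sorted (e' := @adj G)) ?srt // => x y; apply: adj_sym.
Qed.

Lemma thread_inner s s1 a v b s2 z : thread s -> s = s1 ++ a :: v :: b :: s2 -> adj v z ->
  z = a \/ z = b.
Proof.
case/and4P=> us srt /allP d2 _ e; rewrite e in us srt d2.
have dv : degree v = 2 by apply/eqP/d2; rewrite mem_cat !inE eqxx !orbT.
move: us; rewrite cat_uniq /= !inE !negb_or => /and3P[_ _ /andP[/and3P[_ ab _] _]].
have [av vb] : adj a v /\ adj v b.
  by have [_ /= /and3P[]] := cat_sorted2 srt.
by apply: degree2_nbr; rewrite // adj_sym.
Qed.

(** The second neighbour [a] of the first vertex can lie on the thread only as its last vertex,
    because an inner vertex has both its neighbours next to it on the thread. *)
Lemma thread_head x y p : thread (x :: y :: p) ->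
  exists a, [/\ a != y, adj x a, forall z, adj x z -> z = y \/ z = a &
    a \in x :: y :: p -> a = last y p].
Proof.
move=> th; have /and4P[us /= /andP[xy _] /andP[/eqP dx _] _] := th.
have [a ay xa] := @degree2_other x y (eq_leq (esym dx)).
exists a; split=> //; first by move=> z; apply: degree2_nbr; rewrite // eq_sym.
rewrite !inE (negPf ay) eq_sym (negPf (adj_neq xa)) /= => ap.
apply/eqP; apply: contraT => nal.
have [s1 [s2 ep]] := mem_split ap.
case: s2 ep => [|a2 s2] ep; first by rewrite ep last_cat eqxx in nal.
have xyp : x \notin y :: p by case/andP: us.
have ax : adj a x by rewrite adj_sym.
have es : x :: y :: p = (x :: belast y s1) ++ last y s1 :: a :: a2 :: s2.
  by rewrite ep -[RHS]cat_rcons rcons_cons -lastI.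
case: (thread_inner th es ax) => ex; case/negP: xyp; rewrite {1}ex ep.
  by rewrite -cat_cons mem_cat mem_last.
by rewrite inE mem_cat !inE eqxx !orbT.
Qed.

Lemma thread_tail s : thread s -> exists r y x, s = rcons (rcons r y) x.
Proof.
case/and4P=> _ _ _; case/lastP: s => // s x; case/lastP: s => // r y _.
by exists r, y, x.
Qed.

Lemma thread_mem_nbr s x z : thread s -> x \in s -> adj x z ->
  z \in s \/ x = head x s \/ x = last x s.
Proof.
move=> th xs xz; have [s1 [s2 es]] := mem_split xs.
case: s2 es => [|b s2] es; first by right; right; rewrite es last_cat.
case/lastP: s1 es => [|s1 a] es; first by right; left; rewrite es.
rewrite cat_rcons in es; left.
by case: (thread_inner th es xz) => ->; rewrite es mem_cat !inE eqxx !orbT.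
Qed.

Section Threads.
Hypothesis cG : connected G.
Hypothesis tri_free : forall x y z, adj x y -> adj y z -> adj x z = false.
Hypothesis sq_free : forall x y z t, adj x y -> adj y z -> adj z t -> adj t x ->
  x != z -> y != t -> False.
Hypothesis nuc : ~ has_cycle_with_unique_chord G.
Hypothesis nc1 : no_1_cutset G.
Hypothesis nc2 : no_2_cutset G.
Hypothesis deg2 : forall x, 2 <= degree x.

Lemma connected_all (S : {set G}) x : x \in S ->
  (forall y z, y \in S -> adj y z -> z \in S) -> forall y, y \in S.
Proof.
move=> xS cl y; have /connectP[p xp ->] := cG x y.
elim: p x xS xp => //= z p IHp x xS /andP[xz zp]; apply: IHp zp; exact: cl xz.
Qed.

(** Every vertex has degree two and spends it on its two neighbours along the cycle, so there is no
    chord. The condition on [last y p] excludes a thread of two vertices, and [tri_free] a cycle of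
    length three. *)
Lemma closed_thread x y p (s := x :: y :: p) : thread s -> adj (last y p) x -> last y p != y ->
  (forall z, z \in s) -> is_hole s.
Proof.
move=> th lx ly all_s; have /and4P[us srt /allP d2 _] := th.
have cyc : cycle (@adj G) s by move: srt => /= /andP[xy yp]; rewrite xy rcons_path yp.
have edge u v : adj u v -> [set u; v] \in cycle_edges s.
  move=> uv; have [i r er] := rot_to (all_s u).
  have ur : uniq (u :: r) by rewrite -er rot_uniq.
  have cr : cycle (@adj G) (u :: r) by rewrite -er rot_cycle.
  rewrite -(cycle_edges_rot i us) er.
  have sr : size r = (size p).+1 by have := congr1 size er; rewrite size_rot => -[].
  case: r ur cr er sr => // v1; case/lastP=> [|r w] ur cr er sr.
    by move: ly; case: (p) sr => //=; rewrite eqxx.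
  move: cr; rewrite /= rcons_path last_rcons => /and3P[uv1 _ wu].
  have v1w : v1 != w by move: ur; rewrite /= mem_rcons inE negb_or => /and3P[_ /andP[]].
  have uw : adj u w by rewrite adj_sym.
  have du : degree u = 2 by apply/eqP/d2.
  have [->|->] := degree2_nbr du uv1 uw v1w uv; first exact: (@mem_cycle_edges _ [::]).
  rewrite -(cycle_edges_rot (size (u :: v1 :: r)) ur) -rcons_cons -rcons_cons -cats1
    rot_size_cat /=.
  rewrite set2C; apply: (@mem_cycle_edges _ [::]).
  by rewrite -cat1s -(rot_size_cat (u :: v1 :: r)) rot_uniq cats1.
split.
- rewrite /is_cycle /ucycleb cyc us !andbT /s /=.
  by case: (p) ly => //=; rewrite eqxx.
- rewrite /s /=; case ep: p => [|z [|t r]] //; first by rewrite ep eqxx in ly.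
  move: srt lx; rewrite /s ep /= andbT => /andP[xy yz] zx.
  by have := tri_free xy yz; rewrite adj_sym zx.
apply/setP => E; rewrite !inE; apply/negP => /and3P[/imsetP[[u v] uv ->] _ /negP[]].
by apply: edge; rewrite inE in uv.
Qed.

Definition closed_at s := exists u v p, [/\ s = [:: u, v & p], adj (last v p) u,
  last v p != v & forall z, z \in s].

(** If the outer neighbour [a] of the first vertex lies on the thread, the thread is closed under
    adjacency and is all of [G]. If not, [a] has degree at least three, or it would extend the
    thread. *)
Lemma thread_closed_or_out s : thread s -> (forall t, thread t -> size t <= size s) ->
  closed_at s \/ exists x a, [/\ x = head a s, x \in s, a \notin s, adj x a &
    3 <= degree a /\ forall z, adj x z -> z \in s \/ z = a].
Proof.
move=> th maxs; have := th; case: s th maxs => [|x [|y p]] th maxs; try by case/and4P.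
set s := x :: y :: p in th maxs *; move=> _.
have [a [ay xa nx ain]] := thread_head th.
have mem_y : y \in s by rewrite /s !in_cons eqxx orbT.
have [ap|ap] := boolP (a \in s); [left | right].
  exists x, y, p; rewrite -ain //; split=> //; first by rewrite adj_sym.
  move=> z0; suff : z0 \in [set:: s] by rewrite inE.
  apply: (@connected_all _ x) => [|z w]; first by rewrite inE mem_head.
  rewrite [z \in _]inE [w \in _]inE => zs zw; have [//|[ez|ez]] := thread_mem_nbr th zs zw.
    by move: zw; rewrite ez => /nx[]-> //; apply: mem_y.
  have := thread_rev th; have [x' [y' [p' er]]] : exists x' y' p', rev s = [:: x', y' & p'].
    by have [r [y' [x' ->]]] := thread_tail th; rewrite !rev_rcons; exists x', y', (rev r).
  have es : s = rcons (rcons (rev p') y') x' by rewrite -[s]revK er !rev_cons.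
  have ez' : z = x' by rewrite ez es last_rcons.
  rewrite er => /thread_head[b [_ _ nx' _]].
  have zx : adj x' x.
    by rewrite -ez' ez /s /= -(ain ap) adj_sym.
  have zw' : adj x' w by rewrite -ez'.
  have [ew|ew] := nx' w zw'; first by rewrite -(mem_rev s) er ew !in_cons eqxx orbT.
  have [exy|exb] := nx' x zx; last by rewrite ew -exb mem_head.
  (* Here [x] comes just before the last vertex, so the thread has only two vertices and its last
     one, which is [a], would be [y]. *)
  have p0 : p = [::].
    have e : x :: y :: p = rev p' ++ [:: y'; x'] by rewrite -/s es -!cats1 -catA.
    case: (rev p') e => [|t r] /= [ext e]; first by case: e.
    have /and4P[/andP[+ _] _ _ _] := th; rewrite e ext -ext exy mem_cat !inE eqxx !orbT //.
  by rewrite (ain ap) p0 /= eqxx in ay.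
have da : 3 <= degree a.
  rewrite ltn_neqAle deg2 andbT eq_sym; apply/eqP => da.
  have : thread (a :: s).
    have /and4P[us srt d2 _] := th; apply/and4P; split=> //.
    - by rewrite cons_uniq ap.
    - by apply/andP; rewrite adj_sym xa.
    - by apply/andP; rewrite da.
  by move/maxs; rewrite /= ltnn.
exists x, a; split=> //; first by rewrite mem_head.
by split=> // z /nx[->|->]; [left | right].
Qed.

Lemma max_thread s0 : thread s0 -> exists2 s, thread s & forall t, thread t -> size t <= size s.
Proof.
move=> th0; have szG s : thread s -> size s <= #|G|.
  by case/and4P=> /card_uniqP <- _ _ _; apply: max_card.
have [|n [s [th ->]] minn] := @ex_min_nat (fun n => exists s, thread s /\ n = #|G| - size s).
  by exists (#|G| - size s0), s0.
exists s => // t tht; have := minn (#|G| - size t); have := szG s th; have := szG t tht.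
move=> tG sG /(_ _)H; have {}H : #|G| - size s <= #|G| - size t by apply: H; exists t.
by rewrite leq_sub2lE in H.
Qed.

(** Let [a] and [b] be the attachments of a longest thread that does not close up. If [a = b], this
    vertex is a 1-cutset. If they are adjacent, the thread and another component of the rest make
    [ab] a unique chord. Otherwise they are a 2-cutset. *)
Lemma adjacent_degree2 x y : adj x y -> degree x = 2 -> degree y = 2 ->
  exists2 s, thread s & closed_at s.
Proof.
move=> xy dx dy.
have th0 : thread [:: x; y] by rewrite /thread /= inE adj_neq // xy dx dy.
have [s th maxs] := max_thread th0.
have [c|[u [a [eu us as_ ua [da nu]]]]] := thread_closed_or_out th maxs; first by exists s.
have thr := thread_rev th.
have maxr t : thread t -> size t <= size (rev s) by rewrite size_rev; apply: maxs.
have [c|[w [b [ew ws bs wb [db nw]]]]] := thread_closed_or_out thr maxr;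
  first by exists (rev s).
rewrite mem_rev in ws; rewrite mem_rev in bs.
have nw' z : adj w z -> z \in s \/ z = b by move/nw; rewrite mem_rev.
have ends v z : v \in s -> adj v z -> z \notin s -> (v = u /\ z = a) \/ (v = w /\ z = b).
  move=> vs vz zs; case: (thread_mem_nbr th vs vz) => [zs'|[ev|ev]].
  - by rewrite zs' in zs.
  - left; have euv : u = v.
      by rewrite eu ev; case: (s) us.
    by split=> //; move: vz; rewrite -euv => /nu[zs'|//]; rewrite zs' in zs.
  - right; have ewv : w = v.
      by rewrite ew ev; case/lastP: (s) ws => // r t _; rewrite rev_rcons last_rcons.
    by split=> //; move: vz; rewrite -ewv => /nw'[zs'|//]; rewrite zs' in zs.
exfalso; pose S := [set:: s].
have SE z : (z \in S) = (z \in s) by rewrite inE.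
have NS : nbr S \subset [set a; b].
  apply/subsetP => z /nbrP[+ [v + vz]]; rewrite !SE => zs vs.
  by case: (ends v z vs vz zs) => [[_ ->]|[_ ->]]; rewrite !inE eqxx ?orbT.
have cS : conn S.
  have /and4P[_ srt _ _] := th; rewrite /S; case: (s) srt us => // t r srt _; exact: path_conn.
have aS : a \notin S by rewrite SE.
have bS : b \notin S by rewrite SE.
have [eab|nab] := eqVneq a b.
  have aT : a |: S = setT.
    by apply: nc1 => //; [apply/set0Pn; exists u; rewrite SE | move: NS; rewrite -eab setUid].
  have [c [cu cw ac]] := degree3_other u w da.
  have : c \in a |: S by rewrite aT in_setT.
  case/setU1P=> [eca|]; first by rewrite eca adj_irr in ac.
  rewrite SE adj_sym in ac * => cs; case: (ends c a cs ac as_) => -[ec _].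
    by rewrite ec eqxx in cu.
  by rewrite ec eqxx in cw.
have [a1 [a1u a1b aa1]] := degree3_other u b da.
have notS c : c != u -> adj a c -> c \notin s.
  move=> cu; rewrite adj_sym => ca; apply/negP => cs; case: (ends c a cs ca as_) => -[ec ea].
    by rewrite ec eqxx in cu.
  by rewrite ea eqxx in nab.
have a1s := notS a1 a1u aa1.
have a1a : a1 != a by rewrite eq_sym adj_neq.
have [ab|nadj] := boolP (adj a b).
  pose C := compo (~: (S :|: [set a; b])) a1.
  have sC : C \subset ~: (S :|: [set a; b]) := comp_sub _ _.
  have CE z : z \in C -> [/\ z \notin S, z != a & z != b].
    by move/(subsetP sC); rewrite in_setC in_setU in_set2 !negb_or => /and3P[].
  have nSC : ~~ touch S C.
    apply/touchP => -[v [c [vS cC vc]]]; have [cS' ca cb] := CE c cC.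
    have : c \in nbr S by apply/nbrP; split=> //; exists v.
    by move/(subsetP NS); rewrite !inE (negPf ca) (negPf cb).
  have NC : nbr C \subset [set a; b].
    apply/subsetP => z zN; have := subsetP (nbr_comp _ _) z zN; rewrite setCK in_setU.
    case/orP=> // zS; case/negP: nSC; rewrite touchC.
    have /nbrP[_ [c cC cz]] := zN; exact: touchI cC zS cz.
  have C0 : C != set0.
    by apply/set0Pn; exists a1; apply: mem_comp;
      rewrite in_setC in_setU in_set2 !negb_or SE a1s a1a.
  have aC : a \notin C by apply/negP => /CE[_]; rewrite eqxx.
  have bC : b \notin C by apply/negP => /CE[_ _]; rewrite eqxx.
  have [tA tB] := comp_touch2 nc1 C0 NC nab aC bC.
  apply: nuc; apply: (unique_chord ab cS (comp_conn _ _) _ _ _ tA tB nSC).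
  - by rewrite disjoint_subset; apply/subsetP => z zS; rewrite inE; apply: contraL zS => /CE[].
  - by apply: (touchI (set11 a) (_ : u \in S)); rewrite ?SE // adj_sym.
  - by apply: (touchI (set11 b) (_ : w \in S)); rewrite ?SE // adj_sym.
have S2 : 1 < #|S|.
  by have /and4P[us' _ _ s2] := th; rewrite cardsE (card_uniqP us').
apply: (nc2 nab nadj da db aS bS NS S2).
have [a2 [a2u a21 aa2]] := degree3_other u a1 da.
have inR c : adj a c -> c != u -> c \in ~: (S :|: [set a; b]).
  move=> ac cu; rewrite in_setC in_setU in_set2 !negb_or SE notS //=.
  by rewrite eq_sym adj_neq //=; apply: contraNneq nadj => <-.
by apply/card_gt1P; exists a1, a2; rewrite !inR // eq_sym.
Qed.

Lemma seq_contains x0 s idx : uniq s -> (forall x, x \in s) -> uniq idx -> size idx = size s ->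
  all (fun i => i < 10) idx ->
  (forall i j, i < size s -> j < size s ->
    adj (nth x0 s i) (nth x0 s j) = petersen_nat (nth 0 idx i) (nth 0 idx j)) ->
  contains petersen G.
Proof.
move=> us all_s ui si /allP i10 adjs.
have lt x : index x s < size s by rewrite index_mem.
have lt10 x : nth 0 idx (index x s) < 10 by apply/i10/mem_nth; rewrite si.
apply: (@contains_inj _ _ (fun x => petersen_vertex (nth 0 idx (index x s)))).
  move=> x y /(petersen_vertex_inj (lt10 x) (lt10 y))/eqP.
  rewrite nth_uniq ?si // => /eqP e.
  by rewrite -(nth_index x0 (all_s x)) -(nth_index x0 (all_s y)) e.
by move=> x y; rewrite petersen_vertexE // -adjs // !nth_index.
Qed.

Lemma closed_thread_hole s : thread s -> closed_at s ->
  contains petersen G \/ hole_graph_geq G 7.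
Proof.
move=> th [x [y [p [es lx ly all_s]]]]; rewrite es in th all_s.
have hs := closed_thread th lx ly all_s.
have /and4P[us srt _ _] := th.
have [s7|] := leqP 7 (size [:: x, y & p]); first by right; exists [:: x, y & p].
case: hs => _ s4 _ {ly}; case: p th all_s lx us srt s4 {es} => [|z [|t [|r [|w [|? ?]]]]] //
  _ all_s /= lx us.
- move=> /and4P[xy yz zt _] _ _; move: us; rewrite !inE !negb_or -!andbA.
  by case/and5P=> _ xz _ _ /andP[yt _]; case: (sq_free xy yz zt lx xz yt).
- move=> /and5P[xy yz zt tr _] _ _; left.
  (* The 5-cycle on the vertices [a_i] of the Petersen graph. *)
  apply: (@seq_contains x [:: x; y; z; t; r] [:: 0; 1; 2; 3; 4]) => // i j.
  have f1 := tri_free xy yz; have f2 := tri_free yz zt; have f3 := tri_free zt tr.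
  have f4 := tri_free tr lx; have f5 := tri_free lx xy.
  have [yx zy tz] := And3 (etrans (adj_sym _ _) xy) (etrans (adj_sym _ _) yz) (etrans
    (adj_sym _ _) zt).
  have [rt xr] := conj (etrans (adj_sym _ _) tr) (etrans (adj_sym _ _) lx).
  have [g1 g2 g3] := And3 (etrans (adj_sym _ _) f1) (etrans (adj_sym _ _) f2) (etrans
    (adj_sym _ _) f3).
  have [g4 g5] := conj (etrans (adj_sym _ _) f4) (etrans (adj_sym _ _) f5).
  by case: i => [|[|[|[|[|i]]]]] //; case: j => [|[|[|[|[|j]]]]] // _ _;
    rewrite [nth]lock /= -lock /= ?adj_irr.
move=> /and5P[xy yz zt tr /andP[rw _]] _ _; left.
have f1 := tri_free xy yz; have f2 := tri_free yz zt; have f3 := tri_free zt tr.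
have f4 := tri_free tr rw; have f5 := tri_free rw lx; have f6 := tri_free lx xy.
have far a b c d e f : uniq [:: a; b; c; d; e; f] -> adj a b -> adj b c -> adj c d -> adj a d
  = false.
  rewrite /= !inE !negb_or -!andbA => /and5P[_ ac _ _ /and5P[_ _ bd _ _]] ab bc cd.
  by apply/negP; rewrite adj_sym => da; apply: (sq_free ab bc cd da ac bd).
have h1 := far x y z t r w us xy yz zt.
have us0 : uniq [:: x; y; z; t; r; w] := us.
have us1 : uniq (rot 1 [:: x; y; z; t; r; w]) by rewrite rot_uniq.
have h2 := far _ _ _ _ _ _ us1 yz zt tr.
have us2 : uniq (rot 2 [:: x; y; z; t; r; w]) by rewrite rot_uniq.
have h3 := far _ _ _ _ _ _ us2 zt tr rw.
(* The induced 6-cycle a3, a4, b5, b4, b3, b2 of the Petersen graph. *)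
apply: (@seq_contains x [:: x; y; z; t; r; w] [:: 2; 3; 9; 8; 7; 6]) => // i j.
have S (u v : G) (o : bool) : adj u v = o -> adj v u = o by rewrite adj_sym.
have e1 := S _ _ _ xy; have e2 := S _ _ _ yz; have e3 := S _ _ _ zt; have e4 := S _ _ _ tr.
have e5 := S _ _ _ rw; have e6 := S _ _ _ lx.
have g1 := S _ _ _ f1; have g2 := S _ _ _ f2; have g3 := S _ _ _ f3; have g4 := S _ _ _ f4.
have g5 := S _ _ _ f5; have g6 := S _ _ _ f6.
have k1 := S _ _ _ h1; have k2 := S _ _ _ h2; have k3 := S _ _ _ h3.
by case: i => [|[|[|[|[|[|i]]]]]] //; case: j => [|[|[|[|[|[|j]]]]]] // _ _;
  rewrite [nth]lock /= -lock /= ?adj_irr.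
Qed.
End Threads.
End Degrees.

(** * Edges between vertices of degree at least three *)

Section Ladder.
Variable G : sgraph.
Implicit Types (A B C D E F K P Q R S T : {set G}) (x y z a b c u v w : G).
Hypothesis nuc : ~ has_cycle_with_unique_chord G.
Hypothesis nc1 : no_1_cutset G.
Hypothesis nc2 : no_2_cutset G.
Hypothesis deg2 : forall x, 2 <= degree x.
Hypothesis deg2_stable : forall x y, adj x y -> degree x = 2 -> degree y != 2.

Lemma nbr_ntouch (F N T : {set G}) : nbr F \subset N -> [disjoint F & T] -> [disjoint N & T]
  -> ~~ touch F T.
Proof.
move=> sN FT NT; apply/touchP => -[f [t [fF tT ft]]].
have tF : t \notin F by apply: contraL tT => tF; rewrite (disjointFr FT).
have : t \in nbr F by apply/nbrP; split=> //; exists f.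
by move/(subsetP sN)/(disjointFr NT); rewrite tT.
Qed.

Lemma conn_ind S (Pr : G -> Prop) u : conn S -> u \in S -> Pr u ->
  (forall v w, v \in S -> w \in S -> adj v w -> Pr v -> Pr w) -> forall v, v \in S -> Pr v.
Proof.
move=> /connP cS uS Pu step v vS; have /connectP[p up ->] := cS u v uS vS.
elim: p u uS Pu up => //= w p IHp u uS Pu /andP[/and3P[uw _ wS] wp].
by apply: (IHp w) => //; apply: step uw Pu.
Qed.

(** Every component of [P :\ v] sees [v], so without one of them the others still hang together at
    [v]. *)
Lemma conn_minus_comp P v w : conn P -> v \in P -> conn (P :\: compo (P :\ v) w).
Proof.
move=> cP vP; set K := compo _ _; apply: connI => A sA A0 clA.
have sAP : A \subset P by apply: subset_trans sA (subsetDl _ _).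
have AK a : a \in A -> a \notin K by move/(subsetP sA)/setDP=> [].
have vK : v \notin K by apply/negP => /(subsetP (comp_sub _ _)); rewrite !inE eqxx.
have vA : v \in A.
  apply: contraT => vA; suff eA : A = P by rewrite eA vP in vA.
  apply: conn_cut => // a z aA zP az; apply: (clA a z) => //; rewrite inE zP andbT.
  apply: contra (AK a aA) => zK; apply: comp_closed zK _ _; last by rewrite adj_sym.
  by rewrite !inE (subsetP sAP) // andbT; apply: contraNneq vA => <-.
have eAK : A :|: K = P.
  apply: conn_cut => //.
  - by rewrite subUset sAP (subset_trans (comp_sub _ _)) // subsetDl.
  - by apply/set0Pn; exists v; rewrite inE vA.
  move=> a z /setUP[aA|aK] zP az; rewrite inE.
    have [zK|zK] := boolP (z \in K); first by rewrite orbT.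
    by rewrite (clA a) // inE zK.
  have [->|zv] := eqVneq z v; first by rewrite vA.
  by rewrite (comp_closed aK _ az) ?orbT // !inE zv.
by apply/subsetP => z /setDP[]; rewrite -eAK inE => /orP[//|->].
Qed.

Section Fan.
Variables x y : G.
Hypotheses (xy : adj x y) (dx : 3 <= degree x) (dy : 3 <= degree y).

(** In other words, deleting [c] and the edge [xy] does not separate [x] from [y]. Otherwise let
    [Xo] be the union of the components on the side of [x]: its only attachments are [x] and [c],
    which leads to a 2-cutset or to a unique chord. *)
Lemma link_avoid c : c != x -> c != y -> exists S, [/\ conn S, S \subset ~: [set x; y; c],
  touch [set x] S & touch [set y] S].
Proof.
move=> cx cy; apply: NNPP => noS; set W := ~: [set x; y; c] in noS.
have WE v : (v \in W) = [&& v != x, v != y & v != c] by rewrite !inE !negb_or -andbA.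
have cxW v : touch [set x] (compo W v) -> touch [set y] (compo W v) -> False.
  by move=> tx ty; apply: noS; exists (compo W v); split; rewrite ?comp_conn ?comp_sub.
pose Xo := [set v in W | touch [set x] (compo W v)].
have XW v : v \in Xo -> v \in W by rewrite inE => /andP[].
have inX v : v \in W -> adj x v -> v \in Xo.
  by move=> vW xv; rewrite inE vW (touchI (set11 x) (mem_comp vW) xv).
have NX : nbr Xo \subset [set x; c].
  apply/subsetP => w /nbrP[wX [v]]; rewrite inE => /andP[vW tv] vw.
  rewrite !inE; apply: contraR wX; rewrite negb_or => /andP[wx wc].
  have vC := mem_comp vW; have [ewy|wy] := eqVneq w y.
    by case: (cxW v tv); rewrite touchC; apply: touchI vC (set11 y) _; rewrite -ewy.
  have wW : w \in W by rewrite WE wx wy.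
  by rewrite inE wW (@comp_id _ W v) // (comp_closed vC).
have compN v : v \in W -> nbr (compo W v) \subset [set x; y; c].
  by move=> vW; have := nbr_comp W v; rewrite setCK.
have compX v z : z \in [set x; y; c] -> z \notin compo W v.
  by move=> zS; apply/negP => /(subsetP (comp_sub _ _)); rewrite inE zS.
have comp0 v : v \in W -> compo W v != set0 by move=> vW; apply/set0Pn; exists v;
  apply: mem_comp.
have [xS yS cS] : [/\ x \in [set x; y; c], y \in [set x; y; c] & c \in [set x; y; c]].
  by rewrite !inE !eqxx !orbT.
have seeC u v : v \in W -> u \in [set x; y; c] -> u != c ->
    nbr (compo W v) \subset [set u; c] -> touch [set c] (compo W v).
  move=> vW uS uc sN.
  by have [] := comp_touch2 nc1 (comp0 v vW) sN uc (compX v u uS) (compX v c cS).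
have [y1 [y1x y1c yy1]] := degree3_other x c dy.
have y1W : y1 \in W by rewrite WE y1x y1c eq_sym adj_neq.
pose E' := compo W y1.
have tyE : touch [set y] E' by apply: touchI (set11 y) (mem_comp y1W) yy1.
have ntxE : ~~ touch [set x] E' by apply/negP => t; apply: cxW t tyE.
have dropN u v z : v \in W -> ~~ touch [set z] (compo W v) ->
   nbr (compo W v) \subset [set u; z; c] -> nbr (compo W v) \subset [set u; c].
  move=> vW nt sN; apply/subsetP => w wN; have := subsetP sN w wN.
  rewrite !inE => /orP[/orP[->//|/eqP ewz]|->]; last by rewrite orbT.
  by rewrite -ewz nbr_touch in nt.
have tcE : touch [set c] E'.
  apply: (seeC y) => //; first by rewrite eq_sym.
  by apply: (dropN y y1 x) => //; rewrite [[set y; x]]set2C compN.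
have E'X v : v \in E' -> v \notin Xo.
  move=> vE; rewrite inE; apply/nandP; right; rewrite (@comp_id _ W y1) //.
have [x1 [x1y x1c xx1]] := degree3_other y c dx.
have x1W : x1 \in W by rewrite WE x1y x1c eq_sym adj_neq.
have x1X := inX x1 x1W xx1.
pose E := compo W x1.
have txE : touch [set x] E by apply: touchI (set11 x) (mem_comp x1W) xx1.
have ntyE : ~~ touch [set y] E by apply/negP => t; apply: cxW txE t.
have tcX : touch [set c] E.
  apply: (seeC x) => //; first by rewrite eq_sym.
  by apply: (dropN x x1 y) => //; apply: compN.
have sEX : E \subset Xo.
  apply/subsetP => v vE; rewrite inE (subsetP (comp_sub _ _) _ vE) (@comp_id _ W x1) //.
have cE'y : conn (E' :|: [set y]).
  by apply: connU; rewrite ?comp_conn ?conn1 // touchC tyE.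
have E'E : [disjoint Xo & E'].
  by apply: disjointI => v vX /E'X; rewrite vX.
have yX : y \notin Xo by apply/negP => /XW; rewrite WE eqxx andbF.
have xX : x \notin Xo by apply/negP => /XW; rewrite WE eqxx.
have cX : c \notin Xo by apply/negP => /XW; rewrite WE eqxx !andbF.
(* If [x] saw [c], this edge would be a unique chord for the component [E] on the side of [x] and
   the component [E'] together with [y]. *)
have xc : ~~ adj x c.
  apply/negP => xc; apply: nuc; apply: (unique_chord xc (comp_conn W x1) cE'y) => //.
  - apply: disjointWl sEX _; apply: disjointI => v vX; rewrite inE => /orP[vE|/set1P ev].
      by rewrite (disjointFr E'E vX) in vE.
    by rewrite ev (negPf yX) in vX.
  - by apply: (touchI (set11 x) _ xy); rewrite !inE eqxx orbT.
  - by rewrite touchUr tcE.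
  - rewrite touchUr negb_or [touch E [set y]]touchC ntyE andbT.
    apply: (nbr_ntouch (compN x1 x1W)); first exact: disjointWl sEX E'E.
    by rewrite disjoint_sym disjoint_subset; apply/subsetP => v /(subsetP (comp_sub _ _));
      rewrite !inE.
have xnc : x != c by rewrite eq_sym.
have [x2 [x2y x2x1 xx2]] := degree3_other y x1 dx.
have x2W : x2 \in W.
  by rewrite WE x2y eq_sym adj_neq //=; apply: contraNneq xc => <-.
have x2X := inX x2 x2W xx2.
have outX v u (D : {set G}) : D \subset Xo -> v \notin Xo -> v != x -> v != u ->
    v \in ~: (D :|: [set x; u]).
  move=> sD vX vx vu; rewrite !inE !negb_or vx vu !andbT.
  by apply: contra vX => /(subsetP sD).
have yx : y != x by rewrite eq_sym adj_neq.
have yc : y != c by rewrite eq_sym.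
have y1X := E'X y1 (mem_comp y1W).
have [dc|dc] := leqP 3 (degree c).
  apply: (nc2 xnc xc dx dc xX cX NX).
    by apply/card_gt1P; exists x1, x2; rewrite ?x1X ?x2X // eq_sym.
  by apply/card_gt1P; exists y, y1; split; [apply: outX | apply: outX | apply: adj_neq].
(* A vertex of degree two is no end of a proper 2-cutset. Its neighbour [c1] in [Xo] takes its
   place: by [deg2_stable] it has degree at least three. *)
have {}dc : degree c = 2 by apply/eqP; rewrite eqn_leq -ltnS dc deg2.
have /touch1P[c1 c1E cc1] := tcX; have /touch1P[c2 c2E cc2] := tcE.
have c1X := subsetP sEX c1 c1E; have c2X := E'X c2 c2E.
have c12 : c1 != c2 by apply: contraNneq c2X => <-.
have dc1 : 3 <= degree c1.
  by rewrite ltn_neqAle deg2 eq_sym andbT (deg2_stable cc1).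
pose D := Xo :\ c1.
have sD : D \subset Xo := subsetDl _ _.
have ND : nbr D \subset [set x; c1].
  apply/subsetP => v /nbrP[vD [u /setD1P[uc1 uX] uv]]; rewrite !inE.
  have [vX|vX] := boolP (v \in Xo).
    by move: vD; rewrite in_setD1 vX andbT negbK => ->; rewrite orbT.
  have : v \in [set x; c] by apply: (subsetP NX); apply/nbrP; split=> //; exists u.
  rewrite !inE => /orP[->//|/eqP evc]; have cu : adj c u by rewrite adj_sym -evc.
  have [eu|eu] := degree2_nbr dc cc1 cc2 c12 cu; first by rewrite eu eqxx in uc1.
  by rewrite -eu uX in c2X.
have xD : x \notin D by apply: contra xX => /(subsetP sD).
have c1D : c1 \notin D by rewrite !inE eqxx.
have xc1' : x != c1 by apply: contraNneq xX => ->.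
(* The argument for [xc] again: a component of [D] on one side, and [E'] with [y] and [c] on the
   other. *)
have xc1 : ~~ adj x c1.
  apply/negP => xc1; have [u uD] : exists u, u \in D.
    have [e|ne] := eqVneq x1 c1; last by exists x1; rewrite in_setD1 ne x1X.
    by exists x2; rewrite in_setD1 x2X -e x2x1.
  have sA : compo D u \subset D := comp_sub _ _.
  have NA : nbr (compo D u) \subset [set x; c1].
    apply/subsetP => v vN; apply: (subsetP ND); apply/nbrP; split.
      by have := subsetP (nbr_comp D u) v vN; rewrite inE.
    by case/nbrP: vN => _ [t tA tv]; exists t; rewrite // (subsetP sA).
  have notA v : v \notin D -> v \notin compo D u by apply: contra => /(subsetP sA).
  have A0 : compo D u != set0 by apply/set0Pn; exists u; apply: mem_comp.
  have [txA tcA] := comp_touch2 nc1 A0 NA xc1' (notA x xD) (notA c1 c1D).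
  have cB : conn (E' :|: [set y] :|: [set c]).
    by apply: connU; rewrite ?conn1 // touchC touchUr tcE.
  have XB : [disjoint Xo & E' :|: [set y] :|: [set c]].
    apply: disjointI => v vX; case/setUP => [/setUP[vE|/set1P ev]|/set1P ev].
    + by have := E'X v; rewrite vX => /(_ vE).
    + by rewrite -ev vX in yX.
    + by rewrite -ev vX in cX.
  apply: nuc; apply: (unique_chord xc1 (comp_conn D u) cB) => //.
  - exact: disjointWl (subset_trans sA sD) XB.
  - by apply: (touchI (set11 x) _ xy); rewrite !inE eqxx orbT.
  - by apply: (touchI (set11 c1) (b := c)); rewrite 1?adj_sym // !inE eqxx orbT.
  - apply: (nbr_ntouch NA); first exact: disjointWl (subset_trans sA sD) XB.
    apply: disjointI => v /set2P[]->; last by rewrite (disjointFr XB).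
    have xE : x \notin E' := compX y1 x xS.
    by rewrite !in_setU !in_set1 (negPf xE) eq_sym (negPf yx) (negPf xnc).
apply: (nc2 xc1' xc1 dx dc1 xD c1D ND).
  apply/card_gt1P; exists x1, x2; split; last by rewrite eq_sym.
    by rewrite in_setD1 x1X andbT; apply: contraNneq xc1 => <-.
  by rewrite in_setD1 x2X andbT; apply: contraNneq xc1 => <-.
have yc1 : y != c1 by apply: contraNneq yX => ->.
have cc1' : c != c1 by apply: contraNneq cX => ->.
by apply/card_gt1P; exists y, c; split; [apply: outX | apply: outX |].
Qed.

(* Growing a pair of disjoint connections from [x]: one reaches [v] and the other is
   adjacent to [v]. The edge [x y] must not be used, hence the removal of [y]. *)
Let tx P := touch [set x] (P :\ y).
Let fan v P Q := [/\ conn P, conn Q, [disjoint P & Q], x \notin P & x \notin Q] /\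
  [/\ v \in P, tx P, tx Q & touch [set v] Q].

Let txS P Q : P \subset Q -> tx P -> tx Q.
Proof. by move=> sPQ; apply: touchS; rewrite ?setSD. Qed.

Lemma fan_step w v : v != x -> adj w v ->
  (exists P Q, fan w P Q) -> exists P Q, fan v P Q.
Proof.
move=> vx wv exP; have vw : v != w by rewrite eq_sym adj_neq.
have [P [Q [[[cP cQ dPQ xP xQ] [wP tP tQ twQ]] minP]]] : exists P Q, fan w P Q /\
    forall P' Q', fan w P' Q' -> #|P| <= #|P'|.
  have [n [P [Q [fPQ en]]] minn] := @ex_min_nat (fun n => exists P Q, fan w P Q /\ #|P| = n)
    (let: ex_intro P (ex_intro Q f) := exP in
      ex_intro _ #|P| (ex_intro _ P (ex_intro _ Q (conj f erefl)))).
  by exists P, Q; split=> // P' Q' f; rewrite en; apply: minn; exists P', Q'.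
have vw' : adj v w by rewrite adj_sym.
have wx : w != x by apply: contraNneq xP => <-.
have tvP : touch [set v] P by apply: touchI vw'; rewrite ?set11.
have [vQ|vQ] := boolP (v \in Q).
  by exists Q, P; split; split; rewrite // disjoint_sym.
have [vP|vP] := boolP (v \in P).
  (* By minimality the component [K] of [w] does not see [x]. It goes to [Q], which thereby becomes
     adjacent to [v]. *)
  pose K := compo (P :\ v) w.
  have sKP : K \subset P by apply: subset_trans (comp_sub _ _) (subsetDl _ _).
  have vK : v \notin K by apply/negP => /(subsetP (comp_sub _ _)); rewrite !inE eqxx.
  have wK : w \in K by apply: mem_comp; rewrite !inE eq_sym vw wP.
  have ntK : ~~ tx K.
    apply/negP => tK; have : #|P| <= #|K|.
      apply: (minP K Q); split; split; rewrite ?comp_conn //; first exact: disjointWl dPQ.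
      by apply: contra xP => /(subsetP sKP).
    by rewrite leqNgt proper_card // properE sKP; apply/subsetPn; exists v.
  exists (P :\: K), (Q :|: K); split; split=> //.
  - exact: conn_minus_comp.
  - apply: connU; rewrite ?comp_conn // touchC; apply/orP; left.
    by apply: touchS twQ; rewrite ?sub1set.
  - apply: disjointI => z /setDP[zP zK] /setUP[zQ|]; last by rewrite (negPf zK).
    by rewrite (disjointFr dPQ zP) in zQ.
  - by rewrite inE (negPf xP) andbF.
  - by rewrite inE (negPf xQ) /=; apply: contra xP => /(subsetP sKP).
  - by rewrite inE vK.
  - have /touch1P[p /setD1P[py pP] xp] := tP; apply: (touchI (set11 x) _ xp).
    rewrite in_setD1 in_setD py pP andbT; apply: contra ntK => pK.
    by apply: (touchI (set11 x) _ xp); rewrite in_setD1 py.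
  - by apply: txS tQ; apply: subsetUl.
  - by apply: (touchI (set11 v) _ vw'); rewrite inE wK orbT.
pose W := ~: (x |: (P :|: Q)); pose R := compo W v.
have vW : v \in W by rewrite !inE !negb_or vx vP.
have vR : v \in R := mem_comp vW.
have RW z : z \in R -> [/\ z != x, z \notin P & z \notin Q].
  by move/(subsetP (comp_sub _ _)); rewrite !inE !negb_or => /and3P[].
have xR : x \notin R by apply/negP => /RW[]; rewrite eqxx.
have dRP : [disjoint R & P] by apply: disjointI => z /RW[_ /negP].
have dRQ : [disjoint R & Q] by apply: disjointI => z /RW[_ _ /negP].
have [tR|ntR] := boolP (tx R).
  by exists R, P; split; split=> //; apply: comp_conn.
have [tRQ|ntRQ] := boolP (touch R Q).
  exists (R :|: Q), P; split; split=> //.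
  - by apply: connU; rewrite ?comp_conn ?tRQ.
  - by apply: disjointI => z /setUP[/(disjointFr dRP)->//|/(disjointFl dPQ)->].
  - by rewrite inE negb_or xR.
  - by rewrite inE vR.
  - by apply: txS tQ; apply: subsetUr.
have [/touchP[z [r [zR /setD1P[rw rP] zr]]]|ntRP] := boolP (touch R (P :\ w)).
  (* The part [K] of [P] that [R] sees reaches [x], as [P] could be reduced by [K] otherwise. It
     connects [v] to [x] through [R], while [w] moves to [Q]. *)
  pose K := compo (P :\ w) r.
  have sKPw : K \subset P :\ w := comp_sub _ _.
  have sKP : K \subset P by apply: subset_trans sKPw (subsetDl _ _).
  have wK : w \notin K by apply/negP => /(subsetP sKPw); rewrite !inE eqxx.
  have rK : r \in K by apply: mem_comp; rewrite !inE rw rP.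
  have tK : tx K.
    apply: contraT => ntK; have : #|P| <= #|P :\: K|.
      apply: (minP _ Q); split; split=> //.
      - exact: conn_minus_comp.
      - by apply: disjointWl dPQ; apply: subsetDl.
      - by rewrite inE (negPf xP) andbF.
      - by rewrite inE wK.
      have /touch1P[p /setD1P[py pP] xp] := tP; apply: (touchI (set11 x) _ xp).
      rewrite in_setD1 in_setD py pP andbT; apply: contra ntK => pK.
      by apply: (touchI (set11 x) _ xp); rewrite in_setD1 py.
    rewrite leqNgt proper_card // properE subsetDl; apply/subsetPn; exists r => //.
    by rewrite inE rK.
  exists (K :|: R), (Q :|: [set w]); split; split=> //.
  - by apply: connU; rewrite ?comp_conn // (touchI rK zR) // adj_sym.
  - by apply: connU; rewrite ?conn1 // touchC twQ.
  - apply: disjointI => u /setUP[uK|uR] /setUP[uQ|/set1P uw].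
    + by rewrite (disjointFr dPQ) ?(subsetP sKP) in uQ.
    + by rewrite uw (negPf wK) in uK.
    + by rewrite (disjointFr dRQ) in uQ.
    + by have [_] := RW u uR; rewrite uw wP.
  - by rewrite inE negb_or xR andbT; apply: contra xP => /(subsetP sKP).
  - by rewrite !inE negb_or xQ eq_sym.
  - by rewrite inE vR orbT.
  - by apply: txS tK; apply: subsetUl.
  - by apply: txS tQ; apply: subsetUl.
  - by apply: (touchI (set11 v) _ vw'); rewrite !inE eqxx orbT.
have NR u : u \in nbr R -> u = w \/ u = x.
  move=> uN; have := subsetP (nbr_comp W v) u uN; rewrite setCK.
  have tuR := nbr_touch uN; case/setU1P=> [|/setUP[uP|uQ]]; [by right | left | exfalso].
    apply/eqP; apply: contraR ntRP => uw; rewrite touchC; apply: touchS tuR => //.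
    by rewrite sub1set in_setD1 uw.
  by case/negP: ntRQ; rewrite touchC; apply: touchS tuR; rewrite ?sub1set.
have wR : w \notin R by apply: contraL wP => /RW[].
(* Now [R] sees at most [w] and [x], and [x] only through [y]. If [y] is outside [R], then [w] is a
   1-cutset. If [y] is inside, the set given by [link_avoid] lies in [R] and leads to [x] without
   using [y]. *)
have [yR|yR] := boolP (y \in R); last first.
  have /setP/(_ x) : w |: R = setT.
    apply: nc1 => //; first by apply/set0Pn; exists v.
    apply/subsetP => u uN; rewrite inE; have [->//|eu] := NR u uN.
    case/negP: ntR; have /nbr_touch/touch1P[t tR ut] := uN.
    by apply: (touchI (set11 x) _ (b := t)); rewrite -?eu // in_setD1 tR andbT;
      apply: contraNneq yR => <-.
  by rewrite in_setU1 in_setT eq_sym (negPf wx) (negPf xR).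
have wy : w != y by apply: contraNneq wR => ->.
have [S [cS sS txS' tyS]] := link_avoid wx wy.
have SE z : z \in S -> [/\ z != x, z != y & z != w].
  by move/(subsetP sS); rewrite !inE !negb_or => /andP[/andP[]].
have clR z u : z \in R -> u \in S -> adj z u -> u \in R.
  move=> zR uS zu; apply: contraT => uR; have [ux _ uw] := SE u uS.
  have : u \in nbr R by apply/nbrP; split=> //; exists z.
  by case/NR=> e; [rewrite e eqxx in uw | rewrite e eqxx in ux].
have sSR : S \subset R.
  rewrite -(conn_cut (A := S :&: R) cS) ?subsetIl ?subsetIr //.
    have /touch1P[t tS yt] := tyS; apply/set0Pn; exists t.
    by rewrite inE tS (clR y).
  by move=> z u /setIP[zS zR] uS zu; rewrite inE uS (clR z).
case/negP: ntR; apply: touchS txS' => //; apply/subsetP => z zS.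
by have [_ zy _] := SE z zS; rewrite in_setD1 zy (subsetP sSR).
Qed.

(** A fan at a neighbour [x1] of [x] is moved to [y] within the connected complement of [x]. In the
    end [P] contains [y]; a component of [P :\ y] that sees [x] also sees [y] and replaces [P]. *)
Lemma fan_ladder : exists P Q, [/\ conn P, conn Q & [disjoint P & Q]] /\
  [/\ touch [set x] P, touch [set y] P, touch [set x] Q & touch [set y] Q] /\
  [/\ x \notin P, y \notin P, x \notin Q & y \notin Q].
Proof.
have yx : y != x by rewrite eq_sym adj_neq.
have [P [Q [[cP cQ dPQ xP xQ] [yP tP tQ tyQ]]]] : exists P Q, fan y P Q.
  have [x1 [x1y _ xx1]] := degree3_other y y dx.
  have [x2 [x2y x2x1 xx2]] := degree3_other y x1 dx.
  have x1x : x1 != x by rewrite eq_sym adj_neq.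
  have x2x : x2 != x by rewrite eq_sym adj_neq.
  have yS : y \in ~: [set x] by rewrite !inE.
  have x1S : x1 \in ~: [set x] by rewrite !inE.
  have ind := @conn_ind _ (fun v => exists P Q, fan v P Q) _ (conn_setC1 nc1 x) x1S.
  apply: ind yS => [|v w _]; last first.
    by rewrite !inE => wx vw; apply: fan_step.
  have x2W : x2 \notin [set x; x1] by rewrite !inE negb_or x2x.
  have xx1' : x != x1 by rewrite eq_sym.
  have [_ t1] := comp2_touch nc1 x2W xx1'.
  have sC := comp_sub (~: [set x; x1]) x2.
  exists [set x1], (compo (~: [set x; x1]) x2); split; split;
    rewrite ?conn1 ?comp_conn ?set11 //.
  - by rewrite disjoints1; apply/negP => /(subsetP sC); rewrite !inE eqxx orbT.
  - by rewrite inE.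
  - by apply/negP => /(subsetP sC); rewrite !inE eqxx.
  - by apply: (touchI (set11 x) _ xx1); rewrite !inE x1y eqxx.
  - by apply: (touchI (set11 x) _ xx2); rewrite in_setD1 x2y mem_comp // inE.
have /touch1P[p /setD1P[py pP] xp] := tP.
pose K := compo (P :\ y) p.
have pK : p \in K by apply: mem_comp; rewrite !inE py.
have sKP : K \subset P by apply: subset_trans (comp_sub _ _) (subsetDl _ _).
have yK : y \notin K by apply/negP => /(subsetP (comp_sub _ _)); rewrite !inE eqxx.
have tyK : touch [set y] K.
  have [||a [b [aK /setDP[bP bK] ab]]] := conn_exit cP sKP.
  - by apply/set0Pn; exists p.
  - by apply: contraNneq yK => ->.
  have [<-|nby] := eqVneq b y; first by apply: (touchI (set11 b) aK); rewrite adj_sym.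
  by case/negP: bK; apply: comp_closed aK _ ab; rewrite !inE nby.
exists K, Q; split; last split; split; rewrite ?comp_conn //.
- exact: disjointWl dPQ.
- exact: touchI (set11 x) pK xp.
- by apply: touchS tQ => //; apply: subsetDl.
- by apply: contra xP => /(subsetP sKP).
- by rewrite (disjointFr dPQ).
Qed.
End Fan.
End Ladder.

(** * Cycles with crossing chords *)

Lemma uniq_count_le (T : eqType) (s1 s2 : seq T) : uniq s2 ->
  (forall x, count_mem x s1 <= count_mem x s2) -> uniq s1.
Proof.
move=> us le; apply: count_mem_uniq => x; have := le x.
rewrite (count_uniq_mem _ us) => le1.
have {le1} : count_mem x s1 <= 1 by apply: leq_trans le1 (leq_b1 _).
by case: (boolP (x \in s1)) => [|/count_memPn-> //]; rewrite -has_pred1 has_count => /= ? ?;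
  apply/eqP; rewrite eqn_leq; apply/andP.
Qed.

Ltac by_hyp := match goal with H : ?P |- ?P => exact H end.

Ltac count_lia := rewrite -?cats1 /= ?(count_cat, count_rev, size_cat, size_rev, size_rcons)
  /= ?(count_cat, count_rev, size_cat, size_rev, size_rcons) /= ?(count_cat, count_rev,
    size_cat, size_rev, size_rcons) /=; clear; lia.

Section CrossedCycle.
Variable G : sgraph.
Implicit Types (x y z a b u v w : G) (p q l : seq G).
Hypothesis sq_free : forall x y z t : G, adj x y -> adj y z -> adj z t -> adj t x ->
  x != z -> y != t -> False.
Hypothesis nuc : ~ has_cycle_with_unique_chord G.

Definition seg u l v := path (@adj G) u (rcons l v).

Lemma seg_cat u l z l' v : seg u (l ++ z :: l') v = seg u l z && seg z l' v.
Proof. by rewrite /seg rcons_cat cat_path /= [in RHS]rcons_path andbA. Qed.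

Lemma seg_cons u z l v : seg u (z :: l) v = adj u z && seg z l v.
Proof. by []. Qed.

Lemma seg_nil u v : seg u [::] v = adj u v.
Proof. by rewrite /seg /= andbT. Qed.

Lemma seg_rev u l v : seg u (rev l) v = seg v l u.
Proof.
rewrite /seg -[u in LHS](last_rcons v l) -rev_cons.
have -> : rev (v :: l) = rev (belast v (rcons l u)) by rewrite belast_rcons.
rewrite last_rcons -{1}[u](last_rcons v l) rev_path; apply: eq_path => a b /=.
exact: adj_sym.
Qed.

Definition chorded_cycle u p v q :=
  [&& adj u v, p != [::], q != [::], seg u p v, seg v q u & uniq (u :: p ++ v :: q)].

Definition min_chorded u p v q := chorded_cycle u p v q /\
  forall u' p' v' q', chorded_cycle u' p' v' q' -> size p + size q <= size p' + size q'.

Lemma min_chordedC u p v q : min_chorded u p v q -> min_chorded v q u p.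
Proof.
case=> /and5P[uv p0 q0 up /andP[vq us]] mn; split; last by rewrite addnC.
rewrite /chorded_cycle adj_sym uv p0 q0 up vq -cat_cons uniq_catC; exact: us.
Qed.

Lemma min_chorded_rev u p v q : min_chorded u p v q -> min_chorded v (rev p) u (rev q).
Proof.
case=> /and5P[uv p0 q0 up /andP[vq us]] mn; split; last by rewrite !size_rev.
rewrite /chorded_cycle adj_sym uv !seg_rev up vq -!size_eq0 !size_rev !size_eq0 p0 q0 !andTb.
apply: (uniq_count_le us) => z; rewrite /= !count_cat /= !count_rev; lia.
Qed.

Lemma min_chorded_le u p v q u' p' v' q' : min_chorded u p v q -> adj u' v' ->
  p' != [::] -> q' != [::] -> seg u' p' v' -> seg v' q' u' ->
  (forall z, count_mem z (u' :: p' ++ v' :: q') <= count_mem z (u :: p ++ v :: q)) ->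
  size p + size q <= size p' + size q'.
Proof.
case=> /and5P[_ _ _ _ /andP[_ us]] mn uv p0 q0 sp sq le; apply: (mn u' p' v' q').
by rewrite /chorded_cycle uv p0 q0 sp sq (uniq_count_le us le).
Qed.

Section Minimal.
Variables (x y : G) (p q : seq G).
Hypothesis mn : min_chorded x p y q.

Let sp : seg x p y. Proof. by case: mn => /and5P[]. Qed.
Let sq : seg y q x. Proof. by case: mn => /and5P[_ _ _ _ /andP[]]. Qed.
Let q0 : q != [::]. Proof. by case: mn => /and5P[]. Qed.
Let xy : adj x y. Proof. by case: mn => /and5P[]. Qed.

Lemma no_chord_end l1 b l2 : p = l1 ++ b :: l2 -> l1 != [::] -> ~~ adj x b.
Proof.
move=> e l0; apply/negP => xb; have := sp; rewrite e seg_cat => /andP[_ s2].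
have : size p + size q <= size (b :: l2) + size q.
  apply: (min_chorded_le mn xy) => //; first by rewrite seg_cons xb.
  by move=> z; rewrite e; count_lia.
move: l0; rewrite e -size_eq0; count_lia.
Qed.

Lemma no_chord_in l1 a l2 b l3 : p = l1 ++ a :: l2 ++ b :: l3 -> l2 != [::] -> ~~ adj a b.
Proof.
move=> e l0; apply/negP => ab; have := sp; rewrite e seg_cat seg_cat => /and3P[s1 _ s3].
have : size p + size q <= size (l1 ++ a :: b :: l3) + size q.
  apply: (min_chorded_le mn xy) => //; first by case: (l1).
    by rewrite seg_cat s1 seg_cons ab.
  by move=> z; rewrite e; count_lia.
move: l0; rewrite e -size_eq0; count_lia.
Qed.

Lemma no_chord_past l1 a l2 b : p = l1 ++ a :: l2 -> l1 != [::] -> b \in a :: l2 -> ~~ adj x b.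
Proof.
move=> e l0 bl; have [c1 [c2 ec]] := mem_split bl.
apply: (no_chord_end (l1 := l1 ++ c1) (l2 := c2)); first by rewrite e ec catA.
by case: (l1) l0.
Qed.

Lemma no_chord_across l1 a l2 b c : p = l1 ++ a :: l2 -> b \in l1 -> c \in l2 -> ~~ adj b c.
Proof.
move=> e /mem_split[c1 [c2 ec]] /mem_split[d1 [d2 ed]].
apply: (no_chord_in (l1 := c1) (l2 := c2 ++ a :: d1) (l3 := d2)); last by case: (c2).
by rewrite e ec ed -!catA.
Qed.

Section Crossing.
Variables (z w : G) (p1 p2 q1 q2 : seq G).
Hypotheses (ep : p = p1 ++ z :: p2) (eq : q = q1 ++ w :: q2) (zw : adj z w).

Let xp1 : seg x p1 z. Proof. by have := sp; rewrite ep seg_cat => /andP[]. Qed.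
Let zp2 : seg z p2 y. Proof. by have := sp; rewrite ep seg_cat => /andP[]. Qed.
Let yq1 : seg y q1 w. Proof. by have := sq; rewrite eq seg_cat => /andP[]. Qed.
Let wq2 : seg w q2 x. Proof. by have := sq; rewrite eq seg_cat => /andP[]. Qed.
Let szpq : size p + size q = (size p1 + size p2 + size q1 + size q2).+2.
Proof. by rewrite ep eq !size_cat /=; clear; lia. Qed.
Let cpq t : count_mem t (x :: p ++ y :: q) =
  (x == t) + count_mem t p1 + (z == t) + count_mem t p2 + (y == t) +
  count_mem t q1 + (w == t) + count_mem t q2.
Proof. by rewrite ep eq; count_lia. Qed.

Let cle t : count_mem t (x :: p ++ y :: q) <= 1.
Proof. by rewrite count_uniq_mem ?leq_b1 //; case: mn => /and5P[_ _ _ _ /andP[]]. Qed.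

(** The edge [zb] would be a chord of the cycle formed by [p2], [y], [q1] and the edge [zw], which
    is shorter since it avoids [x]. *)
Lemma no_edge_z_q1 b : b \in q1 -> ~~ adj z b.
Proof.
move=> bq; apply/negP => zb; have [c1 [c2 e]] := mem_split bq.
have := yq1; rewrite e seg_cat => /andP[s1 s2].
have : size p + size q <= size (p2 ++ y :: c1) + size (rcons c2 w).
  apply: (min_chorded_le mn zb); rewrite ?seg_cat ?zp2 //.
  - by case: (p2).
  - by case: (c2).
  - by rewrite -cats1 seg_cat s2 seg_nil adj_sym.
  by move=> t; rewrite cpq e; count_lia.
rewrite szpq e; count_lia.
Qed.

(** The edge [ab] would shorten the cycle by bypassing [x]; the chord is then [zw]. *)
Lemma no_edge_p1_q2 a b : a \in p1 -> b \in q2 -> ~~ adj a b.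
Proof.
move=> ap bq; apply/negP => ab; have [c1 [c2 ec]] := mem_split ap.
have [d1 [d2 ed]] := mem_split bq.
have := xp1; rewrite ec seg_cat => /andP[s1 s2].
have := wq2; rewrite ed seg_cat => /andP[s3 s4].
have : size p + size q <= size (p2 ++ y :: q1) + size (d1 ++ b :: a :: c2).
  apply: (min_chorded_le mn zw).
  - by case: (p2).
  - by case: (d1).
  - by rewrite seg_cat zp2.
  - by rewrite seg_cat seg_cons s3 adj_sym ab.
  by move=> t; rewrite cpq ec ed; count_lia.
rewrite szpq ec ed; count_lia.
Qed.

(** Crossing over along [ab] and along [zw] gives a cycle that still has the chord [xy]. It is
    shorter unless [a] is next to [z] and [b] next to [w], and then [a], [b], [w], [z] form a
    square. *)
Lemma no_edge_p1_q1 a b : a \in p1 -> b \in q1 -> ~~ adj a b.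
Proof.
move=> ap bq; apply/negP => ab; have [c1 [c2 ec]] := mem_split ap.
have [d1 [d2 ed]] := mem_split bq.
have := xp1; rewrite ec seg_cat => /andP[s1 s2].
have := yq1; rewrite ed seg_cat => /andP[s3 s4].
have : size p + size q <= size (c1 ++ a :: b :: rev d1) + size (rev p2 ++ z :: w :: q2).
  apply: (min_chorded_le mn xy).
  - by case: (c1).
  - by case: (rev p2).
  - by rewrite seg_cat seg_cons s1 ab seg_rev.
  - by rewrite seg_cat seg_cons seg_rev zp2 zw.
  by move=> t; rewrite cpq ec ed; count_lia.
have [c20|c20] := eqVneq c2 [::]; last first.
  rewrite szpq ec ed; move: c20; rewrite -size_eq0; count_lia.
have [d20|d20] := eqVneq d2 [::]; last first.
  rewrite szpq ec ed; move: d20; rewrite -size_eq0; count_lia.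
move=> _; rewrite c20 seg_nil in s2; rewrite d20 seg_nil in s4.
have [aw bz] : a != w /\ b != z.
  split; apply/eqP => e.
    by have := cle a; rewrite cpq ec e count_cat /= !eqxx; clear; lia.
  by have := cle b; rewrite cpq ed e count_cat /= !eqxx; clear; lia.
by apply: (sq_free ab s4 _ _ aw bz); rewrite // adj_sym.
Qed.
End Crossing.
End Minimal.

(* Failed unifications would otherwise unfold the finite quantifiers in these predicates. *)
Opaque conn touch.

(** The list puts the sets at the positions a3, a4, a5, b1, ..., b5 of the Petersen graph, whose
    adjacent vertices a1 and a2 are deleted. The four path segments [A], [B], [C], [D] are at the
    positions of degree two. *)
Lemma crossed_model (phi : nat -> {set G}) (A B C D X Y Z W : {set G}) x y z w :
  phi =1 nth set0 [:: A; X; D; B; Z; W; C; Y] ->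
  (forall i j, i != j -> [disjoint phi i & phi j]) ->
  [/\ X = [set x], Y = [set y], Z = [set z] & W = [set w]] ->
  [/\ conn A, conn B, conn C & conn D] ->
  [/\ touch X A, touch Z A, touch Z B & touch Y B] ->
  [/\ touch Y C, touch W C, touch W D & touch X D] -> touch X Y -> touch Z W ->
  [/\ ~~ touch X B, ~~ touch X Z, ~~ touch X C & ~~ touch X W] ->
  [/\ ~~ touch Y A, ~~ touch Y Z, ~~ touch Y D & ~~ touch Y W] ->
  [/\ ~~ touch Z C, ~~ touch Z D, ~~ touch W A & ~~ touch W B] ->
  [/\ ~~ touch A B, ~~ touch C D, ~~ touch A C & ~~ touch A D] -> ~~ touch C B -> ~~ touch B
    D ->
  model phi (nth (Cfg [::] [::] [::]) cfgs 0).
Proof.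
have -> : nth (Cfg [::] [::] [::]) cfgs 0 =
    let rows := [:: [:: 1; 4]; [:: 0; 2; 7]; [:: 1; 5]; [:: 4; 7]; [:: 3; 5; 0];
                    [:: 4; 6; 2]; [:: 5; 7]; [:: 6; 3; 1]] in
    Cfg rows rows [:: false; true; false; false; true; true; false; true].
  by vm_compute.
move=> ephi dphi [eX eY eZ eW] [cA cB cC cD] [XA ZA ZB YB] [YC WC WD XD] XY ZW.
move=> [XB XZ XC XW] [YA YZ YD YW] [ZC ZD WA WB] [AB CD AC AD] CB BD.
have cX : conn X by rewrite eX conn1.
have cY : conn Y by rewrite eY conn1.
have cZ : conn Z by rewrite eZ conn1.
have cW : conn W by rewrite eW conn1.
have tC (S T : {set G}) : touch S T -> touch T S by rewrite touchC.
have ntC (S T : {set G}) : ~~ touch S T -> ~~ touch T S by rewrite touchC.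
split.
- case=> [|[|[|[|[|[|[|[|i]]]]]]]] lt; rewrite ephi /=; first [by_hyp | case: (notF lt)].
- by case=> [|[|[|[|[|[|[|[|i]]]]]]]]; rewrite /single /= ?nth_nil // => _; rewrite ephi;
  [exists x | exists z | exists w | exists y].
- by move=> i j _ _; apply: dphi.
- case=> [|[|[|[|[|[|[|[|i]]]]]]]] //; case=> [|[|[|[|[|[|[|[|j]]]]]]]] // _ _;
  rewrite !ephi /=; (split; first by []);
    first [by_hyp | apply: tC; by_hyp].
- case=> [|[|[|[|[|[|[|[|i]]]]]]]] //; case=> [|[|[|[|[|[|[|[|j]]]]]]]] // _ _ _ _;
  rewrite !ephi /=; first [by_hyp | apply: ntC; by_hyp].
Qed.

Transparent conn touch.

Section Model.
Variables (x y : G) (p q : seq G) (z w : G) (p1 p2 q1 q2 : seq G).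
Hypothesis mn : min_chorded x p y q.
Hypotheses (ep : p = p1 ++ z :: p2) (eq : q = q1 ++ w :: q2) (zw : adj z w).

Let sp : seg x p1 z && seg z p2 y.
Proof. by rewrite -seg_cat -ep; case: mn => /and5P[]. Qed.
Let sq : seg y q1 w && seg w q2 x.
Proof. by rewrite -seg_cat -eq; case: mn => /and5P[_ _ _ _ /andP[]]. Qed.
Let us : uniq (x :: p ++ y :: q).
Proof. by case: mn => /and5P[_ _ _ _ /andP[]]. Qed.
Let xy : adj x y. Proof. by case: mn => /and5P[]. Qed.
Let cpq t : (x == t) + count_mem t p1 + (z == t) + count_mem t p2 + (y == t) +
  count_mem t q1 + (w == t) + count_mem t q2 <= 1.
Proof.
apply: leq_trans (leq_b1 (t \in x :: p ++ y :: q)); rewrite -(count_uniq_mem _ us) ep eq.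
by count_lia.
Qed.
Let cmem t (l : seq G) : t \in l -> 0 < count_mem t l.
Proof. by rewrite -has_count has_pred1. Qed.
Let wz : adj w z. Proof. by rewrite adj_sym. Qed.

Let mnC := min_chordedC mn.
Let mnR := min_chorded_rev mn.
Let mnCR := min_chorded_rev mnC.
Let er : rev p = rev p2 ++ z :: rev p1.
Proof. by rewrite ep rev_cat rev_cons cat_rcons. Qed.
Let fr : rev q = rev q2 ++ w :: rev q1.
Proof. by rewrite eq rev_cat rev_cons cat_rcons. Qed.

Let z_q1 b : b \in q1 -> ~~ adj z b. Proof. exact: (no_edge_z_q1 mn ep eq zw). Qed.
Let w_p1 b : b \in p1 -> ~~ adj w b. Proof. exact: (no_edge_z_q1 mnC eq ep wz). Qed.
Let z_q2 b : b \in q2 -> ~~ adj z b.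
Proof. rewrite -mem_rev; exact: (no_edge_z_q1 mnR er fr zw). Qed.
Let w_p2 b : b \in p2 -> ~~ adj w b.
Proof. rewrite -mem_rev; exact: (no_edge_z_q1 mnCR fr er wz). Qed.
Let p1_q2 a b : a \in p1 -> b \in q2 -> ~~ adj a b.
Proof. exact: (no_edge_p1_q2 mn ep eq zw). Qed.
Let q1_p2 a b : a \in q1 -> b \in p2 -> ~~ adj a b.
Proof. exact: (no_edge_p1_q2 mnC eq ep wz). Qed.
Let p1_q1 a b : a \in p1 -> b \in q1 -> ~~ adj a b.
Proof. exact: (no_edge_p1_q1 mn ep eq zw). Qed.
Let p2_q2 a b : a \in p2 -> b \in q2 -> ~~ adj a b.
Proof. rewrite -(mem_rev p2) -(mem_rev q2); exact: (no_edge_p1_q1 mnR er fr zw). Qed.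

(** If [p1] is empty, then [x] sees [z]. With [q1] empty as well, [x], [y], [w], [z] form a square;
    otherwise [xz] is a unique chord for the two remaining arcs, [y] with [p2] and [w] with [q2].
    Symmetry covers the other segments. *)
Lemma min_chorded_nonempty : p1 != [::].
Proof.
apply/eqP => p10; have xz : adj x z by have := sp; rewrite p10 seg_nil => /andP[].
have /andP[_ zp2] := sp; have /andP[yq1 wq2] := sq.
have [q10|q10] := eqVneq q1 [::].
  have yw : adj y w by have := yq1; rewrite q10 seg_nil.
  have [xw yz] : x != w /\ y != z.
    by split; apply/eqP => e; [have := cpq x | have := cpq y]; rewrite e !eqxx; clear; lia.
  by apply: (sq_free xy yw wz) => //; rewrite adj_sym.
apply: nuc; apply: (@unique_chord _ x z [set:: y :: rev p2] [set:: w :: q2] xz).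
- by apply: path_conn; have := zp2; rewrite -seg_rev /seg rcons_path => /andP[].
- by apply: path_conn; have := wq2; rewrite /seg rcons_path => /andP[].
- apply: disjointI => t; rewrite !in_set => t1 t2.
  have {t1} c1 : 0 < count_mem t (y :: p2).
    by rewrite -has_count has_pred1; move: t1; rewrite !in_cons mem_rev.
  have := cmem t2; move: c1 (cpq t) => /=; clear; lia.
- by apply: (touchI (set11 x) _ xy); rewrite inE mem_head.
- have := zp2; rewrite -seg_rev /seg rcons_path => /andP[_ lz].
  by apply: (touchI (set11 z) _ (b := last y (rev p2))); rewrite 1?adj_sym // inE mem_last.
- have := wq2; rewrite /seg rcons_path => /andP[_ lz].
  by apply: (touchI (set11 x) _ (b := last w q2)); rewrite 1?adj_sym // inE mem_last.
- by apply: (touchI (set11 z) _ zw); rewrite inE mem_head.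
apply/touchP => -[a [b []]]; rewrite !inE mem_rev => /predU1P[->|ap] bq; apply/negP.
  exact: (no_chord_past mnC eq).
move: bq; case/predU1P=> [->|]; last exact: p2_q2.
by rewrite adj_sym; apply: w_p2.
Qed.

Let L := [:: p1; [:: x]; q2; p2; [:: z]; [:: w]; q1; [:: y]].

Lemma chorded_model : p1 != [::] -> p2 != [::] -> q1 != [::] -> q2 != [::] ->
  exists phi : nat -> {set G}, model phi (nth (Cfg [::] [::] [::]) cfgs 0).
Proof.
move=> p10 p20 q10 q20.
have rev0 (l : seq G) : l != [::] -> rev l != [::] by rewrite -!size_eq0 size_rev.
have x_zp2 b : b \in z :: p2 -> ~~ adj x b := no_chord_past mn ep p10.
have y_wq2 b : b \in w :: q2 -> ~~ adj y b := no_chord_past mnC eq q10.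
have y_zp1 b : b \in z :: p1 -> ~~ adj y b.
  by move=> bz; apply: (no_chord_past mnR er (rev0 _ p20)); move: bz; rewrite !inE mem_rev.
have x_wq1 b : b \in w :: q1 -> ~~ adj x b.
  by move=> bz; apply: (no_chord_past mnCR fr (rev0 _ q20)); move: bz; rewrite !inE mem_rev.
have p1_p2 a b : a \in p1 -> b \in p2 -> ~~ adj a b := no_chord_across mn ep.
have q1_q2 a b : a \in q1 -> b \in q2 -> ~~ adj a b := no_chord_across mnC eq.
have /andP[xp1 zp2] := sp; have /andP[yq1 wq2] := sq.
have segN u l v : l != [::] -> seg u l v -> [/\ conn [set:: l], touch [set:: [:: u]] [set::
  l] & touch [set:: [:: v]] [set:: l]].
  case: l => // a l _; rewrite seg_cons => /andP[ua]; rewrite /seg rcons_path => /andP[al lv].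
  split; first exact: path_conn.
    by apply: (touchI _ _ ua); rewrite inE mem_head.
  by apply: (touchI (a := v) (b := last a l)); rewrite 1?adj_sym // inE ?mem_head ?mem_last.
have [cp1 xtp1 ztp1] := segN _ _ _ p10 xp1; have [cp2 ztp2 ytp2] := segN _ _ _ p20 zp2.
have [cq1 ytq1 wtq1] := segN _ _ _ q10 yq1; have [cq2 wtq2 xtq2] := segN _ _ _ q20 wq2.
have [c1x c1y c1z c1w] : [/\ conn [set:: [:: x]], conn [set:: [:: y]], conn [set:: [:: z]] &
  conn [set:: [:: w]]] by split; rewrite set_cons set_nil setU0 conn1.
have t1 u v : adj u v -> touch [set:: [:: u]] [set:: [:: v]].
  by move=> uv; apply: touchI uv; rewrite inE mem_head.
have nt l l' : (forall a b, a \in l -> b \in l' -> ~~ adj a b) -> ~~ touch [set:: l] [set:: l'].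
  by move=> ll; apply/touchP => -[a [b [al bl ab]]]; rewrite inE in al; rewrite inE in bl;
    have := ll a b al bl; rewrite ab.
have nt1 u l : (forall b, b \in l -> ~~ adj u b) -> ~~ touch [set:: [:: u]] [set:: l].
  by move=> ul; apply: nt => a b; rewrite mem_seq1 => /eqP->; apply: ul.
have uL : uniq (flatten L).
  apply: uniq_count_le us _ => t; rewrite /L ep eq; count_lia.
have n1 : ~~ touch [set:: [:: x]] [set:: p2] by apply: nt1 => b bp; apply: x_zp2;
  rewrite inE bp orbT.
have n2 : ~~ touch [set:: [:: x]] [set:: [:: z]] by apply: nt1 => b /predU1P[->|//];
  apply: x_zp2; apply: mem_head.
have n3 : ~~ touch [set:: [:: x]] [set:: q1] by apply: nt1 => b bp; apply: x_wq1;
  rewrite inE bp orbT.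
have n4 : ~~ touch [set:: [:: x]] [set:: [:: w]] by apply: nt1 => b /predU1P[->|//];
  apply: x_wq1; apply: mem_head.
have n5 : ~~ touch [set:: [:: y]] [set:: p1] by apply: nt1 => b bp; apply: y_zp1;
  rewrite inE bp orbT.
have n6 : ~~ touch [set:: [:: y]] [set:: [:: z]] by apply: nt1 => b /predU1P[->|//];
  apply: y_zp1; apply: mem_head.
have n7 : ~~ touch [set:: [:: y]] [set:: q2] by apply: nt1 => b bp; apply: y_wq2;
  rewrite inE bp orbT.
have n8 : ~~ touch [set:: [:: y]] [set:: [:: w]] by apply: nt1 => b /predU1P[->|//];
  apply: y_wq2; apply: mem_head.
exists (fun i => [set:: nth [::] L i]).
apply: (@crossed_model _ [set:: p1] [set:: p2] [set:: q1] [set:: q2]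
  [set:: [:: x]] [set:: [:: y]] [set:: [:: z]] [set:: [:: w]] x y z w).
- move=> i; have := nth_map [::] set0 (fun l => [set:: l]) (s := L) (n := i).
  case: ltnP => [_ <- //|iL _]; by rewrite [in LHS]nth_default // nth_default ?set_nil.
- move=> i j ij; apply: disjointI => t; rewrite !in_set => ti tj.
  exact: uniq_flatten_disjoint uL ij ti tj.
- by rewrite !set_cons !set_nil !setU0.
- by [].
- by [].
- by [].
- by apply: t1.
- by apply: t1.
- by [].
- by [].
- by split; apply: nt1.
- by split; apply: nt.
- by apply: nt.
- by apply: nt.
Qed.
End Model.

Lemma min_chorded_model x y p q z w : min_chorded x p y q -> z \in p -> w \in q -> adj z w ->
  exists phi : nat -> {set G}, model phi (nth (Cfg [::] [::] [::]) cfgs 0).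
Proof.
move=> mn /mem_split[p1 [p2 ep]] /mem_split[q1 [q2 eq]] zw.
have wz : adj w z by rewrite adj_sym.
have er : rev p = rev p2 ++ z :: rev p1 by rewrite ep rev_cat rev_cons cat_rcons.
have fr : rev q = rev q2 ++ w :: rev q1 by rewrite eq rev_cat rev_cons cat_rcons.
have rev0 (l : seq G) : rev l != [::] -> l != [::] by rewrite -!size_eq0 size_rev.
apply: (chorded_model mn ep eq zw).
- exact: (min_chorded_nonempty mn ep eq zw).
- exact: rev0 (min_chorded_nonempty (min_chorded_rev mn) er fr zw).
- exact: (min_chorded_nonempty (min_chordedC mn) eq ep wz).
- exact: rev0 (min_chorded_nonempty (min_chorded_rev (min_chordedC mn)) fr er wz).
Qed.

(** The chorded cycle is taken shortest in the whole graph, so it may leave [x] and [y]. Its two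
    arcs see each other, or its chord would be unique; any edge between the arcs can serve as
    [zw]. *)
Lemma ladder_model x y (P Q : {set G}) : adj x y -> conn P -> conn Q -> [disjoint P & Q] ->
  touch [set x] P -> touch [set y] P -> touch [set x] Q -> touch [set y] Q ->
  [/\ x \notin P, y \notin P, x \notin Q & y \notin Q] ->
  exists phi : nat -> {set G}, model phi (nth (Cfg [::] [::] [::]) cfgs 0).
Proof.
move=> xy cP cQ dPQ xP yP xQ yQ [nxP nyP nxQ nyQ].
have [n [x' [y' [p [q [cc en]]]]] minn] : exists2 n,
    (exists x y p q, chorded_cycle x p y q /\ size p + size q = n) &
    forall m, (exists x y p q, chorded_cycle x p y q /\ size p + size q = m) -> n <= m.
  apply: ex_min_nat.
  have [p [p0 px pP up _]] := induced_path cP xP yP.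
  have [q [q0 qx qQ uq _]] := induced_path cQ yQ xQ.
  exists (size p + size q), x, y, p, q; split=> //.
  rewrite /chorded_cycle xy p0 q0 /seg px qx !andTb cons_uniq mem_cat in_cons !negb_or.
  rewrite adj_neq // cat_uniq up cons_uniq uq /= negb_or.
  rewrite (contra (pP x)) // (contra (qQ x)) // (contra (qQ y)) // (contra (pP y)) //= andbT.
  by apply/hasPn => t /qQ tQ; apply/negP => /= /pP tP; rewrite (disjointFr dPQ tP) in tQ.
have mn : min_chorded x' p y' q.
  by split=> // u p' v q' cc'; rewrite en; apply: minn; exists u, v, p', q'.
have /and5P[xy' p0 q0 sp /andP[sq us]] := cc.
have touch_ends u l v : l != [::] -> seg u l v ->
    [/\ conn [set:: l], touch [set u] [set:: l] & touch [set v] [set:: l]].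
  case: l => // a l _; rewrite seg_cons => /andP[ua]; rewrite /seg rcons_path => /andP[al lv].
  split; first exact: path_conn.
    by apply: (touchI (set11 u) _ ua); rewrite inE mem_head.
  by apply: (touchI (set11 v) (b := last a l)); rewrite 1?adj_sym // inE mem_last.
have [c1 t1 t2] := touch_ends _ _ _ p0 sp; have [c2 t3 t4] := touch_ends _ _ _ q0 sq.
have /touchP[z [w [zp wq zw]]] : touch [set:: p] [set:: q].
  apply: contraT => nt; case: nuc; apply: (unique_chord xy' c1 c2) => //.
  apply: disjointI => t; rewrite !in_set => tp tq.
  move: us; rewrite cons_uniq => /andP[_]; rewrite cat_uniq => /and3P[_ /hasPn no _].
  by have := no t; rewrite in_cons tq orbT /= tp => /(_ isT).
rewrite !in_set in zp wq; exact: (min_chorded_model mn zp wq zw).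
Qed.
End CrossedCycle.

(** * Assembling the cases *)

Lemma no_square_free (G : sgraph) :
  (forall x y z t : G, adj x y -> adj y z -> adj z t -> adj t x -> x != z -> y != t -> False) ->
  square_free G.
Proof.
move=> sq_free [s [[cs _ _] s4]]; case: s s4 cs => [|a [|b [|c [|d []]]]] // _.
rewrite /is_cycle /ucycleb /= !inE !negb_or andbT => /andP[/and4P[ab bc cd da]].
by case/and3P=> /and3P[_ ac _] /andP[_ bd] _; apply: sq_free ab bc cd da ac bd.
Qed.

Theorem theorem2p1 (G : sgraph)
    (G_conn : connected G) (G_chord : ~ has_cycle_with_unique_chord G) :
  strongly_2_bipartite G \/
  hole_graph_geq G 7 \/
  clique G \/
  contains petersen G \/
  contains heawood G \/
  (exists v : G, one_cutset v) \/
  (exists a b : G, proper_2_cutset a b) \/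
  (exists X Y A B : {set G}, proper_one_join X Y A B).
Proof.
have [?|not_clique] := classic (clique G); first by tauto.
have [?|/no_1_cutsetP nc1] := classic (exists v : G, one_cutset v); first by tauto.
have [?|/(no_2_cutsetP nc1) nc2] := classic (exists a b : G, proper_2_cutset a b).
  by tauto.
have [?|no_join] := classic (exists X Y A B : {set G}, proper_one_join X Y A B).
  by tauto.
have tri_free (x y z : G) : adj x y -> adj y z -> adj x z = false.
  move=> xy yz; apply/negP => xz.
  exact: not_clique (triangle_clique G_chord nc1 xy yz xz).
have sq_free (x y z t : G) : adj x y -> adj y z -> adj z t -> adj t x ->
    x != z -> y != t -> False.
  move=> xy yz zt tx xz yt.
  exact: no_join (square_join G_chord tri_free xy yz zt tx xz yt).
have deg2 := degree_ge2 G_conn nc1 not_clique.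
have [[x [y [xy [dx dy]]]]|deg2_adj] :=
    classic (exists x y : G, adj x y /\ degree x = 2 /\ degree y = 2).
  have [s th cl] := adjacent_degree2 G_conn G_chord nc1 nc2 deg2 xy dx dy.
  by have := closed_thread_hole tri_free sq_free th cl; tauto.
have deg2_stable (x y : G) : adj x y -> degree x = 2 -> degree y != 2.
  by move=> xy dx; apply/eqP => dy; apply: deg2_adj; exists x, y.
have [[x [y [xy [dx dy]]]]|deg3_adj] :=
    classic (exists x y : G, adj x y /\ 3 <= degree x /\ 3 <= degree y).
  have [P [Q [[cP cQ dPQ] [[xP yP xQ yQ] ends]]]] :=
    fan_ladder G_chord nc1 nc2 deg2 deg2_stable xy dx dy.
  have [phi M] := ladder_model sq_free G_chord xy cP cQ dPQ xP yP xQ yQ ends.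
  have hM : has_model G cfgs by exists (nth (Cfg [::] [::] [::]) cfgs 0); [left | exists phi].
  by have := model_contains tri_free sq_free G_chord nc1 nc2 hM; tauto.
(* What remains is that every edge joins a vertex of degree two to one of degree at least three. *)
left; split; first exact: no_square_free.
split.
- by apply/setP => x; rewrite !inE eq_sym -leq_eqVlt deg2.
- by apply: disjointI => x; rewrite !inE => /eqP->.
- by move=> x y; rewrite !inE => /eqP dx dy; apply/negP => xy;
  rewrite (negPf (deg2_stable x y xy dx)) in dy.
- by move=> x y; rewrite !inE => dx dy; apply/negP => xy; apply: deg3_adj; exists x, y.
Qed.
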